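(* Let $\beta>0$ and let $\rho_{\beta FTE_N}$ be the eigenvalue density of the fixed trace $\beta$-Hermite ensemble of size $N$. If $f\in C_c(\mathbb{R})$, then $$\lim_{N\to\infty}\int_{\mathbb{R}} f(x)\,\sqrt{2N}\,\rho_{\beta FTE_N}(\sqrt{2N}\,x)\,dx=\int_{\mathbb{R}} f(x)\,\rho_{\mathrm W}(x)\,dx,$$ where $\rho_{\mathrm W}(x)=\frac{2}{\pi}\sqrt{1-x^2}$ for $-1<x<1$ and $\rho_{\mathrm W}(x)=0$ for $|x|\ge 1$.
   Context: $C_c(\mathbb{R})$ is the set of continuous functions on $\mathbb{R}$ with compact support. For $\beta>0$ and $N\ge 2$, the fixed trace $\beta$-Hermite ensemble is the probability measure on $\mathbb{R}^N$ with (formal) density $$P_{\beta FTE_N}(x_1,\dots,x_N)=\frac{1}{Z_{\beta FTE_N}}\,\delta\Big(\sum_{i=1}^N x_i^2-\frac{N(N-1)}{2}\Big)\prod_{1\le j<k\le N}|x_j-x_k|^\beta,$$ i.e. the probability measure supported on the sphere $\sum_{i=1}^N x_i^2=N(N-1)/2$ whose density with respect to the surface measure of this sphere is proportional to $\prod_{j<k}|x_j-x_k|^\beta$. Its eigenvalue density (level density) $\rho_{\beta FTE_N}$ is the probability density on $\mathbb{R}$ of the one-dimensional marginal distribution of $x_1$ (it vanishes for $|x_1|>\sqrt{N(N-1)/2}$). *)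

(* Defs.v *)
From HB Require Import structures.
From mathcomp Require Import all_boot all_order all_algebra.
From mathcomp Require Import all_classical all_reals all_analysis.
From mathcomp Require Import measurable_realfun.

Set Implicit Arguments.
Unset Strict Implicit.
Unset Printing Implicit Defensive.

Import Order.TTheory GRing.Theory Num.Theory.
Import numFieldNormedType.Exports.

Local Open Scope classical_set_scope.
Local Open Scope ring_scope.

(* Vectors of R^n are n-tuples: the library equips n.-tuple R with the product
   sigma-algebra, i.e. with the Borel sets of R^n. *)

Section tcons.
Context {R : realType}.

Definition tcons n (p : measurableTypeR R * n.-tuple R) : n.+1.-tuple R :=
  [tuple of p.1 :: p.2].

Lemma measurable_tcons n : measurable_fun [set: _] (@tcons n).
Proof. exact: measurable_cons. Qed.

HB.instance Definition _ n :=
  isMeasurableFun.Build _ _ _ _ (@tcons n) (@measurable_tcons n).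

End tcons.

Section lebesgue_cons.
Context {R : realType} {n : nat}.
Variable mu : {sigma_finite_measure set (n.-tuple R) -> \bar R}.

Definition lebesgue_cons : set (n.+1.-tuple R) -> \bar R :=
  pushforward (@lebesgue_measure R \x mu)%E (@tcons R n).

Let lebesgue_cons0 : lebesgue_cons set0 = 0%E.
Proof. exact: measure0. Qed.

Let lebesgue_cons_ge0 A : (0 <= lebesgue_cons A)%E.
Proof. exact: measure_ge0. Qed.

Let lebesgue_cons_sigma_additive : semi_sigma_additive lebesgue_cons.
Proof. exact: measure_semi_sigma_additive. Qed.

HB.instance Definition _ := isMeasure.Build _ _ _ lebesgue_cons
  lebesgue_cons0 lebesgue_cons_ge0 lebesgue_cons_sigma_additive.

Let sigma_finite_lebesgue_cons : sigma_finite setT lebesgue_cons.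
Proof.
have /sigma_finiteP[F [TF ndF Foo]] := sigma_finiteT (@lebesgue_measure R).
have /sigma_finiteP[G [TG ndG Goo]] := sigma_finiteT mu.
pose h (t : n.+1.-tuple R) : measurableTypeR R * n.-tuple R :=
  (thead t, [tuple of behead t]).
have tconsK : cancel (@tcons R n) h.
  by move=> [a t]; congr pair; exact/val_inj.
have mh : measurable_fun [set: _] h.
  apply/measurable_fun_pairP; split.
    exact: (measurable_tnth ord0).
  exact: measurable_behead.
exists (fun k => h @^-1` (F k `*` G k)).
  rewrite -preimage_bigcup -[LHS](preimage_setT h); congr (_ @^-1` _).
  rewrite -setXTT TF TG; apply/seteqP; split=> -[x y] /=.
    move=> [[i _ Fix] [j _ Gjy]]; exists (maxn i j) => //; split => /=.
    - by move: x Fix; exact/subsetPset/ndF/leq_maxl.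
    - by move: y Gjy; exact/subsetPset/ndG/leq_maxr.
  by move=> [i _ [/= ? ?]]; split; exists i.
move=> k; have [mF Fkoo] := Foo k; have [mG Gkoo] := Goo k; split.
  by rewrite -[X in measurable X]setTI; apply: mh => //; exact: measurableX.
rewrite /lebesgue_cons /pushforward -comp_preimage.
rewrite (_ : h \o _ = id); last by apply/funext => p /=; rewrite tconsK.
by rewrite preimage_id product_measure1E// lte_mul_pinfty// ge0_fin_numE.
Qed.

HB.instance Definition _ := Measure_isSigmaFinite.Build _ _ _ lebesgue_cons
  sigma_finite_lebesgue_cons.

End lebesgue_cons.

Fixpoint lebesgue_tuple {R : realType} (n : nat) :
    {sigma_finite_measure set (n.-tuple R) -> \bar R} :=
  match n with
  | 0 => \d_([tuple] : 0.-tuple R)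
  | m.+1 => lebesgue_cons (lebesgue_tuple m)
  end.

Section sphere_measure.
Context {R : realType} {n : nat}.

Definition enorm (x : n.-tuple R) : R :=
  Num.sqrt (\sum_(i < n) tnth x i ^+ 2).

Lemma measurable_enorm : measurable_fun [set: _] enorm.
Proof.
apply: measurableT_comp.
  by apply: continuous_measurable_fun; exact: sqrt_continuous.
apply: measurable_sum => i; apply: measurable_funX.
exact: measurable_tnth.
Qed.

Definition radial (r : R) (x : n.-tuple R) : n.-tuple R :=
  [tuple r / enorm x * tnth x i | i < n].

Lemma measurable_radial r : measurable_fun [set: _] (radial r).
Proof.
apply/measurable_fun_tnthP => i.
rewrite (_ : _ \o _ = fun x => r * enorm x `^ (-1) * tnth x i); last first.
  by apply/funext => x /=; rewrite tnth_mktuple powR_inv1// sqrtr_ge0.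
apply: measurable_funM; last exact: measurable_tnth.
apply: measurable_funM => //.
apply: (measurableT_comp (measurable_powR _)).
exact: measurable_enorm.
Qed.

HB.instance Definition _ r :=
  isMeasurableFun.Build _ _ _ _ (radial r) (measurable_radial r).

Definition pointed_ball (r : R) : set (n.-tuple R) :=
  [set x | 0 < enorm x <= r].

Lemma measurable_pointed_ball r : measurable (pointed_ball r).
Proof.
rewrite (_ : pointed_ball r = setT `&` enorm @^-1` `]0, r]%classic).
  exact: (measurable_enorm measurableT).
by apply/seteqP; split => x; rewrite /pointed_ball /= in_itv//=; tauto.
Qed.

(* The surface measure of the sphere of radius r centred at 0 (seen as a
   measure on R^n), as defined by integration in polar coordinates: for A
   included in the sphere,
     surface measure of A = (n / r) * volume {t x | 0 < t <= 1, x \in A},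
   and this cone is the preimage of A, in the pointed ball, under the radial
   projection onto the sphere. *)
Definition sphere_measure (r : {nonneg R}) : set (n.-tuple R) -> \bar R :=
  pushforward
    (mscale (n%:R / r%:num)%:nng
      (mrestr (lebesgue_tuple n) (measurable_pointed_ball r%:num)))
    (radial r%:num).

Section instances.
Variable r : {nonneg R}.

Let sphere_measure0 : sphere_measure r set0 = 0%E.
Proof. exact: measure0. Qed.

Let sphere_measure_ge0 A : (0 <= sphere_measure r A)%E.
Proof. exact: measure_ge0. Qed.

Let sphere_measure_sigma_additive : semi_sigma_additive (sphere_measure r).
Proof. exact: measure_semi_sigma_additive. Qed.

HB.instance Definition _ := isMeasure.Build _ _ _ (sphere_measure r)
  sphere_measure0 sphere_measure_ge0 sphere_measure_sigma_additive.

End instances.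
End sphere_measure.

Section fixed_trace.
Context {R : realType}.
Variables (beta : R) (N : nat).

Definition vandermonde_weight (x : N.-tuple R) : R :=
  \prod_(j < N) \prod_(k < N | (j < k)%N) `|tnth x j - tnth x k| `^ beta.

Lemma vandermonde_weight_ge0 x : 0 <= vandermonde_weight x.
Proof.
by apply: prodr_ge0 => j _; apply: prodr_ge0 => k _; exact: powR_ge0.
Qed.

Lemma measurable_vandermonde_weight :
  measurable_fun [set: _] vandermonde_weight.
Proof.
apply: measurable_prod => j _.
rewrite (_ : (fun _ => _) = fun x : N.-tuple R => \prod_(k < N)
    if (j < k)%N then `|tnth x j - tnth x k| `^ beta else 1); last first.
  by apply/funext => x; exact: big_mkcond.
apply: measurable_prod => k _; case: (j < k)%N => //.
apply: (measurableT_comp (measurable_powR _)).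
apply: measurableT_comp => //.
by apply: measurable_funB; exact: measurable_tnth.
Qed.

Definition fte_radius : {nonneg R} :=
  (Num.sqrt (N%:R * (N%:R - 1) / 2 : R))%:nng.

Definition fte_unnormalized (A : set (N.-tuple R)) : \bar R :=
  (\int[sphere_measure fte_radius]_(x in A) (vandermonde_weight x)%:E)%E.

Let fte_unnormalized0 : fte_unnormalized set0 = 0%E.
Proof. exact: integral_set0. Qed.

Let fte_unnormalized_ge0 A : (0 <= fte_unnormalized A)%E.
Proof.
by apply: integral_ge0 => x _; rewrite lee_fin vandermonde_weight_ge0.
Qed.

Let fte_unnormalized_sigma_additive : semi_sigma_additive fte_unnormalized.
Proof.
move=> F mF tF mUF.
rewrite /fte_unnormalized ge0_integral_bigcup//=; last 2 first.
- apply/measurable_EFinP/measurable_funTS.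
  exact: measurable_vandermonde_weight.
- by move=> x _; rewrite lee_fin vandermonde_weight_ge0.
apply: is_cvg_ereal_nneg_natsum_cond => k _ _.
exact: fte_unnormalized_ge0.
Qed.

HB.instance Definition _ := isMeasure.Build _ _ _ fte_unnormalized
  fte_unnormalized0 fte_unnormalized_ge0 fte_unnormalized_sigma_additive.

End fixed_trace.

(* mnormalize mu P is mu divided by its total mass, here the normalization
   constant Z; the dirac measure is only the default value that the library
   asks for when the total mass is 0 or +oo, which does not occur for
   beta > 0 and N >= 2. *)
Definition fixed_trace_ensemble {R : realType} (beta : R) (N : nat) :
    probability (N.-tuple R) R :=
  mnormalize (@fte_unnormalized R beta N)
    \d_(nseq_tuple N 0 : N.-tuple R).

Section first_eigenvalue.
Context {R : realType} {N : nat}.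

(* x_1; the default value of nth is irrelevant as soon as N >= 1. *)
Definition first_eigenvalue (x : N.-tuple R) : measurableTypeR R :=
  nth 0 x 0%N.

Lemma measurable_first_eigenvalue : measurable_fun [set: _] first_eigenvalue.
Proof.
rewrite /first_eigenvalue; have [N0|N0] := posnP N.
  rewrite (_ : (fun _ => _) = cst 0)//.
  by apply/funext => x /=; rewrite nth_default// size_tuple N0.
rewrite (_ : (fun _ => _) = (@tnth N R)^~ (Ordinal N0)).
  exact: measurable_tnth.
by apply/funext => x; rewrite (tnth_nth 0).
Qed.

HB.instance Definition _ := isMeasurableFun.Build _ _ _ _
  first_eigenvalue measurable_first_eigenvalue.

End first_eigenvalue.

Definition is_density {R : realType} (mu : set (measurableTypeR R) -> \bar R)
    (rho : R -> R) : Prop :=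
  [/\ measurable_fun [set: measurableTypeR R] rho,
      forall x, 0 <= rho x
    & forall A : set (measurableTypeR R), measurable A ->
        mu A = (\int[lebesgue_measure]_(x in A) (rho x)%:E)%E].

(* A density is determined only up to a Lebesgue-null set; rho is any version. *)
Definition is_level_density {R : realType} (beta : R) (N : nat)
    (rho : R -> R) : Prop :=
  is_density
    (distribution (fixed_trace_ensemble beta N) (@first_eigenvalue R N)) rho.

Definition semicircle {R : realType} (x : R) : R :=
  if -1 < x < 1 then 2 / pi * Num.sqrt (1 - x ^+ 2) else 0.

(* C_c(R) *)
Definition continuous_compact_support {R : realType} (f : R -> R) : Prop :=
  continuous f /\ compact (closure [set x | f x != 0]).

(* Main.v *)
Require Import Defs.
From HB Require Import structures.
From mathcomp Require Import all_boot all_order all_algebra.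
From mathcomp Require Import fingroup perm.
From mathcomp Require Import all_classical all_reals all_analysis.
From mathcomp Require Import measurable_realfun.
From mathcomp Require Import ring lra.

(** Write p_a for the power sum of the a-th powers of the coordinates. The
    divergence theorem, applied on the sphere to the fields
    (x_i^e * prod_{a in s} p_a * weight)_i, expresses the mean of p_{e+1} prod p_a
    through means of products of power sums of total degree lower by two. After
    scaling by sqrt(2N) all terms but beta/2 * sum_{a+b=e-1} p_a p_b are
    negligible, so by induction on the degree every joint moment factorises in the
    limit, with factors obeying the Catalan recursion
    c_{e+1} = 1/4 * sum_{a+b=e-1} c_a c_b of the semicircle moments; no separate
    concentration estimate is needed. By exchangeability the moments of x_1 are
    those of the empirical measure, and polynomial approximation on [-2, 2], with a
    high even moment controlling the tail, passes from polynomials to f. *)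

Set Implicit Arguments.
Unset Strict Implicit.
Unset Printing Implicit Defensive.

Import Order.TTheory GRing.Theory Num.Theory.
Import numFieldNormedType.Exports.

Local Open Scope classical_set_scope.
Local Open Scope ring_scope.

(** * Extracting one coordinate of Lebesgue measure *)

Section insert.
Context {R : realType} {n : nat}.

(** A loop equation for a single power sum is not closed: the pair interaction produces products p_a
    p_b, whose equations produce longer products, so all joint moments are treated at once. On the
    sphere no confining potential appears; its place is taken by the radial part of the field. The
    coefficient of the leading moment, dimension plus a degree of homogeneity over the squared
    radius N(N-1)/2, tends to beta; against the factor beta/2 times N/(2N) of the pair term this
    gives the 1/4 of the recursion, for every beta. Surface calculus is avoided: sphere integrals
    are ball integrals of functions constant on rays, so only one-dimensional integrations by parts
    in R^N occur. Normalisation constants are never computed; that the total mass is positive is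
    read off from the existence of a density. *)

Definition insert (i : 'I_n.+1) (p : measurableTypeR R * n.-tuple R) :
    n.+1.-tuple R :=
  [tuple (if unlift i j is Some k then tnth p.2 k else p.1) | j < n.+1].

Lemma tnth_insert_id i p : tnth (insert i p) i = p.1.
Proof. by rewrite tnth_mktuple unlift_none. Qed.

Lemma tnth_insert_lift i p k : tnth (insert i p) (lift i k) = tnth p.2 k.
Proof. by rewrite tnth_mktuple liftK. Qed.

Lemma measurable_insert i : measurable_fun [set: _] (insert i).
Proof.
apply/measurable_fun_tnthP => j; rewrite /comp.
under eq_fun do rewrite tnth_mktuple.
case: (unlift i j) => [k|] /=.
  exact: (measurableT_comp (measurable_tnth k) measurable_snd).
exact: measurable_fst.
Qed.

End insert.

Section lebesgue_tuple_insert.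
Context {R : realType}.
Local Open Scope ereal_scope.
Local Notation lambda := (@lebesgue_measure R).

Lemma tcons_insert n (p : measurableTypeR R * n.-tuple R) :
  tcons p = insert ord0 p.
Proof.
apply: eq_from_tnth => j; rewrite tnth_mktuple.
case: unliftP => [k ->|->]; first by rewrite tnthS.
by rewrite tnth0.
Qed.

Lemma insert_lift_tcons n (j : 'I_n.+1) t x0 (x : n.-tuple R) :
  insert (lift ord0 j) (t, tcons (x0, x)) = tcons (x0, insert j (t, x)).
Proof.
apply: eq_from_tnth => k; rewrite tnth_mktuple.
case: (unliftP ord0 k) => [k' ->|->]; last first.
  rewrite [RHS]tnth0.
  have -> : ord0 = lift (lift ord0 j) ord0 :> 'I_n.+2 by exact: val_inj.
  by rewrite liftK tnth0.
rewrite [RHS]tnthS tnth_mktuple.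
case: (unliftP j k') => [l ->|->]/=.
  have -> : lift ord0 (lift j l) = lift (lift ord0 j) (lift ord0 l).
    by apply: val_inj; rewrite /= /bump /= !add1n ltnS addnS.
  by rewrite liftK tnthS.
by rewrite unlift_none.
Qed.

Lemma ge0_integral_lebesgue_cons n (F : n.+1.-tuple R -> \bar R) :
  measurable_fun [set: _] F -> (forall x, 0 <= F x) ->
  \int[lebesgue_tuple n.+1]_x F x =
  \int[lambda \x lebesgue_tuple n]_p F (tcons p).
Proof.
move=> mF F0; rewrite [LHS](@ge0_integral_pushforward _ _ _ _ _ (@tcons R n)
  (@measurable_tcons R n)) //.
Qed.

(** [lebesgue_tuple] splits off coordinate 0 only. For a later coordinate, the induction hypothesis
    extracts it from the tail and Tonelli exchanges it with coordinate 0. *)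
Lemma ge0_integral_insert n (i : 'I_n.+1) (F : n.+1.-tuple R -> \bar R) :
  measurable_fun [set: _] F -> (forall x, 0 <= F x) ->
  \int[lebesgue_tuple n.+1]_x F x =
  \int[lambda \x lebesgue_tuple n]_p F (insert i p).
Proof.
elim: n i F => [|n IH] i F mF F0.
  by rewrite ge0_integral_lebesgue_cons// (ord1 i); under eq_integral do rewrite tcons_insert.
case: (unliftP ord0 i) => [j ->|->]; last first.
  by rewrite ge0_integral_lebesgue_cons//; under eq_integral do rewrite tcons_insert.
have mFc : measurable_fun [set: _] (F \o @tcons R n.+1).
  exact: measurableT_comp mF (@measurable_tcons R _).
have mFi : measurable_fun [set: _] (F \o insert (lift ord0 j)).
  exact: measurableT_comp mF (measurable_insert _).
pose G (q : (measurableTypeR R * measurableTypeR R) * n.-tuple R) :=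
  F (tcons (q.1.1, insert j (q.1.2, q.2))).
have mG : measurable_fun [set: _] G.
  apply: measurableT_comp mFc _; apply/measurable_fun_pairP; split => /=.
    exact: measurableT_comp measurable_fst measurable_fst.
  apply: (measurableT_comp (measurable_insert j)).
  apply/measurable_fun_pairP; split => /=.
    exact: measurableT_comp measurable_snd measurable_fst.
  exact: measurable_snd.
pose Phi (q : measurableTypeR R * measurableTypeR R) := \int[lebesgue_tuple n]_x G (q, x).
have mPhi : measurable_fun [set: _] Phi.
  by apply: (measurable_fun_fubini_tonelli_F _ mG) => q; exact: F0.
have Phi0 q : 0 <= Phi q by apply: integral_ge0 => x _; exact: F0.
rewrite ge0_integral_lebesgue_cons//.
rewrite (fubini_tonelli1 _ mFc (fun p => F0 _)).
rewrite (fubini_tonelli1 _ mFi (fun p => F0 _)).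
transitivity (\int[lambda]_x \int[lambda]_t Phi (x, t)).
  apply: eq_integral => x0 _; rewrite /fubini_F/=.
  rewrite (IH j (fun x' => F (tcons (x0, x'))))//; last first.
    exact: (measurableT_comp mFc (measurable_pair1 x0)).
  rewrite fubini_tonelli1//.
  apply: (measurableT_comp mFc).
  by apply: (measurableT_comp (measurable_pair1 x0)); exact: measurable_insert.
rewrite (fubini_tonelli Phi)//.
apply: eq_integral => t _; rewrite /fubini_F/=.
rewrite (@ge0_integral_lebesgue_cons n (fun x' => F (insert (lift ord0 j) (t, x')))) //; last first.
  exact: (measurableT_comp mFi (measurable_pair1 t)).
rewrite fubini_tonelli1//.
- by apply: eq_integral => x0 _; apply: eq_integral => x _; rewrite /= insert_lift_tcons.
- apply: (measurableT_comp mFi).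
  by apply: (measurableT_comp (measurable_pair1 t)); exact: measurable_tcons.
Qed.

(** Equality of measures, not only of integrals of nonnegative functions, is what lets
    [integral_insert] treat signed integrands. *)
Lemma lebesgue_tuple_insert n (i : 'I_n.+1) (A : set (n.+1.-tuple R)) :
  measurable A ->
  lebesgue_tuple n.+1 A = pushforward (lambda \x lebesgue_tuple n) (insert i) A.
Proof.
move=> mA; have mi : measurable (insert i @^-1` A).
  by rewrite -[X in measurable X]setTI; exact: measurable_insert.
rewrite -[A in LHS]setIT -integral_indic// (ge0_integral_insert i).
- by rewrite -[X in pushforward _ _ X]setIT /pushforward preimage_setI preimage_setT -integral_indic.
- by apply/measurable_EFinP; exact: measurable_indic.
- by move=> x; rewrite lee_fin.
Qed.

End lebesgue_tuple_insert.

(** * Integrating a partial derivative *)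

Section cube.
Context {R : realType}.

Definition cube n (M : R) : set (n.-tuple R) :=
  [set x | forall i, `|tnth x i| <= M].

Arguments cube : clear implicits.

Lemma measurable_cube n M : measurable (cube n M).
Proof.
have -> : cube n M = \bigcap_(i in [set: 'I_n]) ((@tnth n R)^~ i @^-1` [set` `[-M, M]]).
  apply/seteqP; split=> x /= h i; first by move=> _; rewrite /= in_itv /= -ler_norml.
  by have := h i Logic.I; rewrite /= in_itv /= -ler_norml.
apply: fin_bigcap_measurable => // i _.
by rewrite -[X in measurable X]setTI; exact: measurable_tnth.
Qed.

Lemma lebesgue_tuple_cube_lty n M : (lebesgue_tuple n (cube n M) < +oo)%E.
Proof.
elim: n => [|n IH]; first by rewrite /= /dirac ltry.
rewrite [X in (X < _)%E](_ : _ =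
    ((@lebesgue_measure R \x lebesgue_tuple n) ([set` `[- M, M]%R] `*` cube n M))%E); last first.
  congr (product_measure1 _ _ _); apply/seteqP; split=> -[t x] /=.
    move=> h; split.
      by have := h ord0; rewrite tnth0 /= in_itv/= -ler_norml.
    by move=> i; have := h (lift ord0 i); rewrite tnthS.
  rewrite in_itv/= -ler_norml => -[ht hx] i.
  by case: (unliftP ord0 i) => [j ->|->]; rewrite ?tnthS ?tnth0.
have mM := measurable_itv `[- M, M].
rewrite (product_measure1E (@lebesgue_measure R) (lebesgue_tuple n) mM (@measurable_cube n M)).
have fM : (@lebesgue_measure R `[- M, M]%classic) \is a fin_num.
  by rewrite lebesgue_measure_itv/=; case: ifP.
exact: lte_mul_pinfty.
Qed.

Lemma integrable_cube n M (F : n.-tuple R -> R) (C : R) :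
  measurable_fun [set: _] F -> (forall x, `|F x| <= C) ->
  (forall x, ~ cube n M x -> F x = 0) ->
  (lebesgue_tuple n).-integrable setT (EFin \o F).
Proof.
move=> mF FC F0.
have mc := @measurable_cube n M.
have -> : EFin \o F = (EFin \o F) \_ (cube n M).
  apply/funext => x; rewrite patchE; case: ifPn => //.
  by rewrite notin_setE => /F0 /= ->.
apply/integrable_restrict => //.
rewrite setTI.
apply: measurable_bounded_integrable => //.
- exact: lebesgue_tuple_cube_lty.
- exact: measurable_funTS.
- exists C; split; first exact: num_real.
  by move=> c Cc x _ /=; exact: le_trans (FC x) (ltW Cc).
Qed.

End cube.

Arguments cube {R} n M _.

(** * Continuously differentiable functions of one variable *)

Section C1.
Context {R : realType}.
Implicit Types (f g : R -> R).

(** A relation with an explicit derivative, so that the formula of the derivative is built along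
    with its continuity. *)
Definition C1 f f' := (forall t, is_derive t (1:R) f (f' t)) /\ continuous f'.

Lemma C1_continuous f f' : C1 f f' -> continuous f.
Proof.
move=> [df _] t; apply/differentiable_continuous/derivable1_diffP.
by have [] := df t.
Qed.

Lemma C1_ext f f' g' : C1 f f' -> f' =1 g' -> C1 f g'.
Proof. by move=> ? /funext <-. Qed.

Lemma C1_cst (c : R) : C1 (cst c) (cst 0).
Proof. by split=> t; [exact: is_derive_cst|exact: cvg_cst]. Qed.

Lemma C1_id : C1 id (cst 1).
Proof. by split=> t; [exact: is_derive_id|exact: cvg_cst]. Qed.

Lemma C1D f f' g g' : C1 f f' -> C1 g g' -> C1 (f \+ g) (f' \+ g').
Proof.
move=> [df cf] [dg cg]; split=> t; first exact: is_deriveD.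
by apply: cvgD; [exact: cf|exact: cg].
Qed.

Lemma C1M f f' g g' : C1 f f' -> C1 g g' ->
  C1 (fun t => f t * g t) (fun t => f' t * g t + f t * g' t).
Proof.
move=> Cf Cg; have cf := C1_continuous Cf; have cg := C1_continuous Cg.
case: Cf Cg => df cf' [dg cg']; split=> t.
  apply: is_derive_eq (is_deriveM (df t) (dg t)) _.
  by rewrite /GRing.scale/= addrC; congr (_ + _); rewrite mulrC.
by apply: cvgD; apply: cvgM; [exact: cf'|exact: cg|exact: cf|exact: cg'].
Qed.

Lemma C1_comp f f' g g' : C1 f f' -> C1 g g' ->
  C1 (fun t => f (g t)) (fun t => f' (g t) * g' t).
Proof.
move=> Cf Cg; have cg := C1_continuous Cg.
case: Cf Cg => df cf' [dg cg']; split=> t.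
  exact: (is_derive1_comp (df (g t)) (dg t)).
apply: cvgM; last exact: cg'.
exact: (continuous_comp (cg t) (cf' (g t))).
Qed.

Lemma C1_sum (I : Type) (r : seq I) (P : pred I) (f f' : I -> R -> R) :
  (forall i, P i -> C1 (f i) (f' i)) ->
  C1 (fun t => \sum_(i <- r | P i) f i t) (fun t => \sum_(i <- r | P i) f' i t).
Proof.
move=> Cf; elim: r => [|i r IH].
  have E (h : I -> R -> R) : (fun t => \sum_(i <- [::] | P i) h i t) = cst 0.
    by apply/funext => t; rewrite big_nil.
  by rewrite !E; exact: C1_cst.
have E (h : I -> R -> R) : (fun t => \sum_(i <- i :: r | P i) h i t) =
    if P i then h i \+ (fun t => \sum_(i <- r | P i) h i t)
    else fun t => \sum_(i <- r | P i) h i t.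
  by apply/funext => t; rewrite big_cons; case: (P i).
by rewrite !E; case: ifPn => // Pi; exact: C1D (Cf i Pi) IH.
Qed.

Lemma C1Z (c : R) f f' : C1 f f' -> C1 (fun t => c * f t) (fun t => c * f' t).
Proof.
move=> Cf; apply: C1_ext (C1M (C1_cst c) Cf) _ => t /=.
by rewrite mul0r add0r.
Qed.

Lemma C1X n f f' : C1 f f' ->
  C1 (fun t => f t ^+ n) (fun t => n%:R * f t ^+ n.-1 * f' t).
Proof.
move=> Cf; elim: n => [|n IH].
  by apply: C1_ext (C1_cst 1) _ => t; rewrite /= !mul0r.
under eq_fun do rewrite exprS.
apply: C1_ext (C1M Cf IH) _ => t.
by case: n {IH} => [|n] /=; rewrite ?expr0 ?exprS -?natr1 /=; ring.
Qed.

Lemma C1_expR : C1 expR expR.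
Proof. by split; [exact: is_derive_expR|exact: continuous_expR]. Qed.

End C1.

Section integral_line.
Context {R : realType}.

Lemma integral_line0 (g g' : R -> R) (M : R) : C1 g g' ->
  (forall t, M < `|t| -> g t = 0) -> (forall t, M < `|t| -> g' t = 0) ->
  (\int[@lebesgue_measure R]_t (g' t)%:E = 0)%E.
Proof.
(* [K] exceeds [M] strictly, so that [g] vanishes at both end points, and it is positive whatever
   the sign of [M]. *)
move=> Cg g0 g'0; pose K : R := `|M| + 1.
have MK : M < K by rewrite ltr_pwDr// ler_norm.
have K0 : 0 < K by rewrite ltr_pwDr.
transitivity (\int[@lebesgue_measure R]_(t in [set` `[- K, K]%R]) (g' t)%:E)%E.
  rewrite [RHS]integral_mkcond; apply: eq_integral => t _.
  rewrite patchE; case: ifPn => //; rewrite notin_setE/= in_itv/= -ler_norml.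
  by move=> /negP; rewrite -ltNge => Kt; rewrite g'0// (lt_trans MK).
rewrite (@continuous_FTC2 _ g' g).
- by rewrite !g0 ?subee// ?normrN ger0_norm ?(ltW K0).
- lra.
- exact/continuous_subspaceT/(Cg.2).
- split.
  + by move=> t _; have [] := Cg.1 t.
  + exact/cvg_at_right_filter/(C1_continuous Cg).
  + exact/cvg_at_left_filter/(C1_continuous Cg).
- by move=> t _; rewrite derive1E; have [] := Cg.1 t.
Qed.

Lemma integrable_insert n (i : 'I_n.+1) (F : n.+1.-tuple R -> \bar R) :
  (lebesgue_tuple n.+1).-integrable setT F ->
  (@lebesgue_measure R \x lebesgue_tuple n)%E.-integrable setT (F \o insert i).
Proof.
move=> iF; have mF := measurable_int _ iF.
apply/integrableP; split; first exact: measurableT_comp mF (@measurable_insert R n i).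
have /integrableP[_] := iF.
by rewrite (ge0_integral_insert i)//; exact: measurableT_comp.
Qed.

Lemma integral_insert n (i : 'I_n.+1) (F : n.+1.-tuple R -> \bar R) :
  (lebesgue_tuple n.+1).-integrable setT F ->
  (\int[lebesgue_tuple n.+1]_x F x =
   \int[@lebesgue_measure R \x lebesgue_tuple n]_p F (insert i p))%E.
Proof.
move=> iF; have mF := measurable_int _ iF.
have mi := @measurable_insert R n i.
have iFi := integrable_insert i iF.
transitivity (\int[pushforward (@lebesgue_measure R \x lebesgue_tuple n) (insert i)]_x
    F x)%E.
  by apply: eq_measure_integral => A mA _; exact: lebesgue_tuple_insert.
by rewrite (integral_pushforward mi mF)// preimage_setT.
Qed.

(** Fubini with the extracted coordinate integrated first: on each line the integrand is the
    derivative of a function that vanishes far out. *)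
Lemma integral_partial0 n (i : 'I_n.+1) (u du : n.+1.-tuple R -> R) (M C : R) :
  (forall x, C1 (fun t => u (insert i (t, x))) (fun t => du (insert i (t, x)))) ->
  measurable_fun [set: _] du -> (forall x, `|du x| <= C) ->
  (forall x, ~ cube n.+1 M x -> u x = 0) ->
  (forall x, ~ cube n.+1 M x -> du x = 0) ->
  (\int[lebesgue_tuple n.+1]_x (du x)%:E = 0)%E.
Proof.
move=> Cu mdu duC u0 du0.
have idu := integrable_cube mdu duC du0.
rewrite (integral_insert i idu) -(integral21_prod_meas1 (integrable_insert i idu)).
apply: integral0_eq => x _.
apply: (integral_line0 (Cu x) (M := M)) => t Mt.
  by apply: u0 => /(_ i); rewrite tnth_insert_id/= leNgt Mt.
by apply: du0 => /(_ i); rewrite tnth_insert_id/= leNgt Mt.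
Qed.

End integral_line.

(** * Power sums *)

Section partial.
Context {R : realType} {n : nat}.
Local Notation vec := (n.+1.-tuple R).
Implicit Types (u v du dv : vec -> R) (i j : 'I_n.+1).

(** Here [x] lists the other coordinates: [u] is C^1 on every line in direction [i], which is all
    that slicewise integration needs. *)
Definition partial i u du := forall x,
  C1 (fun t => u (insert i (t, x))) (fun t => du (insert i (t, x))).

Lemma partial_ext i u du dv : partial i u du -> du =1 dv -> partial i u dv.
Proof. by move=> ? /funext <-. Qed.

Lemma partial_coord i j : partial i (fun x => tnth x j) (fun=> (j == i)%:R).
Proof.
move=> x; case: (unliftP i j) => [k ->|->].
  under eq_fun do rewrite tnth_insert_lift.
  rewrite eq_sym (negbTE (neq_lift i k)); exact: (C1_cst (tnth x k)).
by under eq_fun do rewrite tnth_insert_id; rewrite eqxx; exact: C1_id.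
Qed.

Lemma partial_cst i c : partial i (fun=> c) (fun=> 0).
Proof. by move=> x; exact: C1_cst. Qed.

Lemma partialD i u du v dv : partial i u du -> partial i v dv ->
  partial i (fun x => u x + v x) (fun x => du x + dv x).
Proof. by move=> Du Dv x; exact: C1D. Qed.

Lemma partialM i u du v dv : partial i u du -> partial i v dv ->
  partial i (fun x => u x * v x) (fun x => du x * v x + u x * dv x).
Proof. by move=> Du Dv x; exact: C1M (Du x) (Dv x). Qed.

Lemma partialZ i c u du : partial i u du ->
  partial i (fun x => c * u x) (fun x => c * du x).
Proof. by move=> Du x; exact: C1Z (Du x). Qed.

Lemma partialX i m u du : partial i u du ->
  partial i (fun x => u x ^+ m) (fun x => m%:R * u x ^+ m.-1 * du x).
Proof. by move=> Du x; exact: C1X (Du x). Qed.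

Lemma partial_sum i (I : Type) (r : seq I) (P : pred I) (u du : I -> vec -> R) :
  (forall k, P k -> partial i (u k) (du k)) ->
  partial i (fun x => \sum_(k <- r | P k) u k x)
            (fun x => \sum_(k <- r | P k) du k x).
Proof.
move=> Du x.
apply: (@C1_sum R I r P (fun k t => u k (insert i (t, x)))
  (fun k t => du k (insert i (t, x)))) => k Pk.
exact: Du.
Qed.

Lemma partial_comp i (f f' : R -> R) u du : C1 f f' -> partial i u du ->
  partial i (fun x => f (u x)) (fun x => f' (u x) * du x).
Proof. by move=> Cf Du x; exact: C1_comp Cf (Du x). Qed.

End partial.

(** * Bounds on a cube, uniform in the regularisation *)

Section ubounded.
Context {R : realType} {n : nat} (M : R).
Local Notation vec := (n.-tuple R).
Implicit Types u v : R -> vec -> R.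

(* The parameter e is the regularisation of the weight, which tends to 0. *)
Definition ubounded u := exists C, forall e x, 0 < e <= 1 -> cube n M x ->
  `|u e x| <= C.

Lemma ubounded_cst c : ubounded (fun _ _ => c).
Proof. by exists `|c|. Qed.

Lemma ubounded_coord i : ubounded (fun _ x => tnth x i).
Proof. by exists M => e x _; exact. Qed.

Lemma uboundedD u v : ubounded u -> ubounded v -> ubounded (fun e x => u e x + v e x).
Proof.
move=> [C hC] [D hD]; exists (C + D) => e x he hx.
by rewrite (le_trans (ler_normD _ _))// lerD ?hC ?hD.
Qed.

Lemma uboundedN u : ubounded u -> ubounded (fun e x => - u e x).
Proof. by move=> [C hC]; exists C => e x he hx; rewrite normrN hC. Qed.

Lemma uboundedM u v : ubounded u -> ubounded v -> ubounded (fun e x => u e x * v e x).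
Proof.
move=> [C hC] [D hD]; exists (C * D) => e x he hx.
by rewrite normrM ler_pM// ?hC ?hD.
Qed.

Lemma ubounded_sum (I : Type) (r : seq I) (P : pred I) (u : I -> R -> vec -> R) :
  (forall k, P k -> ubounded (u k)) ->
  ubounded (fun e x => \sum_(k <- r | P k) u k e x).
Proof.
move=> hu; elim: r => [|k r [C IH]].
  by exists 0 => e x _ _; rewrite big_nil normr0.
have [Pk|Pk] := boolP (P k).
  have [D hD] := hu k Pk; exists (D + C) => e x he hx.
  by rewrite big_cons Pk (le_trans (ler_normD _ _))// lerD ?hD ?IH.
by exists C => e x he hx; rewrite big_cons (negbTE Pk) IH.
Qed.

Lemma ubounded_prod (I : Type) (r : seq I) (P : pred I) (u : I -> R -> vec -> R) :
  (forall k, P k -> ubounded (u k)) ->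
  ubounded (fun e x => \prod_(k <- r | P k) u k e x).
Proof.
move=> hu; elim: r => [|k r [C IH]].
  by exists 1 => e x _ _; rewrite big_nil normr1.
have [Pk|Pk] := boolP (P k).
  have [D hD] := hu k Pk; exists (D * C) => e x he hx.
  by rewrite big_cons Pk normrM ler_pM// ?hD ?IH.
by exists C => e x he hx; rewrite big_cons (negbTE Pk) IH.
Qed.

Lemma uboundedX u m : ubounded u -> ubounded (fun e x => u e x ^+ m).
Proof.
move=> hu; elim: m => [|m IH]; first exact: ubounded_cst.
under eq_fun do under eq_fun do rewrite exprS.
exact: uboundedM.
Qed.

End ubounded.

Section power_sums.
Context {R : realType} {n : nat}.
Local Notation vec := (n.-tuple R).
Implicit Types (x : vec) (a e : nat) (s : seq nat).

Definition psum a x : R := \sum_(i < n) tnth x i ^+ a.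
Definition pprod s x : R := \prod_(a <- s) psum a x.

(** The Leibniz rule for the i-th partial derivative of [pprod s]. For [a = 0] the truncated
    exponent [a.-1] is harmless, its coefficient being zero. *)
Fixpoint dpprod s (i : 'I_n) x : R :=
  if s is a :: s' then
    a%:R * tnth x i ^+ a.-1 * pprod s' x + psum a x * dpprod s' i x
  else 0.

(* sum_i x_i^e * d(pprod s)/dx_i *)
Fixpoint pgrad e s x : R :=
  if s is a :: s' then
    a%:R * psum (e + a).-1 x * pprod s' x + psum a x * pgrad e s' x
  else 0.

Lemma pprod_cons a s x : pprod (a :: s) x = psum a x * pprod s x.
Proof. by rewrite /pprod big_cons. Qed.

Lemma sum_dpprod e s x : \sum_i tnth x i ^+ e * dpprod s i x = pgrad e s x.
Proof.
elim: s => [|a s IH] /=; first by rewrite big1// => i _; rewrite mulr0.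
under eq_bigr do rewrite mulrDr; rewrite big_split/=; congr (_ + _).
  rewrite /psum mulr_sumr mulr_suml; apply: eq_bigr => i _.
  case: a => [|a]; first by rewrite !mul0r mulr0.
  by rewrite addnS /= exprD; ring.
by rewrite -IH mulr_sumr; apply: eq_bigr => i _; ring.
Qed.

Lemma measurable_psum a : measurable_fun [set: _] (psum a).
Proof.
by apply: measurable_sum => i; apply: measurable_funX; exact: measurable_tnth.
Qed.

Lemma measurable_pprod s : measurable_fun [set: _] (pprod s).
Proof. by apply: measurable_prod => a _; exact: measurable_psum. Qed.

Lemma measurable_dpprod s i : measurable_fun [set: _] (dpprod s i).
Proof.
elim: s => [|a s IH] /=; first exact: measurable_cst.
apply: measurable_funD; apply: measurable_funM => //.
- apply: measurable_funM => //; apply: measurable_funX; exact: measurable_tnth.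
- exact: measurable_pprod.
- exact: measurable_psum.
Qed.

Lemma measurable_pgrad e s : measurable_fun [set: _] (pgrad e s).
Proof.
elim: s => [|a s IH] /=; first exact: measurable_cst.
apply: measurable_funD; apply: measurable_funM => //.
- by apply: measurable_funM => //; exact: measurable_psum.
- exact: measurable_pprod.
- exact: measurable_psum.
Qed.

Lemma ubounded_psum M a : ubounded M (fun _ => psum a).
Proof. by apply: ubounded_sum => i _; apply: uboundedX; exact: ubounded_coord. Qed.

Lemma ubounded_pprod M s : ubounded M (fun _ => pprod s).
Proof. by apply: ubounded_prod => a _; exact: ubounded_psum. Qed.

Lemma ubounded_dpprod M s i : ubounded M (fun _ => dpprod s i).
Proof.
elim: s => [|a s IH] /=; first exact: ubounded_cst.
apply: uboundedD; apply: uboundedM => //.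
- apply: uboundedM; first exact: ubounded_cst.
  by apply: uboundedX; exact: ubounded_coord.
- exact: ubounded_pprod.
- exact: ubounded_psum.
Qed.

Lemma ubounded_pgrad M e s : ubounded M (fun _ => pgrad e s).
Proof.
elim: s => [|a s IH] /=; first exact: ubounded_cst.
apply: uboundedD; apply: uboundedM => //.
- by apply: uboundedM; [exact: ubounded_cst|exact: ubounded_psum].
- exact: ubounded_pprod.
- exact: ubounded_psum.
Qed.

End power_sums.

Section partial_power_sums.
Context {R : realType} {n : nat}.

Lemma partial_psum a i :
  partial i (@psum R n.+1 a) (fun x => a%:R * tnth x i ^+ a.-1).
Proof.
have h : forall k : 'I_n.+1, true -> partial i (fun x : n.+1.-tuple R => tnth x k ^+ a)
    (fun x => a%:R * tnth x k ^+ a.-1 * (k == i)%:R).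
  by move=> k _; apply: partialX; exact: partial_coord.
have /partial_ext := @partial_sum R n i _ (index_enum 'I_n.+1) predT
  (fun k x => tnth x k ^+ a) (fun k x => a%:R * tnth x k ^+ a.-1 * (k == i)%:R) h.
apply=> x.
rewrite (bigD1 i)//= eqxx mulr1 big1 ?addr0// => k /negbTE ->.
by rewrite mulr0.
Qed.

Lemma partial_pprod s i : partial i (@pprod R n.+1 s) (dpprod s i).
Proof.
elim: s => [|a s IH] /=.
  rewrite (_ : pprod [::] = fun=> 1); first exact: partial_cst.
  by apply/funext => x; rewrite /pprod big_nil.
rewrite (_ : pprod _ = fun x => psum a x * pprod s x); last first.
  by apply/funext => x; rewrite pprod_cons.
exact: partialM (@partial_psum a i) IH.
Qed.

End partial_power_sums.

(** * The regularised weight *)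

Section regularised_weight.
Context {R : realType} {n : nat}.
Variables (beta : R).
Hypothesis beta0 : 0 < beta.
Local Notation vec := (n.+1.-tuple R).
Implicit Types (x : vec) (i j k : 'I_n.+1) (eps : R).

Let d x i j := tnth x i - tnth x j.

(* For beta < 1 the partial derivatives of |x_j - x_k|^beta blow up on the
   diagonal, so the integrations by parts are done for this smooth weight. *)
Definition rweight eps x : R :=
  \prod_j \prod_(k | k != j) (d x j k ^+ 2 + eps) `^ (beta / 4).

(** [beta * rforce] is the logarithmic derivative of [rweight] in direction [i]; the term [k = i] is
    zero and need not be excluded. *)
Definition rforce eps i x : R := \sum_k d x i k * (d x i k ^+ 2 + eps)^-1.

(** The difference quotient of the e-th power at [x_i] and [x_j], in the polynomial form that makes
    sense on the diagonal too. *)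
Definition quot e i j x : R :=
  \sum_(a < e) tnth x i ^+ (e.-1 - a) * tnth x j ^+ a.

Definition rpair e eps x : R :=
  2^-1 * \sum_i \sum_j quot e i j x * (d x i j ^+ 2 * (d x i j ^+ 2 + eps)^-1).

(* sum over i < j of (x_i^e - x_j^e) / (x_i - x_j); the second term removes the
   diagonal of the double sum. *)
Definition pair_sum e x : R :=
  2^-1 * (\sum_(a < e) psum (e.-1 - a) x * psum a x - e%:R * psum e.-1 x).

Lemma sqD_gt0 eps (y : R) : 0 < eps -> 0 < y ^+ 2 + eps.
Proof. by move=> e0; rewrite ltr_wpDl// sqr_ge0. Qed.

Lemma rweightE eps x : 0 < eps -> rweight eps x =
  expR (\sum_j \sum_(k | k != j) beta / 4 * ln (d x j k ^+ 2 + eps)).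
Proof.
move=> e0; rewrite expR_sum; apply: eq_bigr => j _.
rewrite expR_sum; apply: eq_bigr => k _.
by rewrite /powR gt_eqF// sqD_gt0.
Qed.

(** Ordered pairs replace the pairs [j < k], whence the halved exponent; with squared differences it
    becomes the [beta / 4] of [rweight]. In this symmetric form derivatives and permutations need no
    ordering of the indices. *)
Lemma vandermonde_weightE x : vandermonde_weight beta x =
  \prod_j \prod_(k | k != j) `|d x j k| `^ (beta / 2).
Proof.
pose F j k := `|d x j k| `^ (beta / 2).
have FC j k : F j k = F k j by rewrite /F /d distrC.
have sp j : \prod_(k | k != j) F j k =
    \prod_(k < n.+1 | (j < k)%N) F j k * \prod_(k < n.+1 | (k < j)%N) F j k.
  rewrite (bigID (fun k : 'I_n.+1 => (j < k)%N))/=; congr (_ * _);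
  apply: eq_bigl => k; rewrite -?val_eqE/=.
    by rewrite andb_idl// => /gtn_eqF ->.
  by rewrite -leqNgt ltn_neqAle.
transitivity (\prod_j \prod_(k | k != j) F j k); last by [].
under [RHS]eq_bigr do rewrite sp.
rewrite big_split/= [X in _ * X](exchange_big_dep predT)//= -big_split/=.
apply: eq_bigr => j _; rewrite -big_split/=; apply: eq_bigr => k _.
rewrite /F /d (distrC (tnth x k)) -powRD; last by rewrite -splitr gt_eqF.
by rewrite -splitr.
Qed.

Lemma C1_ln_sq eps : 0 < eps ->
  C1 (fun y : R => ln (y ^+ 2 + eps)) (fun y => 2 * (y * (y ^+ 2 + eps)^-1)).
Proof.
move=> e0.
have [dq cq] : C1 (fun y : R => y ^+ 2 + eps) (fun y => 2 * y).
  apply: C1_ext (C1D (C1X 2 (@C1_id R)) (C1_cst eps)) _ => y /=.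
  by rewrite expr1 mulr1 addr0.
split=> t.
  have dl := is_derive1_ln (sqD_gt0 t e0).
  have := @is_derive1_comp R (@ln R) (fun y : R => y ^+ 2 + eps) t _ _ dl (dq t).
  by rewrite mulrCA [_^-1 * t]mulrC; exact.
apply: cvgM; first exact: cvg_cst.
apply: cvgM; first exact: cvg_id.
apply: cvgV; first by rewrite gt_eqF// sqD_gt0.
apply: cvgD; last exact: cvg_cst.
exact: exprn_continuous.
Qed.

Lemma partial_rweight eps i : 0 < eps ->
  partial i (rweight eps) (fun x => rweight eps x * (beta * rforce eps i x)).
Proof.
move=> e0.
have -> : rweight eps = fun x =>
    expR (\sum_j \sum_(k | k != j) beta / 4 * ln (d x j k ^+ 2 + eps)).
  by apply/funext => x; rewrite rweightE.
have pd j k : partial i (fun x => d x j k) (fun=> (j == i)%:R - (k == i)%:R).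
  have -> : (fun x => d x j k) = fun x => tnth x j + -1 * tnth x k.
    by apply/funext => x; rewrite mulN1r.
  apply: partial_ext (partialD (partial_coord i j)
    (partialZ (-1) (partial_coord i k))) _ => x.
  by rewrite mulN1r.
have pl j k := partialZ (beta / 4) (partial_comp (C1_ln_sq e0) (pd j k)).
have ps := @partial_sum R n i _ (index_enum 'I_n.+1) predT _ _ (fun j _ =>
   @partial_sum R n i _ (index_enum 'I_n.+1) (fun k => k != j) _ _ (fun k _ => pl j k)).
apply: partial_ext (partial_comp (@C1_expR R) ps) _ => x /=.
congr (_ * _).
(* [x_i] occurs in row [i] and in column [i] of the double sum; antisymmetry of [h] makes the two
   contributions equal. *)
pose h j k := d x j k * (d x j k ^+ 2 + eps)^-1.
have hN j k : h j k = - h k j.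
  by rewrite /h /d -opprB sqrrN mulNr.
have h0 j : h j j = 0 by rewrite /h /d subrr mul0r.
transitivity (\sum_j \sum_k beta / 2 * (h j k * ((j == i)%:R - (k == i)%:R))).
  apply: eq_bigr => j _; rewrite [RHS](bigD1 j)//= h0 mul0r mulr0 add0r.
  by apply: eq_bigr => k _; rewrite -/(h j k); field.
under eq_bigr do under eq_bigr do rewrite mulrBr mulrBr.
under eq_bigr do rewrite big_split/=.
rewrite big_split/=.
have -> : \sum_j \sum_k beta / 2 * (h j k * (j == i)%:R) = beta / 2 * rforce eps i x.
  rewrite (bigD1 i)//= [X in _ + X]big1 ?addr0; last first.
    by move=> j /negbTE ->; rewrite big1// => k _; rewrite !mulr0.
  by rewrite /rforce mulr_sumr; apply: eq_bigr => k _; rewrite eqxx mulr1.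
have -> : \sum_j \sum_k - (beta / 2 * (h j k * (k == i)%:R)) = beta / 2 * rforce eps i x.
  rewrite exchange_big/= (bigD1 i)//= [X in _ + X]big1 ?addr0; last first.
    by move=> j /negbTE ->; rewrite big1// => k _; rewrite !mulr0 oppr0.
  rewrite /rforce mulr_sumr; apply: eq_bigr => k _; rewrite eqxx mulr1 hN.
  by rewrite mulrN opprK.
by field.
Qed.

(* Symmetrising in (i, j) cancels the singularity: the right-hand side stays
   bounded as eps tends to 0. *)
Lemma sum_rforce e eps x : \sum_i tnth x i ^+ e * rforce eps i x = rpair e eps x.
Proof.
pose h j k := d x j k * (d x j k ^+ 2 + eps)^-1.
have hN j k : h j k = - h k j by rewrite /h /d -opprB sqrrN mulNr.
have -> : rpair e eps x = 2^-1 * \sum_i \sum_j (tnth x i ^+ e - tnth x j ^+ e) * h i j.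
  congr (_ * _); apply: eq_bigr => i _; apply: eq_bigr => j _.
  by rewrite subrXX /h /quot -/(d x i j); ring.
under [in RHS]eq_bigr do under eq_bigr do rewrite mulrBl.
under [in RHS]eq_bigr do rewrite big_split/=.
rewrite big_split/= [X in _ + X]exchange_big/=.
under [X in _ + X]eq_bigr do under eq_bigr do rewrite hN mulrN opprK.
have half (S : R) : 2^-1 * (S + S) = S by field.
by rewrite half; apply: eq_bigr => i _; rewrite mulr_sumr.
Qed.

Lemma measurable_dist i j : measurable_fun [set: _] (fun x => d x i j).
Proof. by apply: measurable_funB; exact: measurable_tnth. Qed.

Lemma measurable_invD eps i j : 0 < eps ->
  measurable_fun [set: _] (fun x => (d x i j ^+ 2 + eps)^-1).
Proof.
move=> e0; rewrite (_ : (fun x => _) = fun x => (d x i j ^+ 2 + eps) `^ (-1)).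
  apply: (measurableT_comp (measurable_powR _)).
  by apply: measurable_funD => //; apply: measurable_funX; exact: measurable_dist.
by apply/funext => x; rewrite powR_inv1// ltW// sqD_gt0.
Qed.

Lemma measurable_rweight eps : measurable_fun [set: _] (rweight eps).
Proof.
apply: measurable_prod => j _.
rewrite (_ : (fun _ => _) = fun x => \prod_k
    if k != j then (d x j k ^+ 2 + eps) `^ (beta / 4) else 1); last first.
  by apply/funext => x; exact: big_mkcond.
apply: measurable_prod => k _; case: (k != j) => //.
apply: (measurableT_comp (measurable_powR _)).
by apply: measurable_funD => //; apply: measurable_funX; exact: measurable_dist.
Qed.

Lemma measurable_rforce eps i : 0 < eps -> measurable_fun [set: _] (rforce eps i).
Proof.
move=> e0; apply: measurable_sum => k; apply: measurable_funM.
  exact: measurable_dist.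
exact: measurable_invD.
Qed.

Lemma measurable_pair_sum e : measurable_fun [set: _] (@pair_sum e).
Proof.
apply: measurable_funM => //; apply: measurable_funB.
  by apply: measurable_sum => a; apply: measurable_funM; exact: measurable_psum.
by apply: measurable_funM => //; exact: measurable_psum.
Qed.

Lemma ubounded_dist M i j : ubounded M (fun _ x => d x i j).
Proof.
by apply: uboundedD; [|apply: uboundedN]; exact: ubounded_coord.
Qed.

Lemma ubounded_invD M eps i j : 0 < eps ->
  ubounded M (fun _ x => (d x i j ^+ 2 + eps)^-1).
Proof.
move=> e0; exists eps^-1 => _ x _ _.
have h := sqD_gt0 (d x i j) e0; rewrite ger0_norm ?invr_ge0 ?(ltW h)//.
by rewrite lef_pV2 ?posrE ?sqD_gt0// lerDr sqr_ge0.
Qed.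

Lemma ubounded_rforce M eps i : 0 < eps -> ubounded M (fun _ => rforce eps i).
Proof.
move=> e0; apply: ubounded_sum => k _; apply: uboundedM.
  exact: ubounded_dist.
exact: ubounded_invD.
Qed.

(** The restriction [e <= 1] in [ubounded] serves here: it bounds the base of each power
    independently of the regularisation. *)
Lemma ubounded_rweight M : ubounded M rweight.
Proof.
apply: ubounded_prod => j _; apply: ubounded_prod => k _.
have [C hC] := uboundedX 2 (ubounded_dist M j k).
exists ((C + 1) `^ (beta / 4)) => e x /[dup] /andP[e0 e1] he hx.
rewrite ger0_norm ?powR_ge0//.
have := hC e x he hx; rewrite ger0_norm ?sqr_ge0// => hC'.
apply: ge0_ler_powR.
- by rewrite ltW// divr_gt0.
- by rewrite nnegrE ltW// sqD_gt0.
- by rewrite nnegrE (le_trans _ (lerD hC' e1))// ltW// sqD_gt0.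
- exact: lerD.
Qed.

(** Each ratio d^2 / (d^2 + eps) is at most 1, so unlike that of [rforce] the bound does not depend
    on [eps] and survives the limit. *)
Lemma ubounded_rpair M e : ubounded M (rpair e).
Proof.
apply: uboundedM; first exact: ubounded_cst.
apply: ubounded_sum => i _; apply: ubounded_sum => j _; apply: uboundedM.
  by apply: ubounded_sum => a _; apply: uboundedM; apply: uboundedX; exact: ubounded_coord.
exists 1 => eps x /andP[e0 _] _; have h := sqD_gt0 (d x i j) e0.
have h' : 0 <= d x i j ^+ 2 * (d x i j ^+ 2 + eps)^-1.
  by rewrite mulr_ge0 ?sqr_ge0// invr_ge0 ltW.
rewrite (ger0_norm h').
by rewrite ler_pdivrMr// mul1r lerDl ltW.
Qed.

End regularised_weight.

(** * Loop equation in the whole space *)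

Section bigop_cvg.
Context {R : realType} {T : Type} (F : set_system T) {FF : Filter F}.

Lemma cvg_bigsum (I : Type) (r : seq I) (P : pred I) (u : I -> T -> R) (l : I -> R) :
  (forall i, P i -> u i @ F --> l i) ->
  (fun t => \sum_(i <- r | P i) u i t) @ F --> \sum_(i <- r | P i) l i.
Proof. by move=> ul; apply: cvg_big => //; exact: add_continuous.
Qed.

Lemma cvg_bigprod (I : Type) (r : seq I) (P : pred I) (u : I -> T -> R) (l : I -> R) :
  (forall i, P i -> u i @ F --> l i) ->
  (fun t => \prod_(i <- r | P i) u i t) @ F --> \prod_(i <- r | P i) l i.
Proof. by move=> ul; apply: cvg_big => //; exact: mul_continuous.
Qed.

End bigop_cvg.

Section regularisation_limit.
Context {R : realType} {n : nat}.
Variables (beta : R).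
Hypothesis beta0 : 0 < beta.
Local Notation vec := (n.+1.-tuple R).
Implicit Types (x : vec).

Let e_ (m : nat) : R := m.+1%:R^-1.

Let e_cvg : e_ @ \oo --> (0 : R).
Proof. exact: cvg_harmonic. Qed.

Let e_cvg_right : e_ @ \oo --> (0 : R)^'+.
Proof.
move=> A /= [r /= r0 rA].
have : \forall m \near \oo, e_ m < r by exact: (cvgr_lt 0 e_cvg).
apply: filterS => m mr; have em : 0 < e_ m by rewrite invr_gt0.
by apply: rA => //=; rewrite sub0r normrN gtr0_norm.
Qed.

Lemma cvg_rweight x : rweight beta (e_ m) x @[m --> \oo] --> vandermonde_weight beta x.
Proof.
rewrite vandermonde_weightE//; apply: cvg_bigprod => j _; apply: cvg_bigprod => k _.
set d := tnth x j - tnth x k.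
have b4 : 0 < beta / 4 by rewrite divr_gt0.
have [->|d0] := eqVneq d 0.
  (* On the diagonal the factor is a positive power of the regularisation alone, whose limit 0 is
     taken from the right; this uses [0 < beta]. *)
  rewrite normr0 powR0; last by rewrite gt_eqF// divr_gt0.
  under eq_fun do rewrite expr0n add0r.
  exact: (cvg_comp _ _ e_cvg_right (powR_cvg0 b4)).
have -> : `|d| `^ (beta / 2) = (d ^+ 2 + 0) `^ (beta / 4).
  rewrite addr0 -(real_normK (num_real d)) -powR_mulrn// -powRrM; congr (_ `^ _).
  by field.
have d2 : 0 < d ^+ 2 + 0 by rewrite addr0 exprn_even_gt0.
have cp : {for (d ^+ 2 + 0), continuous (fun y => y `^ (beta / 4))}.
  apply/differentiable_continuous/derivable1_diffP.
  by have [] := is_derive1_powR (beta / 4) d2.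
apply: (cvg_comp (fun m => d ^+ 2 + e_ m) (fun y => y `^ (beta / 4)) _ cp).
by apply: cvgD => //; exact: cvg_cst.
Qed.

(** On the diagonal the ratio is identically 0 and elsewhere it tends to 1, hence the indicator in
    the limit. *)
Lemma cvg_rpair e x : rpair e (e_ m) x @[m --> \oo] -->
  2^-1 * \sum_i \sum_j quot e i j x * (tnth x i != tnth x j)%:R.
Proof.
apply: cvgM; first exact: cvg_cst.
apply: cvg_bigsum => i _; apply: cvg_bigsum => j _.
apply: cvgM; first exact: cvg_cst.
rewrite -subr_eq0; set d := tnth x i - tnth x j.
have [->|d0] /= := eqVneq d 0.
  by under eq_fun do rewrite expr0n mul0r; exact: cvg_cst.
have d2 : d ^+ 2 + 0 != 0 by rewrite addr0 expf_eq0.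
have -> : true%:R = d ^+ 2 * (d ^+ 2 + 0)^-1 by rewrite addr0 mulfV// expf_eq0.
apply: cvgM; first exact: cvg_cst.
by apply: cvgV => //; apply: cvgD => //; exact: cvg_cst.
Qed.

Lemma quot_diag e (i : 'I_n.+1) x : quot e i i x = e%:R * tnth x i ^+ e.-1.
Proof.
rewrite /quot; under eq_bigr => a _.
  rewrite -exprD subnK; last by case: e a => [[]//|e a]; rewrite -ltnS.
  over.
by rewrite sumr_const card_ord mulr_natl.
Qed.

Lemma sum_quot e x : pair_sum e x =
  2^-1 * \sum_i \sum_(j | j != i) quot e i j x.
Proof.
have -> : \sum_i \sum_(j | j != i) quot e i j x =
    \sum_i (\sum_j quot e i j x - quot e i i x).
  by apply: eq_bigr => i _; rewrite [in RHS](bigD1 i)//= addrAC subrr add0r.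
rewrite sumrB; congr (_ * (_ - _)); last first.
  by rewrite /psum mulr_sumr; apply: eq_bigr => i _; rewrite quot_diag.
rewrite /quot; under [RHS]eq_bigr do rewrite exchange_big/=.
rewrite exchange_big/=; apply: eq_bigr => a _.
rewrite /psum mulr_suml; apply: eq_bigr => i _.
by rewrite mulr_sumr.
Qed.

(* The limit of rpair misses the pairs with x_i = x_j, but there the weight
   vanishes. *)
Lemma rpair_limit_weight e x :
  2^-1 * (\sum_i \sum_j quot e i j x * (tnth x i != tnth x j)%:R) *
    vandermonde_weight beta x = pair_sum e x * vandermonde_weight beta x.
Proof.
have [->|w0] := eqVneq (vandermonde_weight beta x) 0; first by rewrite !mulr0.
rewrite sum_quot; congr (_ * _ * _); apply: eq_bigr => i _.
rewrite (bigD1 i)//= eqxx mulr0 add0r; apply: eq_bigr => j ji.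
case: eqVneq => [xij|_]; last by rewrite mulr1.
case/eqP: w0; rewrite vandermonde_weightE// (bigD1 i)//= (bigD1 j)//=.
rewrite xij subrr normr0 powR0 ?mul0r//.
by rewrite gt_eqF// divr_gt0.
Qed.

End regularisation_limit.

Section loop.
Context {R : realType} {n : nat}.
Variables (beta : R).
Hypothesis beta0 : 0 < beta.
Local Notation vec := (n.+1.-tuple R).
Implicit Types (x : vec).
Variables (e : nat) (s : seq nat) (phi phi' : R -> R) (M C : R).
Hypotheses (M0 : 0 <= M) (Cphi : C1 phi phi').
Hypothesis phi0 : forall y, M ^+ 2 < y -> phi y = 0 /\ phi' y = 0.
Hypothesis phi_le : forall y, `|phi y| <= C /\ `|phi' y| <= C.

Let field eps (i : 'I_n.+1) x :=
  tnth x i ^+ e * pprod s x * rweight beta eps x * phi (psum 2 x).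

(** The four summands differentiate the power of [x_i], the product of power sums, the weight and
    the radial factor, in this order. *)
Let dfield eps (i : 'I_n.+1) x :=
  (e%:R * tnth x i ^+ e.-1 * pprod s x * phi (psum 2 x)
   + tnth x i ^+ e * dpprod s i x * phi (psum 2 x)
   + beta * (tnth x i ^+ e * rforce eps i x) * pprod s x * phi (psum 2 x)
   + 2 * tnth x i ^+ e.+1 * pprod s x * phi' (psum 2 x)) * rweight beta eps x.

(* loop_term times the weight is the divergence of the vector field
   (x_i^e * pprod s * phi(|x|^2) * weight)_i. *)
Definition loop_term x : R :=
  (e%:R * psum e.-1 x * pprod s x + pgrad e s x + beta * pair_sum e x * pprod s x)
    * phi (psum 2 x)
  + 2 * psum e.+1 x * pprod s x * phi' (psum 2 x).

Let rloop eps x :=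
  ((e%:R * psum e.-1 x * pprod s x + pgrad e s x + beta * rpair e eps x * pprod s x)
    * phi (psum 2 x)
  + 2 * psum e.+1 x * pprod s x * phi' (psum 2 x)) * rweight beta eps x.

Let partial_field eps i : 0 < eps -> partial i (field eps i) (dfield eps i).
Proof.
move=> e0.
apply: partial_ext (partialM (partialM (partialM (partialX e (partial_coord i i))
  (partial_pprod s i)) (partial_rweight beta i e0))
  (partial_comp Cphi (partial_psum 2 i))) _ => x.
rewrite /dfield eqxx mulr1 exprS /=; ring.
Qed.

Let sum_dfield eps x : \sum_i dfield eps i x = rloop eps x.
Proof.
rewrite /dfield /rloop -mulr_suml; congr (_ * _).
rewrite !big_split/= -!mulr_suml -sum_rforce -sum_dpprod; congr (_ + _).
  rewrite !mulrDl; congr (_ + _ + _); first by rewrite -mulr_sumr.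
  by rewrite -mulr_sumr.
by rewrite -mulr_sumr.
Qed.

Let cube_out x : ~ cube n.+1 M x -> phi (psum 2 x) = 0 /\ phi' (psum 2 x) = 0.
Proof.
move=> /existsNP[i /negP]; rewrite -ltNge => Mi; apply: phi0.
apply: (@lt_le_trans _ _ (tnth x i ^+ 2)).
  by rewrite -(real_normK (num_real (tnth x i))) ltrXn2r ?nnegrE.
rewrite /psum (bigD1 i)//= lerDl sumr_ge0// => j _; exact: sqr_ge0.
Qed.

Let ub_phi (f : R -> R) : (forall y, `|f y| <= C) -> ubounded M (fun _ x => f (psum 2 x)).
Proof. by move=> fC; exists C. Qed.

Let m_phi (f : R -> R) : continuous f -> measurable_fun [set: vec] (fun x => f (psum 2 x)).
Proof.
move=> cf; apply: (measurableT_comp (continuous_measurable_fun cf)).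
exact: measurable_psum.
Qed.

Let cphi := C1_continuous Cphi.
Let cphi' := Cphi.2.

Let measurable_dfield eps i : 0 < eps -> measurable_fun [set: _] (dfield eps i).
Proof.
move=> e0; have mt := @measurable_tnth.
apply: measurable_funM; last exact: measurable_rweight.
repeat apply: measurable_funD; repeat apply: measurable_funM => //;
  do ?[exact: measurable_pprod|exact: measurable_dpprod|exact: (m_phi cphi)|exact: (m_phi cphi')
      |exact: measurable_rforce|apply: measurable_funX; exact: measurable_tnth].
Qed.

Let ub_dfield eps i : 0 < eps <= 1 -> ubounded M (fun _ => dfield eps i).
Proof.
move=> e01; have e0 : 0 < eps by case/andP: e01.
apply: uboundedM; last first.
  have [K hK] := @ubounded_rweight R n beta beta0 M.
  by exists K => _ x _; exact: hK.
repeat apply: uboundedD; repeat apply: uboundedM;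
  do ?[exact: ubounded_pprod|exact: ubounded_dpprod|exact: ubounded_cst
      |exact: ubounded_rforce|apply: uboundedX; exact: ubounded_coord
      |by apply: ub_phi => y; have [] := phi_le y].
Qed.

Let measurable_rloop eps : 0 < eps -> measurable_fun [set: _] (rloop eps).
Proof.
move=> e0; rewrite (_ : rloop eps = fun x => \sum_i dfield eps i x); last first.
  by apply/funext => x; rewrite sum_dfield.
by apply: measurable_sum => i; exact: measurable_dfield.
Qed.

Let ub_rloop : ubounded M rloop.
Proof.
apply: uboundedM; last exact: ubounded_rweight.
by repeat first [exact: ubounded_rpair|exact: ubounded_pprod
  |exact: ubounded_pgrad|exact: ubounded_cst|exact: ubounded_psum
  |by apply: ub_phi => y; have [] := phi_le y
  |apply: uboundedD|apply: uboundedM].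
Qed.

Let dfield_out eps i x : ~ cube n.+1 M x -> dfield eps i x = 0.
Proof. by move=> /cube_out[p0 p0']; rewrite /dfield p0 p0' !mulr0 !addr0 mul0r. Qed.

Let dfield_bounded eps i : 0 < eps <= 1 -> exists K, forall x, `|dfield eps i x| <= K.
Proof.
move=> /[dup] e01 /(ub_dfield i)[K hK]; exists `|K| => x.
have [/(hK _ _ e01)|/dfield_out ->] := pselect (cube n.+1 M x); last by rewrite normr0.
by move=> /le_trans; apply; exact: ler_norm.
Qed.

Let integral_rloop eps : 0 < eps <= 1 ->
  (\int[lebesgue_tuple n.+1]_x (rloop eps x)%:E = 0)%E.
Proof.
move=> /[dup] e01 /andP[e0 _].
under eq_integral do rewrite -sum_dfield -sumEFin.
rewrite (@integral_sum _ _ _ _ _ _ _ (fun i x => (dfield eps i x)%:E))//.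
  rewrite big1// => i _; have [K hK] := dfield_bounded i e01.
  apply: (@integral_partial0 R n i (field eps i) (dfield eps i) M K) => //.
  - exact: partial_field.
  - exact: measurable_dfield.
  - by move=> x /cube_out[p0 _]; rewrite /field p0 mulr0.
  - exact: dfield_out.
move=> i; have [K hK] := dfield_bounded i e01.
apply: (integrable_cube (measurable_dfield i e0) hK).
exact: dfield_out.
Qed.

Lemma measurable_loop_term : measurable_fun [set: _] loop_term.
Proof.
by repeat first [exact: measurable_cst|exact: measurable_pprod
  |exact: measurable_pgrad|exact: (m_phi cphi)|exact: (m_phi cphi')|exact: measurable_pair_sum
  |exact: measurable_psum|apply: measurable_funD|apply: measurable_funM].
Qed.

(** Integrability is part of the conclusion because two such terms are subtracted later. The
    regularisation is removed by dominated convergence, the bound on the cube being uniform in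
    it. *)
Lemma integral_loop_term : (lebesgue_tuple n.+1).-integrable setT
    (fun x => (loop_term x * vandermonde_weight beta x)%:E) /\
  (\int[lebesgue_tuple n.+1]_x (loop_term x * vandermonde_weight beta x)%:E = 0)%E.
Proof.
pose e_ (m : nat) : R := m.+1%:R^-1.
have e01 m : 0 < e_ m <= 1 by rewrite invr_gt0 ltr0Sn invf_le1// ler1n.
have e0 m : 0 < e_ m by case/andP: (e01 m).
have [K hK] := ub_rloop.
have mloop : measurable_fun setT (fun x => (loop_term x * vandermonde_weight beta x)%:E).
  apply/measurable_EFinP; apply: measurable_funM; first exact: measurable_loop_term.
  exact: measurable_vandermonde_weight.
pose g (x : vec) : \bar R := (K * \1_(cube n.+1 M) x)%:E.
have [] := @dominated_convergence _ _ _ (lebesgue_tuple n.+1) setT measurableT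
    (fun m x => (rloop (e_ m) x)%:E)
    (fun x => (loop_term x * vandermonde_weight beta x)%:E) g _ mloop.
- by move=> m; apply/measurable_EFinP; exact: measurable_rloop.
- apply: aeW => x _; apply: cvg_EFin; first exact: nearW.
  (* The integrand is rewritten with the pointwise limit of [rpair] in place of [pair_sum]; the two
     agree once multiplied by the weight. *)
  have -> : loop_term x * vandermonde_weight beta x =
    ((e%:R * psum e.-1 x * pprod s x + pgrad e s x + beta *
     (2^-1 * (\sum_i \sum_j quot e i j x * (tnth x i != tnth x j)%:R)) * pprod s x)
    * phi (psum 2 x)
  + 2 * psum e.+1 x * pprod s x * phi' (psum 2 x)) * vandermonde_weight beta x.
    have := rpair_limit_weight beta0 e x; rewrite /loop_term.
    move: (2^-1 * _) (vandermonde_weight _ _) => A w h.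
    have lin (X Y P T F D : R) : ((X + Y + beta * T * P) * F + D) * w =
        ((X + Y) * F + D) * w + beta * P * F * (T * w) by ring.
    by rewrite !lin h.
  apply: cvgM; last exact: cvg_rweight.
  apply: cvgD; last exact: cvg_cst.
  apply: cvgM; last exact: cvg_cst.
  apply: cvgD; first exact: cvg_cst.
  apply: cvgM; last exact: cvg_cst.
  by apply: cvgM; [exact: cvg_cst|exact: cvg_rpair].
- apply: (@integrable_cube _ _ M (fun x => K * \1_(cube n.+1 M) x) `|K|).
  + by apply: measurable_funM => //; apply: measurable_indic; exact: measurable_cube.
  + move=> x; rewrite normrM ler_piMr// indicE.
    by case: (_ \in _); rewrite ?normr1 ?normr0.
  + by move=> x xM; rewrite indicE memNset ?mulr0.
- apply: aeW => x m _; rewrite /g lee_fin indicE.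
  have [xM|xM] := pselect (cube n.+1 M x).
    by rewrite mem_set// mulr1 hK.
  by rewrite memNset// mulr0 -sum_dfield big1 ?normr0// => i _; exact: dfield_out.
move=> ? _ h; split => //; symmetry; apply: cvg_unique h => //.
rewrite (_ : [sequence _]_n = cst 0%E); first exact: cvg_cst.
by apply/funext => m /=; rewrite integral_rloop.
Qed.

End loop.

(** * Radial cut-offs *)

Section cutoff.
Context {R : realType}.
Implicit Types t r c : R.

(** A quadratic error bound makes the difference quotient continuous at [x], which is Caratheodory's
    criterion; for [sqplus] this spares one-sided derivatives at 0. *)
Lemma is_derive_quadratic_error (f : R -> R) (x a K : R) :
  (forall z, `|f z - f x - a * (z - x)| <= K * (z - x) ^+ 2) ->
  is_derive x 1 f a.
Proof.
move=> hf; apply/is_derive1_caratheodory.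
exists (fun z => if z == x then a else (f z - f x) / (z - x)); split.
- move=> z; case: eqVneq => [->|zx]; first by rewrite !subrr mulr0.
  by rewrite divfK// subr_eq0.
- apply/cvgrPdist_le => e e0; rewrite eqxx.
  have K1 : 0 < `|K| + 1 by rewrite ltr_pwDr.
  near=> z; case: eqVneq => [_|zx]; first by rewrite subrr normr0 ltW.
  have zx0 : 0 < `|z - x| by rewrite normr_gt0 subr_eq0.
  have -> : a - (f z - f x) / (z - x) = - ((f z - f x - a * (z - x)) / (z - x)).
    by field; rewrite subr_eq0.
  rewrite normrN normrM normfV ler_pdivrMr//.
  apply: (le_trans (hf z)); rewrite -(real_normK (num_real (z - x))) expr2 mulrA.
  rewrite ler_wpM2r//.
  have zd : `|z - x| <= e / (`|K| + 1).
    rewrite distrC; near: z; apply: cvgr_dist_le; last exact: divr_gt0.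
    exact: cvg_id.
  apply: (@le_trans _ _ ((`|K| + 1) * `|z - x|)).
    by rewrite ler_wpM2r// (le_trans (ler_norm _))// lerDl.
  by rewrite mulrC -ler_pdivlMr.
- by rewrite eqxx.
Unshelve. all: by end_near. Qed.

Definition sqplus t := Num.max t 0 ^+ 2.

Lemma C1_sqplus : C1 sqplus (fun t => 2 * Num.max t 0).
Proof.
split=> [t|].
  apply: (@is_derive_quadratic_error _ _ _ 1) => z; rewrite /sqplus ler_norml.
  have zt := sqr_ge0 (z - t).
  case: (leP z 0) => z0; case: (leP t 0) => t0.
  - by apply/andP; split; nra.
  - have := mulr_le0_ge0 z0 (ltW t0).
    by move=> h; apply/andP; split; nra.
  - have := mulr_ge0_le0 (ltW z0) t0.
    by move=> h; apply/andP; split; nra.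
  - by apply/andP; split; nra.
move=> t; apply: cvgM; first exact: cvg_cst.
apply: (@continuous_max R R id (cst 0)); first exact: cvg_id.
exact: cvg_cst.
Qed.

Lemma sqplus_ge0 t : 0 <= sqplus t. Proof. exact: sqr_ge0. Qed.

Lemma sqplus_le0 t : t <= 0 -> sqplus t = 0.
Proof. by move=> t0; rewrite /sqplus max_r// expr0n. Qed.

Lemma sqplus1 : sqplus 1 = 1.
Proof. by rewrite /sqplus max_l// expr1n. Qed.

(** A C^1 step: [1 - sqplus (1 - t)] is at most 0 for [t <= 0] and reaches 1 with slope 0 at
    [t = 1], where it stays; the outer [sqplus] flattens the lower end. *)
Definition step t := sqplus (1 - sqplus (1 - t)).
Definition dstep t := 4 * Num.max (1 - sqplus (1 - t)) 0 * Num.max (1 - t) 0.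

Lemma C1_affine (a b : R) : C1 (fun t => a + b * t) (cst b).
Proof.
apply: C1_ext (C1D (C1_cst a) (C1Z b (@C1_id R))) _ => t /=.
by rewrite add0r mulr1.
Qed.

Lemma C1_step : C1 step dstep.
Proof.
have C1N (f f' : R -> R) : C1 f f' -> C1 (fun t => 1 - f t) (fun t => - f' t).
  move=> Cf; have := C1D (C1_cst 1) (C1Z (-1) Cf).
  rewrite (_ : _ \+ _ = fun t => 1 - f t); last by apply/funext => t /=; rewrite mulN1r.
  by move=> /C1_ext; apply => t; rewrite /= add0r mulN1r.
apply: C1_ext (C1_comp C1_sqplus (C1N _ _ (C1_comp C1_sqplus (C1N _ _ (@C1_id R))))) _.
by move=> t; rewrite /dstep /cst; ring.
Qed.

Lemma step_le0 t : t <= 0 -> step t = 0.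
Proof.
move=> t0; apply: sqplus_le0; rewrite subr_le0 /sqplus max_l; last lra.
by nra.
Qed.

Lemma dstep_le0 t : t <= 0 -> dstep t = 0.
Proof.
move=> t0; rewrite /dstep [X in _ * X * _]max_r ?mulr0 ?mul0r// subr_le0.
by rewrite /sqplus max_l; [nra|lra].
Qed.

Lemma step_ge1 t : 1 <= t -> step t = 1.
Proof. by move=> t1; rewrite /step (@sqplus_le0 (1 - t)) ?subr_le0// subr0 sqplus1. Qed.

Lemma step_ge0 t : 0 <= step t. Proof. exact: sqplus_ge0. Qed.

Lemma step_le1 t : step t <= 1.
Proof.
have := sqplus_ge0 (1 - t); rewrite /step; move: (sqplus (1 - t)) => u u0.
by rewrite /sqplus maxEle; case: ifPn; rewrite -?ltNge => h; nra.
Qed.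

(** In the variable t = |x|^2 the first factor climbs from 0 to 1 between 1/(m+1) and 2/(m+1), and
    the second descends from 1 to 0 between r^2 and r^2 + 1/(m+1). Starting the descent at r^2 makes
    the limit the indicator of the closed ball without its centre. *)
Definition cutoff r (m : nat) t :=
  step (- 1 + m.+1%:R * t) * step (1 + m.+1%:R * r ^+ 2 + - m.+1%:R * t).

Definition dcutoff r (m : nat) t :=
  dstep (- 1 + m.+1%:R * t) * m.+1%:R
    * step (1 + m.+1%:R * r ^+ 2 + - m.+1%:R * t)
  + step (- 1 + m.+1%:R * t)
    * (dstep (1 + m.+1%:R * r ^+ 2 + - m.+1%:R * t) * - m.+1%:R).

Lemma C1_cutoff r m : C1 (cutoff r m) (dcutoff r m).
Proof.
exact: C1M (C1_comp C1_step (C1_affine _ _)) (C1_comp C1_step (C1_affine _ _)).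
Qed.

Lemma cutoff_ge0 r m t : 0 <= cutoff r m t.
Proof. by rewrite mulr_ge0 ?step_ge0. Qed.

Lemma cutoff_le1 r m t : cutoff r m t <= 1.
Proof. by rewrite mulr_ile1 ?step_ge0 ?step_le1. Qed.

Lemma cutoff_small r m t : m.+1%:R * t <= 1 -> cutoff r m t = 0 /\ dcutoff r m t = 0.
Proof.
move=> h; have h' : - 1 + m.+1%:R * t <= 0 by lra.
by rewrite /cutoff /dcutoff step_le0// dstep_le0// !mul0r addr0.
Qed.

Lemma cutoff_large r m t : r ^+ 2 + 1 <= t -> cutoff r m t = 0 /\ dcutoff r m t = 0.
Proof.
move=> h; have h' : 1 + m.+1%:R * r ^+ 2 + - m.+1%:R * t <= 0.
  have m1 : 1 <= m.+1%:R :> R by rewrite ler1n.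
  by nra.
by rewrite /cutoff /dcutoff (step_le0 h') (dstep_le0 h') !(mul0r,mulr0) addr0.
Qed.

Lemma cvg_cutoff r t : cutoff r m t @[m --> \oo] --> ((0 < t <= r ^+ 2)%R%:R : R).
Proof.
have ev (u : R) : \forall m \near \oo, u <= m.+1%:R.
  exists (Num.truncn `|u|) => // m /= hm.
  rewrite (le_trans (ler_norm _))// ltW// (lt_le_trans (truncnS_gt _))// ler_nat.
  by rewrite ltnS.
case: (ltP 0 t) => [t0|t0] /=; last first.
  apply: cvg_near_cst; near=> m.
  by have [-> _] := @cutoff_small r m t (le_trans (mulr_ge0_le0 (ler0n _ _) t0) ler01).
case: (leP t (r ^+ 2)) => [tr|rt] /=.
  apply: cvg_near_cst; near=> m.
  rewrite /cutoff !step_ge1 ?mulr1//.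
    by have : 0 <= m.+1%:R :> R by []; nra.
  have : 2 / t <= m.+1%:R by near: m; exact: ev.
  by rewrite ler_pdivrMr//; lra.
apply: cvg_near_cst; near=> m.
rewrite /cutoff [X in _ * X]step_le0 ?mulr0//.
have : 1 / (t - r ^+ 2) <= m.+1%:R by near: m; exact: ev.
by rewrite ler_pdivrMr ?subr_gt0//; lra.
Unshelve. all: by end_near. Qed.

(* A positive C^1 function equal to t for t >= dl, so that its real powers are
   C^1 on the whole line. *)
Definition posext (dl t : R) := t + dl^-1 * sqplus (dl - t).

Lemma posext_gt0 dl t : 0 < dl -> 0 < posext dl t.
Proof.
move=> d0; rewrite /posext; case: (leP t dl) => td.
  rewrite /sqplus max_l ?subr_ge0//.
  rewrite -(pmulr_rgt0 _ d0) mulrDr mulrA mulfV ?gt_eqF// mul1r.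
  by nra.
rewrite sqplus_le0 ?mulr0 ?addr0; last lra.
exact: lt_trans td.
Qed.

Lemma posext_id dl t : dl <= t -> posext dl t = t.
Proof. by move=> h; rewrite /posext sqplus_le0 ?mulr0 ?addr0// subr_le0. Qed.

Definition dposext (dl t : R) := 1 - dl^-1 * (2 * Num.max (dl - t) 0).

Lemma dposext_id dl t : dl <= t -> dposext dl t = 1.
Proof. by move=> h; rewrite /dposext max_r ?subr_le0// !mulr0 subr0. Qed.

Lemma C1_posext dl : C1 (posext dl) (dposext dl).
Proof.
have := C1D (@C1_id R) (C1Z dl^-1 (C1_comp C1_sqplus (C1_affine dl (-1)))).
rewrite (_ : _ \+ _ = posext dl); last first.
  by apply/funext => t /=; rewrite /posext mulN1r.
by move=> /C1_ext; apply=> t; rewrite /dposext /= mulN1r; ring.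
Qed.

Lemma C1_ln (g g' : R -> R) : (forall t, 0 < g t) -> C1 g g' ->
  C1 (fun t => ln (g t)) (fun t => (g t)^-1 * g' t).
Proof.
move=> g0 Cg; have cg := C1_continuous Cg; case: Cg => dg cg'; split=> t.
  exact: (@is_derive1_comp R (@ln R) g t _ _ (is_derive1_ln (g0 t)) (dg t)).
apply: cvgM; last exact: cg'.
by apply: cvgV; [rewrite gt_eqF|exact: cg].
Qed.

(** The cut-off times t^(-c). Replacing [t] by [posext] changes nothing, as the cut-off vanishes for
    t <= 1/(m+1), but makes the power C^1 on the whole line. *)
Definition cutpow r m c t :=
  cutoff r m t * expR (- c * ln (posext m.+1%:R^-1 t)).

Definition dcutpow r m c t :=
  dcutoff r m t * expR (- c * ln (posext m.+1%:R^-1 t))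
  + cutoff r m t * (expR (- c * ln (posext m.+1%:R^-1 t))
      * (- c * ((posext m.+1%:R^-1 t)^-1 * dposext m.+1%:R^-1 t))).

Lemma C1_cutpow r m c : C1 (cutpow r m c) (dcutpow r m c).
Proof.
apply: C1M; first exact: C1_cutoff.
apply: (C1_comp (@C1_expR R)); apply: C1Z; apply: C1_ln; last exact: C1_posext.
by move=> t; apply: posext_gt0.
Qed.

Lemma cutpowE r m c t : 0 < t -> cutpow r m c t = cutoff r m t * t `^ (- c).
Proof.
move=> t0; rewrite /cutpow; case: (leP (m.+1%:R * t) 1) => h.
  by have [-> _] := @cutoff_small r m t h; rewrite !mul0r.
by rewrite posext_id ?/powR ?gt_eqF// -[X in X <= _]mul1r ler_pdivrMr// mulrC ltW.
Qed.

Lemma dcutpowE r m c t : 0 < t -> dcutpow r m c t =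
  dcutoff r m t * t `^ (- c) - c * cutoff r m t * (t `^ (- c) * t^-1).
Proof.
move=> t0; rewrite /dcutpow; case: (leP (m.+1%:R * t) 1) => h.
  by have [-> ->] := @cutoff_small r m t h; rewrite !(mul0r,mulr0) addr0 subr0.
have th : m.+1%:R^-1 <= t.
  by rewrite -[X in X <= _]mul1r ler_pdivrMr// mulrC ltW.
rewrite posext_id// dposext_id// /powR gt_eqF//; ring.
Qed.

Lemma cutpow_out r m c t : t <= 0 \/ r ^+ 2 + 1 <= t ->
  cutpow r m c t = 0 /\ dcutpow r m c t = 0.
Proof.
move=> h; have [c0 d0] : cutoff r m t = 0 /\ dcutoff r m t = 0.
  case: h => h; last exact: cutoff_large.
  apply: cutoff_small; rewrite (le_trans _ ler01)//.
  by rewrite mulr_ge0_le0.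
by rewrite /cutpow /dcutpow c0 d0 !mul0r addr0.
Qed.

Lemma bounded_compact_support (f : R -> R) (a b : R) : continuous f ->
  (forall t, t <= a \/ b <= t -> f t = 0) -> exists C, forall t, `|f t| <= C.
Proof.
move=> cf f0; case: (leP a b) => [ab|ba]; last first.
  by exists 0 => t; rewrite f0 ?normr0//; case: (leP t a) => h; [left|right]; lra.
have cn : {within `[a, b], continuous (fun t => `|f t|)}.
  by apply: continuous_subspaceT => t; apply: cvg_norm; exact: cf.
have [c _ hc] := EVT_max ab cn.
exists `|f c| => t; case: (leP t a) => ta; first by rewrite f0 ?normr0//; left.
case: (leP b t) => tb; first by rewrite f0 ?normr0//; right.
by apply: hc; rewrite in_itv/= !ltW.
Qed.

Lemma cutpow_bounded r m c :
  exists C, forall t, `|cutpow r m c t| <= C /\ `|dcutpow r m c t| <= C.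
Proof.
have out := @cutpow_out r m c.
have [C hC] := bounded_compact_support (C1_continuous (C1_cutpow r m c))
  (fun t h => (out t h).1).
have [D hD] := bounded_compact_support (C1_cutpow r m c).2 (fun t h => (out t h).2).
by exists (Num.max C D) => t; rewrite !le_max hC hD orbT.
Qed.

End cutoff.

(** * Loop equation on the sphere *)

Section homogeneity.
Context {R : realType} {n : nat}.
Variables (lam : R) (x y : n.-tuple R).
Hypothesis xy : forall i, tnth y i = lam * tnth x i.

Lemma psum_scale a : psum a y = lam ^+ a * psum a x.
Proof.
by rewrite /psum mulr_sumr; apply: eq_bigr => i _; rewrite xy exprMn.
Qed.

Lemma pprod_scale s : pprod s y = lam ^+ sumn s * pprod s x.
Proof.
elim: s => [|a s IH]; first by rewrite /pprod !big_nil mul1r.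
by rewrite !pprod_cons psum_scale IH /= exprD; ring.
Qed.

(** The degree [e + sumn s - 1] may be -1, so both sides are multiplied by [lam]. *)
Lemma pgrad_scale e s : lam * pgrad e s y = lam ^+ (e + sumn s) * pgrad e s x.
Proof.
elim: s => [|a s IH] /=; first by rewrite !mulr0.
rewrite mulrDr [lam * (psum a y * _)]mulrCA IH !psum_scale pprod_scale.
rewrite mulrDr; congr (_ + _); last by rewrite !exprD; ring.
case: a => [|a]; first by rewrite !mul0r !mulr0.
by rewrite addnS /= addSn addnS exprS !exprD; ring.
Qed.

End homogeneity.

(** Euler's identity for a homogeneous polynomial of degree [sumn s]. *)
Lemma pgrad1 (R : realType) n s (x : n.-tuple R) :
  pgrad 1 s x = (sumn s)%:R * pprod s x.
Proof.
elim: s => [|a s IH] /=; first by rewrite mul0r.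
by rewrite IH pprod_cons natrD; ring.
Qed.

Section homogeneity_pairs.
Context {R : realType} {n : nat}.
Variables (lam : R) (x y : n.+1.-tuple R).
Hypothesis xy : forall i, tnth y i = lam * tnth x i.

Lemma pair_sum_scale e : lam * pair_sum e y = lam ^+ e * pair_sum e x.
Proof.
case: e => [|e].
  by rewrite /pair_sum !big_ord0 !mul0r !subrr !mulr0.
rewrite /pair_sum mulrCA [in RHS]mulrCA; congr (_ * _).
rewrite !mulrBr mulr_sumr [in RHS]mulr_sumr (psum_scale xy); congr (_ - _).
  apply: eq_bigr => a _; rewrite !(psum_scale xy) exprS.
  rewrite -[X in _ = _ * lam ^+ X * _](@subnK a e) ?exprD; last by rewrite -ltnS.
  by ring.
by rewrite exprS /=; ring.
Qed.

(** The homogeneity degree of the weight: beta times the number of pairs in dimension [n.+1]. *)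
Definition vdegree (beta : R) : R := beta * (n.+1%:R * n%:R / 2).

Lemma vandermonde_weight_scale beta : 0 < beta -> 0 < lam ->
  vandermonde_weight beta y = lam `^ vdegree beta * vandermonde_weight beta x.
Proof.
move=> b0 l0; rewrite !vandermonde_weightE//.
under eq_bigr do under eq_bigr do
  rewrite !xy -mulrBr normrM powRM// (gtr0_norm l0).
have cE (i : 'I_n.+1) : #|(fun k : 'I_n.+1 => k != i)| = n.
  by transitivity #|predC1 i|; [exact: eq_card|rewrite cardC1 card_ord].
under eq_bigr do rewrite big_split/= prodr_const cE.
rewrite big_split/= prodr_const; congr (_ * _).
rewrite card_ord -!powR_mulrn ?powR_ge0// -!powRrM; congr (_ `^ _).
by rewrite /vdegree /=; field.
Qed.

End homogeneity_pairs.

(** For [e = 1] every difference quotient is 1, so the sum counts the pairs. *)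
Lemma pair_sum1 (R : realType) n (x : n.+1.-tuple R) :
  pair_sum 1 x = n.+1%:R * n%:R / 2.
Proof.
rewrite /pair_sum big_ord_recl big_ord0 /psum.
under eq_bigr do rewrite expr0.
by rewrite sumr_const card_ord -(natr1 n); field.
Qed.

Section sphere.
Context {R : realType} {n : nat}.
Variables (beta r : R).
Hypotheses (beta0 : 0 < beta) (r0 : 0 < r).
Local Notation vec := (n.+1.-tuple R).
Implicit Types (x : vec) (F : vec -> R).

Lemma psum2_enorm x : psum 2 x = enorm x ^+ 2.
Proof. by rewrite sqr_sqrtr// sumr_ge0// => i _; exact: sqr_ge0. Qed.

Lemma tnth_radial x i : tnth (radial r x) i = r / enorm x * tnth x i.
Proof. by rewrite tnth_mktuple. Qed.

Lemma enorm_ge0 x : 0 <= enorm x. Proof. exact: sqrtr_ge0. Qed.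

Lemma tnth_le_enorm x i : `|tnth x i| <= enorm x.
Proof.
rewrite -(ler_pXn2r (n := 2)) ?nnegrE ?enorm_ge0// -psum2_enorm real_normK ?num_real//.
by rewrite /psum (bigD1 i)//= lerDl sumr_ge0// => j _; exact: sqr_ge0.
Qed.

Lemma radial_cube x : cube n.+1 r (radial r x).
Proof.
move=> i; rewrite tnth_radial normrM normrM (gtr0_norm r0).
rewrite normfV (ger0_norm (enorm_ge0 x)).
have := enorm_ge0 x; rewrite le_eqVlt => /orP[/eqP <-|x0].
  by rewrite invr0 mulr0 mul0r ltW.
by rewrite -mulrA ler_piMr ?(ltW r0)// mulrC ler_pdivrMr// mul1r tnth_le_enorm.
Qed.

Definition cube_bounded F := exists C, forall x, cube n.+1 r x -> `|F x| <= C.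

Lemma ubounded_cube_bounded F : ubounded r (fun _ => F) -> cube_bounded F.
Proof. by move=> [C hC]; exists C => x; apply: (hC 1); rewrite ltr01 lexx. Qed.

Lemma vandermonde_bounded : cube_bounded (@vandermonde_weight R beta n.+1).
Proof.
apply: ubounded_cube_bounded.
apply: ubounded_prod => j _; apply: ubounded_prod => k _.
exists ((2 * r) `^ beta) => e x _ hx; rewrite ger0_norm ?powR_ge0//.
apply: ge0_ler_powR; rewrite ?nnegrE ?mulr_ge0//; [exact: ltW|exact: ltW|].
by rewrite mulrDl !mul1r (le_trans (ler_normB _ _))// lerD.
Qed.

Lemma cube_boundedM F G : cube_bounded F -> cube_bounded G ->
  cube_bounded (fun x => F x * G x).
Proof.
move=> [C hC] [D hD]; exists (C * D) => x hx.
by rewrite normrM ler_pM ?hC ?hD.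
Qed.

Lemma integrable_radial F : measurable_fun [set: vec] F -> cube_bounded F ->
  (lebesgue_tuple n.+1).-integrable (pointed_ball r)
    (fun x => (F (radial r x) * vandermonde_weight beta (radial r x))%:E).
Proof.
move=> mF bF; have [C hC] := cube_boundedM bF vandermonde_bounded.
apply: measurable_bounded_integrable.
- exact: measurable_pointed_ball.
- apply: le_lt_trans (lebesgue_tuple_cube_lty n.+1 r).
  apply: le_measure; rewrite ?inE.
  + exact: measurable_pointed_ball.
  + exact: measurable_cube.
  + move=> x /andP[_ xr] i; exact: le_trans (tnth_le_enorm _ _) xr.
- apply: measurable_funTS; apply: measurable_funM.
    exact: (measurableT_comp mF (measurable_radial r)).
  exact: (measurableT_comp (@measurable_vandermonde_weight R beta n.+1)
    (measurable_radial r)).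
- exists C; split; first exact: num_real.
  by move=> c Cc x _ /=; apply: (le_trans (hC _ (radial_cube x))); exact: ltW.
Qed.

(** Polar coordinates in reverse: the integrand is constant on rays, so up to the factor
    [n.+1%:R / r] this is the weighted integral over the sphere. The factor cancels in means. *)
Definition sphere_integral F : R :=
  \int[lebesgue_tuple n.+1]_(x in pointed_ball r)
    (F (radial r x) * vandermonde_weight beta (radial r x)).

Lemma sphere_integralD F G : measurable_fun [set: vec] F -> cube_bounded F ->
  measurable_fun [set: vec] G -> cube_bounded G ->
  sphere_integral (fun x => F x + G x) = sphere_integral F + sphere_integral G.
Proof.
move=> mF bF mG bG; rewrite /sphere_integral.
under eq_Rintegral do rewrite mulrDl.
rewrite RintegralD//.
- exact: measurable_pointed_ball.
- exact: integrable_radial.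
- exact: integrable_radial.
Qed.

Lemma sphere_integralZ c F : measurable_fun [set: vec] F -> cube_bounded F ->
  sphere_integral (fun x => c * F x) = c * sphere_integral F.
Proof.
move=> mF bF; rewrite /sphere_integral.
under eq_Rintegral do rewrite -mulrA.
rewrite RintegralZl//.
- exact: measurable_pointed_ball.
- exact: integrable_radial.
Qed.

Section loop_equation.
Variables (e : nat) (s : seq nat).

Definition loop_fun x : R :=
  e%:R * psum e.-1 x * pprod s x + pgrad e s x + beta * pair_sum e x * pprod s x.

(** The homogeneity degree of [loop_fun] times the weight; dividing by |x|^q makes the divergence
    constant on rays, apart from the cut-off. *)
Let q : R := (e + sumn s)%:R - 1 + @vdegree R n beta.

Let K x := (loop_fun x - (n.+1%:R + q) * r ^- 2 * pprod (e.+1 :: s) x)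
  * vandermonde_weight beta x.

(* The second field is radial; subtracting its divergence makes the total field
   tangent to the spheres, so that no derivative of the cut-off survives. *)
Let loop_diff m x : cutoff r m (psum 2 x) * (r `^ (- q) * K (radial r x)) =
  (loop_term beta e s (cutpow r m (q / 2)) (dcutpow r m (q / 2)) x
  - loop_term beta 1 (e.+1 :: s) (cutpow r m (q / 2 + 1)) (dcutpow r m (q / 2 + 1)) x)
  * vandermonde_weight beta x.
Proof.
have [t0|t0] := leP (psum 2 x) 0.
  have out c : cutpow r m c (psum 2 x) = 0 /\ dcutpow r m c (psum 2 x) = 0.
    by apply: cutpow_out; left.
  have [c0 _] : cutoff r m (psum 2 x) = 0 /\ dcutoff r m (psum 2 x) = 0.
    by apply: cutoff_small; rewrite (le_trans _ ler01)// mulr_ge0_le0.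
  rewrite /loop_term (out _).1 (out _).2 (out _).1 (out _).2 c0 !mulr0.
  by rewrite !mul0r addr0 subrr mul0r.
have x0 : 0 < enorm x.
  by rewrite lt_def enorm_ge0 andbT; apply: contraTneq t0 => x0; rewrite psum2_enorm x0 expr0n ltxx.
set lam := r / enorm x.
have l0 : 0 < lam by rewrite divr_gt0.
have xy := tnth_radial x; rewrite -/lam in xy.
have tE : psum 2 x = r ^+ 2 * lam ^- 2.
  by rewrite psum2_enorm /lam; field; rewrite !gt_eqF.
(* Real powers are used since the degree [e + sumn s - 1] may be -1. *)
have LE : loop_fun (radial r x) = lam `^ ((e + sumn s)%:R - 1) * loop_fun x.
  rewrite powRB; last by rewrite (gt_eqF l0) implybT.
  rewrite powRr1 ?(ltW l0)// powR_mulrn ?(ltW l0)//.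
  apply: (mulfI (lt0r_neq0 l0)); rewrite [RHS]mulrA.
  have -> : lam * (lam ^+ (e + sumn s) / lam) = lam ^+ (e + sumn s).
    by rewrite mulrC divfK// gt_eqF.
  rewrite /loop_fun !mulrDr (pgrad_scale xy); congr (_ + _ + _).
    rewrite (pprod_scale xy) (psum_scale xy).
    case: (e) => [|e']; first by rewrite !mul0r !mulr0.
    by rewrite addSn exprS exprD /=; ring.
  transitivity (beta * (lam * pair_sum e (radial r x)) * pprod s (radial r x)).
    by ring.
  by rewrite (pair_sum_scale xy) (pprod_scale xy) exprD; ring.
have FE : pprod (e.+1 :: s) (radial r x) = lam `^ ((e + sumn s)%:R - 1) * lam ^+ 2
    * pprod (e.+1 :: s) x.
  rewrite (pprod_scale xy) /= addSn -powR_mulrn ?(ltW l0)// -powR_mulrn ?(ltW l0)//.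
  rewrite -powRD ?(gt_eqF l0) ?implybT//; congr (_ `^ _ * _).
  by rewrite -natr1; ring.
have KE : K (radial r x) = lam `^ q * (loop_fun x - (n.+1%:R + q) * (psum 2 x)^-1
    * pprod (e.+1 :: s) x) * vandermonde_weight beta x.
  rewrite /K LE FE (vandermonde_weight_scale xy beta0 l0) tE /q.
  rewrite [lam `^ (_ - 1 + _)]powRD ?(gt_eqF l0) ?implybT//.
  move: (lam `^ _) (lam `^ _) => A B; field.
  by rewrite !gt_eqF.
(* As [lam = r / enorm x], both sides are |x|^(-q). This explains the exponent [q / 2] of the first
   cut-off and, for a polynomial two degrees higher, the exponent [q / 2 + 1] of the second. *)
have tq : r `^ (- q) * lam `^ q = psum 2 x `^ (- (q / 2)).
  rewrite tE powRM ?exprn_ge0 ?invr_ge0 ?exprn_ge0 ?ltW//.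
  rewrite -powR_invn ?ltW// -powR_mulrn ?ltW// -!powRrM; congr (_ `^ _ * _ `^ _).
    by field.
  by field.
rewrite KE !mulrA -[cutoff _ _ _ * _ * _]mulrA tq.
congr (_ * _).
have tc : psum 2 x `^ (- (q / 2 + 1)) = psum 2 x `^ (- (q / 2)) * (psum 2 x)^-1.
  rewrite opprD powRD ?(gt_eqF t0) ?implybT//.
  by rewrite powR_inv1// ltW.
rewrite /loop_term !cutpowE// !dcutpowE// tc pgrad1 pair_sum1 /loop_fun.
have -> : psum 0 x = n.+1%:R.
  by rewrite /psum; under eq_bigr do rewrite expr0; rewrite sumr_const card_ord.
rewrite pprod_cons /= [(e.+1 + _)%:R]natrD -(natr1 e).
move: (psum 2 x `^ (- (q / 2))) => A.
rewrite /q /vdegree natrD; move: (lt0r_neq0 t0).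
move: (cutoff _ _ _) (dcutoff _ _ _) => c dc.
move: (psum 2 x) => t tn0; field.
by rewrite tn0.
Qed.

Let measurable_loop_fun : measurable_fun [set: vec] loop_fun.
Proof.
by repeat first [exact: measurable_cst|exact: measurable_pprod
  |exact: measurable_pgrad|exact: measurable_pair_sum
  |exact: measurable_psum|apply: measurable_funD|apply: measurable_funM].
Qed.


Let cube_bounded_loop_fun : cube_bounded loop_fun.
Proof.
by apply: ubounded_cube_bounded;
  repeat first [exact: ubounded_cst|exact: ubounded_pprod
  |exact: ubounded_pgrad|exact: ubounded_psum|exact: ubounded_coord
  |apply: uboundedX|apply: uboundedN|apply: uboundedD|apply: uboundedM
  |apply: ubounded_sum => ? _].
Qed.

Let measurable_K : measurable_fun [set: vec] K.
Proof.
apply: measurable_funM; last exact: measurable_vandermonde_weight.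
apply: measurable_funB; first exact: measurable_loop_fun.
by apply: measurable_funM => //; exact: measurable_pprod.
Qed.

Let cube_bounded_K : cube_bounded K.
Proof.
apply: cube_boundedM vandermonde_bounded.
have [C hC] := cube_bounded_loop_fun.
have [D hD] : cube_bounded (fun x => (n.+1%:R + q) * r ^- 2 * pprod (e.+1 :: s) x).
  by apply: ubounded_cube_bounded; apply: uboundedM;
    [exact: ubounded_cst|exact: ubounded_pprod].
by exists (C + D) => x hx; rewrite (le_trans (ler_normB _ _))// lerD ?hC ?hD.
Qed.

Let integral_cutoff m :
  (\int[lebesgue_tuple n.+1]_x (cutoff r m (psum 2 x) * K (radial r x))%:E = 0)%E.
Proof.
have cint c e' s' : (lebesgue_tuple n.+1).-integrable setT
    (fun x => (loop_term beta e' s' (cutpow r m c) (dcutpow r m c) x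
      * vandermonde_weight beta x)%:E) /\
    (\int[lebesgue_tuple n.+1]_x (loop_term beta e' s' (cutpow r m c) (dcutpow r m c) x
      * vandermonde_weight beta x)%:E = 0)%E.
  have [C hC] := cutpow_bounded r m c.
  apply: (@integral_loop_term R n beta beta0 e' s' _ _ (r + 1) C).
  - by rewrite addr_ge0// ltW.
  - exact: C1_cutpow.
  - move=> t rt; apply: cutpow_out; right; apply: (le_trans _ (ltW rt)).
    by rewrite sqrrD1 lerD2r lerDl mulrn_wge0// ltW.
  - exact: hC.
have [i1 e1] := cint (q / 2) e s.
have [i2 e2] := cint (q / 2 + 1) 1%N (e.+1 :: s).
have rq : r `^ (- q) != 0 by rewrite gt_eqF// powR_gt0.
transitivity (\int[lebesgue_tuple n.+1]_x ((r `^ (- q))^-1%:E *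
   ((loop_term beta e s (cutpow r m (q / 2)) (dcutpow r m (q / 2)) x
     * vandermonde_weight beta x)%:E -
    (loop_term beta 1 (e.+1 :: s) (cutpow r m (q / 2 + 1)) (dcutpow r m (q / 2 + 1)) x
     * vandermonde_weight beta x)%:E)))%E.
  apply: eq_integral => x _; rewrite -EFinB -mulrBl -loop_diff -EFinM; congr EFin.
  by rewrite [RHS]mulrCA mulKf.
rewrite integralZl//; last exact: integrableB.
by rewrite integralB// e1 e2 sube0 mule0.
Qed.

(** The cut-offs tend to the indicator of the pointed ball, which turns the vanishing integrals into
    an identity on the sphere. In [n.+1%:R + q] the dimension comes from the radial field and [q]
    from differentiating |x|^(-q). *)
Lemma sphere_loop :
  sphere_integral loop_fun = (n.+1%:R + q) * r ^- 2 * sphere_integral (pprod (e.+1 :: s)).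
Proof.
have [C hC] := cube_bounded_K.
have C0 : 0 <= C by apply: le_trans (hC _ (radial_cube (nseq_tuple n.+1 0))).
pose f (x : vec) : R := \1_(pointed_ball r) x * K (radial r x).
have mKr : measurable_fun [set: vec] (fun x => K (radial r x)).
  exact: (measurableT_comp measurable_K (measurable_radial r)).
have mf : measurable_fun [set: vec] (fun x => (f x)%:E).
  apply/measurable_EFinP; apply: measurable_funM => //.
  by apply: measurable_indic; exact: measurable_pointed_ball.
pose g (x : vec) : \bar R := (C * \1_(cube n.+1 (r + 1)) x)%:E.
have f0 : (\int[lebesgue_tuple n.+1]_x (f x)%:E = 0)%E.
  have [] := @dominated_convergence _ _ _ (lebesgue_tuple n.+1) setT measurableT
    (fun m x => (cutoff r m (psum 2 x) * K (radial r x))%:E) (fun x => (f x)%:E) g _ mf.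
  - move=> m; apply/measurable_EFinP; apply: measurable_funM => //.
    apply: (measurableT_comp (continuous_measurable_fun (C1_continuous (C1_cutoff r m)))).
    exact: measurable_psum.
  - apply: aeW => x _; apply: cvg_EFin; first exact: nearW.
    apply: cvgM; last exact: cvg_cst.
    have := @cvg_cutoff R r (psum 2 x); rewrite indicE.
    suff -> : (x \in pointed_ball r) = (0 < psum 2 x <= r ^+ 2) by [].
    apply/idP/idP; rewrite inE /pointed_ball/= psum2_enorm.
      by move=> /andP[x0 xr]; rewrite exprn_gt0//= lerXn2r// nnegrE ?enorm_ge0 ?(ltW r0).
    rewrite exprn_even_gt0//= ler_pXn2r// ?nnegrE ?enorm_ge0 ?(ltW r0)//.
    by move=> /andP[x0 xr]; rewrite xr andbT lt_def x0 enorm_ge0.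
  - apply: (@integrable_cube _ _ (r + 1) (fun x => C * \1_(cube n.+1 (r + 1)) x) C).
    + by apply: measurable_funM => //; apply: measurable_indic; exact: measurable_cube.
    + move=> x; rewrite normrM (ger0_norm C0) ler_piMr// indicE.
      by case: (_ \in _); rewrite ?normr1 ?normr0.
    + by move=> x xM; rewrite indicE memNset ?mulr0.
  - apply: aeW => x m _; rewrite /g lee_fin indicE.
    have [xM|xM] := pselect (cube n.+1 (r + 1) x).
      rewrite mem_set// mulr1 normrM (ger0_norm (cutoff_ge0 _ _ _)).
      rewrite -[leRHS]mul1r ler_pM ?cutoff_ge0 ?cutoff_le1// hC//.
      exact: radial_cube.
    rewrite memNset// mulr0 (cutoff_large _ _).1 ?mul0r ?normr0//.
    move/existsNP : xM => [i /negP]; rewrite -ltNge => xi.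
    apply: (@le_trans _ _ ((r + 1) ^+ 2)).
      by rewrite sqrrD1 lerD2r lerDl mulrn_wge0// ltW.
    rewrite psum2_enorm ler_pXn2r ?nnegrE ?enorm_ge0 ?addr_ge0 ?(ltW r0)//.
    exact: le_trans (ltW xi) (tnth_le_enorm _ _).
  move=> _ _ h; symmetry; apply: cvg_unique h => //.
  rewrite (_ : [sequence _]_n = cst 0%E); first exact: cvg_cst.
  by apply/funext => m /=; rewrite integral_cutoff.
have mF : measurable_fun [set: vec] (pprod (e.+1 :: s)) by exact: measurable_pprod.
have bF : cube_bounded (pprod (e.+1 :: s)).
  by apply: ubounded_cube_bounded; exact: ubounded_pprod.
apply/eqP; rewrite -subr_eq0 -mulNr -sphere_integralZ// -sphere_integralD//.
- apply/eqP; rewrite /sphere_integral /Rintegral.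
  suff -> : (\int[lebesgue_tuple n.+1]_(x in pointed_ball r)
     ((loop_fun (radial r x) + - ((n.+1%:R + q) * r ^- 2) * pprod (e.+1 :: s) (radial r x))
      * vandermonde_weight beta (radial r x))%:E = 0)%E by [].
  rewrite integral_mkcond -[RHS]f0; apply: eq_integral => x _.
  rewrite patchE /f indicE; case: ifPn => _; rewrite ?mul0r// mul1r.
  by rewrite /K mulNr.
- by apply: measurable_funM.
- have [D hD] := bF; exists (`|- ((n.+1%:R + q) * r ^- 2)| * D) => x hx.
  by rewrite normrM ler_wpM2l// hD.
Qed.

End loop_equation.
End sphere.

(** * Exchangeability *)

Section exchangeability.
Context {R : realType} {n : nat}.
Local Notation vec := (n.+1.-tuple R).

Section permuted.
Variables (sigma : 'S_n.+1) (x y : vec).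
Hypothesis xy : forall j, tnth y j = tnth x (sigma j).

Lemma enorm_perm : enorm y = enorm x.
Proof.
rewrite /enorm; congr Num.sqrt; rewrite [RHS](reindex_inj (@perm_inj _ sigma)).
by apply: eq_bigr => j _; rewrite xy.
Qed.

Lemma radial_perm r j : tnth (radial r y) j = tnth (radial r x) (sigma j).
Proof. by rewrite !tnth_radial enorm_perm xy. Qed.

Lemma vandermonde_weight_perm (beta : R) : 0 < beta ->
  vandermonde_weight beta y = vandermonde_weight beta x.
Proof.
move=> b0; rewrite !vandermonde_weightE//.
rewrite [RHS](reindex_inj (@perm_inj _ sigma)); apply: eq_bigr => j _.
rewrite [RHS](reindex_inj (@perm_inj _ sigma)); apply: eq_big => k.
  by rewrite (inj_eq (@perm_inj _ sigma)).
by rewrite !xy.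
Qed.

End permuted.

(** The permutation sends [i] to 0 and keeps the order of the other indices. *)
Lemma insert_perm (i : 'I_n.+1) p (j : 'I_n.+1) :
  tnth (@insert R n i p) j = tnth (insert ord0 p) (lift_perm i ord0 1%g j).
Proof.
case: (unliftP i j) => [k ->|->].
  by rewrite lift_perm_lift perm1 !tnth_insert_lift.
by rewrite lift_perm_id !tnth_insert_id.
Qed.

(** Extracting coordinate [i] or coordinate 0 represents the same integral over the same product
    space, and the two insertions of a point differ by a permutation, under which ball and weight
    are invariant. *)
Lemma sphere_integral_coord (beta r : R) (h : R -> R) (i : 'I_n.+1) :
  0 < beta -> 0 < r -> measurable_fun [set: R] h ->
  (exists C, forall t, `|t| <= r -> `|h t| <= C) ->
  sphere_integral beta r (fun x : vec => h (tnth x i)) =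
  sphere_integral beta r (fun x : vec => h (tnth x ord0)).
Proof.
move=> b0 r0 mh [C hC].
have int j : (lebesgue_tuple n.+1).-integrable (pointed_ball r) (fun x : vec =>
    (h (tnth (radial r x) j) * vandermonde_weight beta (radial r x))%:E).
  apply: (@integrable_radial R n beta r b0 r0 (fun x => h (tnth x j))).
    exact: (measurableT_comp mh (measurable_tnth j)).
  by exists C => x hx; exact: hC.
have mB := @measurable_pointed_ball R n.+1 r.
pose G j : vec -> \bar R := (fun x : vec =>
    (h (tnth (radial r x) j) * vandermonde_weight beta (radial r x))%:E)
     \_ (pointed_ball r).
have iG j : (lebesgue_tuple n.+1).-integrable setT (G j).
  exact: (iffLR (integrable_mkcond _ mB) (int j)).
rewrite /sphere_integral /Rintegral; congr fine.
rewrite [LHS]integral_mkcond [RHS]integral_mkcond.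
rewrite (integral_insert i (iG i)) (integral_insert ord0 (iG ord0)).
apply: eq_integral => p _; rewrite /G !patchE.
have pp := insert_perm i p.
have -> : (insert i p \in pointed_ball r) = (insert ord0 p \in pointed_ball r).
  by apply/idP/idP; rewrite !inE /pointed_ball /= (enorm_perm pp).
case: ifP => // _; congr (_%:E); rewrite (radial_perm pp) lift_perm_id.
by rewrite (vandermonde_weight_perm (radial_perm pp r)).
Qed.

End exchangeability.

(** * Integrals against transported densities *)

Section density_transfer.
Context d1 d2 (T1 : measurableType d1) (T2 : measurableType d2) {R : realType}.
Variables (mu : {measure set T1 -> \bar R}) (nu : {measure set T2 -> \bar R}).
Variables (phi : T1 -> T2) (p : T1 -> R) (q : T2 -> R).
Hypotheses (mphi : measurable_fun [set: T1] phi).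
Hypotheses (mp : measurable_fun [set: T1] p) (mq : measurable_fun [set: T2] q).
Hypotheses (p0 : forall x, 0 <= p x) (q0 : forall y, 0 <= q y).
Hypothesis pq : forall A, measurable A ->
  (\int[mu]_(x in phi @^-1` A) (p x)%:E = \int[nu]_(y in A) (q y)%:E)%E.

Import HBNNSimple.
Local Open Scope ereal_scope.

Let transfer_nnsfun (h : {nnsfun T2 >-> R}) :
  \int[mu]_x (h (phi x) * p x)%:E = \int[nu]_y (h y * q y)%:E.
Proof.
have hE y : (h y = \sum_(r \in range h) (r * \1_(h @^-1` [set r]) y))%R by exact: fimfunE.
transitivity (\int[mu]_x (\sum_(r \in range h)
    (r * \1_(h @^-1` [set r]) (phi x) * p x)%:E)).
  by apply: eq_integral => x _; rewrite hE fsumEFin//; congr EFin; rewrite !fsbig_finite// big_distrl.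
transitivity (\int[nu]_y (\sum_(r \in range h)
    (r * \1_(h @^-1` [set r]) y * q y)%:E)); last first.
  by apply: eq_integral => x _; rewrite hE fsumEFin//; congr EFin; rewrite !fsbig_finite// big_distrl.
have h0 r y : (0 <= r * \1_(h @^-1` [set r]) y)%R.
  by have := nnfun_muleindic_ge0 h r y; rewrite -EFinM lee_fin.
rewrite !ge0_integral_fsum//.
- apply: eq_fsbigr => r rh.
  have r0 : (0 <= r)%R by move: rh; rewrite inE => -[y _ <-].
  have mhr : measurable (h @^-1` [set r]) by exact: measurable_funPTI.
  under eq_integral do rewrite -mulrA EFinM.
  under [RHS]eq_integral do rewrite -mulrA EFinM.
  rewrite !ge0_integralZl//; last 4 first.
  + by apply/measurable_EFinP; apply: measurable_funM => //; apply: measurable_indic.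
  + by move=> x _; rewrite lee_fin mulr_ge0.
  + apply/measurable_EFinP; apply: measurable_funM => //.
    exact: (measurableT_comp (measurable_indic mhr) mphi).
  + by move=> x _; rewrite lee_fin mulr_ge0.
  congr (_ * _).
  transitivity (\int[mu]_(x in phi @^-1` (h @^-1` [set r])) (p x)%:E).
    rewrite [RHS]integral_mkcond; apply: eq_integral => x _.
    rewrite patchE indicE; have -> : (x \in phi @^-1` (h @^-1` [set r])) = (phi x \in h @^-1` [set r]).
      by apply/idP/idP; rewrite !inE.
    by case: (phi x \in _); rewrite ?mul1r ?mul0r.
  rewrite pq// integral_mkcond; apply: eq_integral => x _.
  by rewrite patchE indicE; case: (x \in _); rewrite ?mul1r ?mul0r.
- move=> r; apply/measurable_EFinP; apply: measurable_funM => //.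
  by apply: measurable_funM => //; apply: measurable_indic; exact: measurable_funPTI.
- by move=> r y _; rewrite lee_fin mulr_ge0.
- move=> r; apply/measurable_EFinP; apply: measurable_funM => //.
  apply: measurable_funM => //.
  have mhr : measurable (h @^-1` [set r]) by exact: measurable_funPTI.
  exact: (measurableT_comp (measurable_indic mhr) mphi).
- by move=> r y _; rewrite lee_fin mulr_ge0.
Qed.

(** The hypothesis [pq] is the case of indicators; linearity gives simple functions and monotone
    convergence the rest. *)
Lemma ge0_integral_density_transfer (g : T2 -> R) :
  measurable_fun setT g -> (forall y, 0 <= g y)%R ->
  \int[mu]_x (g (phi x) * p x)%:E = \int[nu]_y (g y * q y)%:E.
Proof.
move=> mg g0; have mgE : measurable_fun setT (EFin \o g) by exact/measurable_EFinP.
pose h := nnsfun_approx measurableT mgE.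
have hg y : (h m y)%:E @[m --> \oo] --> (g y)%:E.
  by apply: (@cvg_nnsfun_approx _ _ _ _ measurableT _ mgE) => // z _; rewrite lee_fin.
have hle a b y : (a <= b)%N -> (h a y <= h b y)%R.
  by move=> ab; exact/lefP/nd_nnsfun_approx.
transitivity (limn (fun m => \int[mu]_x (h m (phi x) * p x)%:E)).
  rewrite -monotone_convergence//.
  - apply: eq_integral => x _; apply/esym/cvg_lim => //.
    under eq_fun do rewrite EFinM; rewrite EFinM.
    by apply: cvgeZr => //; exact: hg.
  - move=> m; apply/measurable_EFinP; apply: measurable_funM => //.
    exact: (measurableT_comp (measurable_funPT (h m)) mphi).
  - by move=> m x _; rewrite lee_fin mulr_ge0.
  - by move=> x _ a b ab; rewrite lee_fin ler_wpM2r ?hle.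
transitivity (limn (fun m => \int[nu]_y (h m y * q y)%:E)).
  by congr (limn _); apply/funext => m; exact: transfer_nnsfun.
rewrite -monotone_convergence//.
- apply: eq_integral => x _; apply/cvg_lim => //.
  under eq_fun do rewrite EFinM; rewrite EFinM.
  by apply: cvgeZr => //; exact: hg.
- by move=> m; apply/measurable_EFinP; apply: measurable_funM.
- by move=> m x _; rewrite lee_fin mulr_ge0.
- by move=> x _ a b ab; rewrite lee_fin ler_wpM2r ?hle.
Qed.

End density_transfer.

(** * The level density as a sphere integral *)

(** A case of the transfer along the identity map: [mu] with density [\1_D] and [mrestr mu mD] with
    density 1 agree on sets. *)
Lemma ge0_integral_mrestr d (T : measurableType d) (R : realType)
    (mu : {measure set T -> \bar R}) (D : set T) (mD : measurable D) (g : T -> R) :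
  measurable_fun setT g -> (forall x, 0 <= g x) ->
  (\int[mrestr mu mD]_x (g x)%:E = \int[mu]_(x in D) (g x)%:E)%E.
Proof.
move=> mg g0.
rewrite [RHS]integral_mkcond.
transitivity (\int[mrestr mu mD]_x (g x * cst 1 x)%:E)%E.
  by apply: eq_integral => x _; rewrite mulr1.
rewrite -(@ge0_integral_density_transfer _ _ _ _ R mu _ id \1_D)//.
- by apply: eq_integral => x _; rewrite patchE indicE; case: (x \in D);
    rewrite ?mulr1 ?mulr0.
- move=> A mA; rewrite preimage_id integral_indic//.
  transitivity (mrestr mu mD A); first by rewrite /mrestr setIC.
  by rewrite -[LHS]mul1e -integral_cst.
Qed.

(** Uniqueness of Lebesgue measure: the rescaled measure has the same values on half-open
    intervals. *)
Lemma lebesgue_measure_scale (R : realType) (sg : R) (A : set (measurableTypeR R)) :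
  0 < sg -> measurable A ->
  (sg%:E * lebesgue_measure ((fun t : measurableTypeR R => (sg * t)%R) @^-1` A)
   = lebesgue_measure A)%E.
Proof.
move=> s0 mA.
have ms : measurable_fun [set: measurableTypeR R]
    ((fun t => sg * t) : measurableTypeR R -> measurableTypeR R).
  by apply: measurable_funM.
pose sgn : {nonneg R} := NngNum (ltW s0).
pose m : {measure set (measurableTypeR R) -> \bar R} :=
  mscale sgn (measure_function_pushforward__canonical__measure_function_Measure
    (@lebesgue_measure R) ms).
symmetry; apply: (@lebesgue_measure_unique R m) => // _ [[a b]] _ <-.
rewrite /m /= /mscale /= /pushforward.
have -> : (fun t : R => sg * t) @^-1` [set` `]a, b]%R] = [set` `](a / sg)%R, (b / sg)%R]%R].
  apply/seteqP; split=> t; rewrite /= !in_itv/= ltr_pdivrMr// ler_pdivlMr// mulrC;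
    by [].
rewrite !lebesgue_measure_itv/= !lte_fin ltr_pM2r ?invr_gt0//.
case: ifP => _; last by rewrite mule0.
by rewrite -EFinB -EFinM -mulrBl mulrC divfK ?gt_eqF.
Qed.

Lemma ge0_integral_scale (R : realType) (sg : R) (g : R -> R) :
  0 < sg -> measurable_fun setT g -> (forall t, 0 <= g t) ->
  (\int[lebesgue_measure]_t (g (sg * t) * sg)%:E =
   \int[lebesgue_measure]_t (g t)%:E)%E.
Proof.
move=> s0 mg g0.
transitivity (\int[lebesgue_measure]_t (g t * cst 1 t)%:E)%E; last first.
  by apply: eq_integral => t _; rewrite mulr1.
apply: (@ge0_integral_density_transfer _ _ (measurableTypeR R) (measurableTypeR R) R
  (@lebesgue_measure R) (@lebesgue_measure R) (fun t => sg * t) (cst sg) (cst 1)) => //.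
- exact: measurable_funM.
- by move=> t; exact: ltW.
move=> A mA.
have mA' : measurable ((fun t : measurableTypeR R => sg * t) @^-1` A).
  by rewrite -[X in measurable X]setTI; apply: measurable_funM.
transitivity (sg%:E * lebesgue_measure ((fun t : measurableTypeR R => (sg * t)%R) @^-1` A))%E.
  exact: (integral_cst _ mA' sg%:E).
rewrite lebesgue_measure_scale// -[LHS]mul1e; symmetry.
exact: (integral_cst _ mA 1%E).
Qed.

Section level_density.
Context {R : realType} {n : nat}.
Variables (beta : R) (rho : R -> R).
Hypotheses (beta0 : 0 < beta) (n0 : (0 < n)%N).
Hypothesis hrho : is_level_density beta n.+1 rho.
Local Notation r := ((@fte_radius R n.+1)%:num : R).
Local Notation vec := (n.+1.-tuple R).

Lemma fte_radius_gt0 : 0 < r.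
Proof.
rewrite /= sqrtr_gt0 divr_gt0// mulr_gt0// subr_gt0 ltr1n.
by rewrite ltnS.
Qed.
Let r0 := fte_radius_gt0.

Let mw : measurable_fun [set: vec] (fun x => vandermonde_weight beta (radial r x)).
Proof.
exact: (measurableT_comp (@measurable_vandermonde_weight R beta n.+1) (measurable_radial r)).
Qed.

Let mB := @measurable_pointed_ball R n.+1 r.

Lemma fte_unnormalizedE (U : set vec) : measurable U ->
  (fte_unnormalized beta U = (n.+1%:R / r)%:E * \int[lebesgue_tuple n.+1]_x
     (\1_(radial r @^-1` U) x * (\1_(pointed_ball r) x
        * vandermonde_weight beta (radial r x)))%:E)%E.
Proof.
move=> mU; have mrU : measurable (radial r @^-1` U).
  by rewrite -[X in measurable X]setTI; exact: (measurable_radial r).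
rewrite /fte_unnormalized (@ge0_integral_pushforward _ _ _ _ R (radial r)
  (measurable_radial r) _ U (fun x => (vandermonde_weight beta x)%:E))//; first last.
- by move=> x _; rewrite lee_fin vandermonde_weight_ge0.
- by apply/measurable_EFinP/measurable_funTS; exact: measurable_vandermonde_weight.
rewrite [LHS](@ge0_integral_mscale _ _ R (mrestr (lebesgue_tuple n.+1) mB) _ mrU _
  (fun x => (vandermonde_weight beta (radial r x))%:E)); last 2 first.
- by apply/measurable_EFinP/measurable_funTS.
- by move=> x _; rewrite lee_fin vandermonde_weight_ge0.
congr (_ * _)%E; rewrite integral_mkcond.
transitivity (\int[mrestr (lebesgue_tuple n.+1) mB]_x
    (\1_(radial r @^-1` U) x * vandermonde_weight beta (radial r x))%:E)%E.
  apply: eq_integral => x _; rewrite patchE indicE.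
  by case: (x \in _); rewrite ?mul1r ?mul0r.
rewrite ge0_integral_mrestr.
- rewrite integral_mkcond; apply: eq_integral => x _; rewrite patchE !indicE.
  by case: (x \in pointed_ball _); rewrite ?mul1r ?(mul0r,mulr0).
- by apply: measurable_funM => //; apply: measurable_indic.
- by move=> x; rewrite indicE mulr_ge0// vandermonde_weight_ge0.
Qed.

Lemma first_eigenvalueE (x : vec) : first_eigenvalue x = tnth x ord0.
Proof. by rewrite (tnth_nth 0). Qed.

Let first_preimage (A : set R) : measurable A ->
  measurable ((fun x : vec => tnth x ord0) @^-1` A).
Proof.
by move=> mA; rewrite -[X in measurable X]setTI; exact: (measurable_tnth ord0).
Qed.

(* A total mass 0 or +oo is excluded by the existence of a density: the default
   value of mnormalize is then a dirac measure. *)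
Lemma level_density_scale : exists2 c : R, 0 <= c & forall A : set (measurableTypeR R),
  measurable A ->
  (\int[lebesgue_tuple n.+1]_(x in (fun x => tnth (radial r x) ord0) @^-1` A)
    (c * (\1_(pointed_ball r) x * vandermonde_weight beta (radial r x)))%:E =
   \int[lebesgue_measure]_(t in A) (rho t)%:E)%E.
Proof.
have [mrho rho0 hA] := hrho.
have EA (A : set (measurableTypeR R)) : (@first_eigenvalue R n.+1) @^-1` A =
    (fun x : vec => tnth x ord0) @^-1` A.
  by apply/seteqP; split=> x /=; rewrite first_eigenvalueE.
pose Z := @fte_unnormalized R beta n.+1 setT.
have PE (A : set (measurableTypeR R)) :
    distribution (fixed_trace_ensemble beta n.+1) (@first_eigenvalue R n.+1) A =
    (if (Z == 0%E) || (Z == +oo%E) then fun U => \d_(nseq_tuple n.+1 0 : vec) U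
     else fun U => (fte_unnormalized beta U * (fine Z)^-1%:E)%E)
    ((fun x : vec => tnth x ord0) @^-1` A) by rewrite -EA.
have [Zbad|Zgood] := boolP ((Z == 0%E) || (Z == +oo%E)).
  (* The singleton at 0 tells the two apart: the default dirac measure gives it mass 1, a density
     gives it mass 0. *)
  have := hA [set 0] (measurable_set1 0).
  rewrite integral_set1 PE Zbad diracE mem_set/=; last by rewrite /= (tnth_nth 0).
  by move=> /eqP; rewrite onee_eq0.
pose c := (fine Z)^-1 * (n.+1%:R / r).
have Z0 : 0 <= fine Z by rewrite fine_ge0// measure_ge0.
exists c; first by rewrite mulr_ge0 ?invr_ge0// divr_ge0// ltW.
move=> A mA; rewrite -hA//.
rewrite PE (negbTE Zgood) fte_unnormalizedE; last exact: first_preimage.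
rewrite muleAC -EFinM [X in (X%:E * _)%E]mulrC -/c.
rewrite -ge0_integralZl//.
- rewrite [LHS]integral_mkcond; apply: eq_integral => x _; rewrite patchE.
  rewrite [in RHS]indicE -EFinM.
  have -> : (x \in radial r @^-1` ((fun x0 : vec => tnth x0 ord0) @^-1` A)) =
    (x \in (fun x0 => tnth (radial r x0) ord0) @^-1` A).
    by apply/idP/idP; rewrite !inE.
  by case: (x \in _); rewrite ?mul1r ?mul0r ?mulr0.
- apply/measurable_EFinP; apply: measurable_funM.
    apply: measurable_indic; rewrite -[X in measurable X]setTI.
    by apply: (measurable_radial r) => //; exact: first_preimage.
  by apply: measurable_funM => //; exact: measurable_indic.
- by move=> x _; rewrite lee_fin !indicE !mulr_ge0// vandermonde_weight_ge0.
- by rewrite lee_fin mulr_ge0 ?invr_ge0// divr_ge0// ltW.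
Qed.

(** The constant is fixed by [c * mass = 1] alone, which yields both the positivity of the mass and
    the identification with a mean. *)
Lemma level_density_sphere_integral (sg : R) : 0 < sg -> exists c : R, [/\ 0 <= c,
   c * sphere_integral beta r (fun _ : vec => 1) = 1 &
   forall h : R -> R, measurable_fun setT h -> (exists C, forall t, `|h t| <= C) ->
   \int[lebesgue_measure]_t (h t * (sg * rho (sg * t))) =
   c * sphere_integral beta r (fun x : vec => h (tnth x ord0 / sg))].
Proof.
move=> s0; have [mrho rho0 hA] := hrho.
have [c c0 hc] := level_density_scale; exists c.
pose p (x : vec) := c * (\1_(pointed_ball r) x * vandermonde_weight beta (radial r x)).
have mp : measurable_fun setT p.
  apply: measurable_funM; first exact: measurable_cst.
  apply: measurable_funM; last exact: mw.
  exact: (measurable_indic mB).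
have p0 x : 0 <= p x.
  by rewrite /p indicE !mulr_ge0// vandermonde_weight_ge0.
have mphi : measurable_fun setT (fun x : vec => tnth (radial r x) ord0).
  exact: (measurableT_comp (measurable_tnth ord0) (measurable_radial r)).
have bint (h : R -> R) : measurable_fun setT h -> (exists C, forall t, `|h t| <= C) ->
    (lebesgue_tuple n.+1).-integrable (pointed_ball r) (fun x : vec =>
    (h (tnth (radial r x) ord0) * vandermonde_weight beta (radial r x))%:E).
  move=> mh [C hC].
  apply: (@integrable_radial R n beta r beta0 r0 (fun x => h (tnth x ord0))).
    exact: (measurableT_comp mh (measurable_tnth ord0)).
  by exists C => x _.
have ge0E (h : R -> R) : measurable_fun setT h -> (forall t, 0 <= h t) ->
    (exists C, forall t, `|h t| <= C) ->
    (\int[lebesgue_measure]_t (h t * rho t)%:E =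
     (c * sphere_integral beta r (fun x : vec => h (tnth x ord0)))%:E)%E.
  move=> mh h0 hb.
  rewrite -(@ge0_integral_density_transfer _ _ vec (measurableTypeR R) R
    (lebesgue_tuple n.+1) (@lebesgue_measure R) (fun x : vec => tnth (radial r x) ord0) p rho mphi mp mrho p0 rho0 hc h)//.
  rewrite EFinM /sphere_integral /Rintegral fineK; last first.
    by apply: integrable_fin_num => //; exact: bint.
  rewrite -integralZl//; last exact: bint.
  rewrite [RHS]integral_mkcond; apply: eq_integral => x _.
  rewrite patchE /p indicE; case: (x \in _); rewrite ?mul1r ?mul0r ?mulr0//.
  by rewrite mulrCA.
pose rs t := sg * rho (sg * t).
have mrs : measurable_fun setT rs.
  apply: measurable_funM => //; apply: (measurableT_comp mrho).
  exact: measurable_funM.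
have rs0 t : 0 <= rs t by rewrite mulr_ge0// ltW.
have mdiv (h : R -> R) : measurable_fun setT h -> measurable_fun setT (fun t : R => h (t / sg)).
  by move=> mh; apply: (measurableT_comp mh); exact: measurable_funM.
have scaleE (h : R -> R) : measurable_fun setT h -> (forall t, 0 <= h t) ->
    (exists C, forall t, `|h t| <= C) ->
    (\int[lebesgue_measure]_t (h t * rs t)%:E =
     (c * sphere_integral beta r (fun x : vec => h (tnth x ord0 / sg)))%:E)%E.
  move=> mh h0 [C hC].
  rewrite -(ge0E (fun t => h (t / sg)) (mdiv _ mh) (fun _ => h0 _)); last by exists C.
  rewrite -(@ge0_integral_scale R sg (fun t => h (t / sg) * rho t))//.
  - apply: eq_integral => t _; rewrite /rs [sg * t]mulrC mulfK ?gt_eqF//.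
    by congr EFin; ring.
  - by apply: measurable_funM => //; exact: mdiv.
  - by move=> t; rewrite mulr_ge0.
have irho : lebesgue_measure.-integrable setT (EFin \o rs).
  apply/integrableP; split; first exact/measurable_EFinP.
  under eq_integral do rewrite /= ger0_norm//.
  have /= := scaleE (cst 1) (measurable_cst _) (fun=> ler01).
  under eq_integral do rewrite mul1r.
  by move=> ->; [rewrite ltry|exists 1 => t; rewrite normr1].
(* Total probability one, tested on the constant function 1, fixes the constant. *)
split => // [|h mh [C hC]].
  have := ge0E (cst 1) (measurable_cst _) (fun=> ler01).
  under eq_integral do rewrite mul1r.
  rewrite -hA//= => h1.
  have /h1 : exists C : R, forall t : R, `|1| <= C by exists 1 => _; rewrite normr1.
  by rewrite probability_setT => -[].
have ihr (k : R -> R) : measurable_fun setT k -> (exists C, forall t, `|k t| <= C) ->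
    lebesgue_measure.-integrable setT (fun t => (k t * rs t)%:E).
  move=> mk [D hD]; have iD : lebesgue_measure.-integrable setT (fun t => (D%:E * (rs t)%:E)%E) by exact: integrableZl.
  apply: le_integrable iD => //.
  - by apply/measurable_EFinP; exact: measurable_funM.
  - move=> t _; rewrite -EFinM !abse_EFin lee_fin !normrM ler_wpM2r//.
    by rewrite (le_trans (hD t))// ler_norm.
have C0 : 0 <= C by apply: le_trans (hC 0).
have bC : exists D, forall t : R, `|cst C t| <= D by exists `|C|.
have bhC : exists D, forall t, `|h t + C| <= D.
  exists (C + C) => t; rewrite (le_trans (ler_normD _ _))// lerD ?hC//.
  by rewrite ger0_norm.
have mhC : measurable_fun setT (fun t => h t + C) by exact: measurable_funD.
have E1 := scaleE (fun t => h t + C) mhC _ bhC.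
have E2 := scaleE (cst C) (measurable_cst _) (fun _ => C0) bC.
(* The bound [C] makes [h + C] nonnegative, which reduces a signed [h] to the nonnegative case; [C]
   is then subtracted on both sides. *)
transitivity (\int[lebesgue_measure]_t ((h t + C) * rs t) -
              \int[lebesgue_measure]_t (C * rs t)).
  rewrite -RintegralB//; [|exact: ihr|exact: (ihr (cst C))].
  by apply: eq_Rintegral => t _; rewrite -mulrBl addrK.
rewrite /Rintegral E1 ?E2 /=; last first.
  move=> t; have := hC t; rewrite ler_norml => /andP[+ _]; lra.
rewrite -mulrBr; congr (_ * _).
have bh : cube_bounded r (fun x : vec => h (tnth x ord0 / sg)) by exists C.
have mh0 : measurable_fun setT (fun x : vec => h (tnth x ord0 / sg)).
  exact: (measurableT_comp (mdiv _ mh) (measurable_tnth ord0)).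
have bC0 : cube_bounded r (fun _ : vec => C) by exists `|C|.
by rewrite (sphere_integralD beta0 r0 mh0 bh _ bC0)// addrK.
Qed.

End level_density.

(** * Means over the sphere and their loop equation *)

Fixpoint grad_terms (e : nat) (s : seq nat) : seq (nat * seq nat) :=
  if s is a :: s' then
    (a, (e + a).-1 :: s') :: [seq (p.1, a :: p.2) | p <- grad_terms e s']
  else [::].

(** Recording the coefficient and the exponents of each summand makes [pgrad] a combination of
    products of power sums, of which means are taken termwise. *)
Lemma pgradE (R : realType) n e s (x : n.-tuple R) :
  pgrad e s x = \sum_(p <- grad_terms e s) p.1%:R * pprod p.2 x.
Proof.
elim: s => [|a s IH] /=; first by rewrite big_nil.
rewrite big_cons /= pprod_cons mulrA; congr (_ + _).
rewrite big_map IH mulr_sumr; apply: eq_bigr => p _ /=.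
by rewrite pprod_cons; ring.
Qed.

(** Terms with coefficient 0 are excluded: for them the truncated predecessor may give the wrong
    degree. *)
Lemma grad_terms_degree e s p : p \in grad_terms e s -> p.1 != 0%N ->
  size p.2 = size s /\ (sumn p.2).+1 = (e + sumn s)%N.
Proof.
elim: s p => [//|a s IH] p /=; rewrite inE => /predU1P[->/=|].
  by case: a => [//|a] _; split => //; rewrite addnS /= addSn addnS addnA.
move=> /mapP[q qs ->] /= q0; have [-> qd] := IH q qs q0.
by split => //; rewrite -addnS qd addnCA.
Qed.

Section sphere_mean.
Context {R : realType} {n : nat}.
Variables (beta r : R).
Hypotheses (beta0 : 0 < beta) (r0 : 0 < r).
Local Notation vec := (n.+1.-tuple R).
Local Notation S := (@sphere_integral R n beta r).
Hypothesis mass0 : 0 < S (fun=> 1).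

Definition sphere_mean (F : vec -> R) : R := S F / S (fun=> 1).

Definition sphere_good (F : vec -> R) :=
  measurable_fun [set: vec] F /\ cube_bounded r F.

Lemma sphere_good_pprod s : sphere_good (pprod s).
Proof.
split; first exact: measurable_pprod.
by apply: ubounded_cube_bounded; exact: ubounded_pprod.
Qed.

Lemma sphere_good_cst c : sphere_good (fun=> c).
Proof. by split => //; exists `|c|. Qed.

Lemma sphere_goodD F G : sphere_good F -> sphere_good G ->
  sphere_good (fun x => F x + G x).
Proof.
move=> [mF [C hC]] [mG [D hD]]; split; first exact: measurable_funD.
by exists (C + D) => x hx; rewrite (le_trans (ler_normD _ _))// lerD ?hC ?hD.
Qed.

Lemma sphere_goodZ c F : sphere_good F -> sphere_good (fun x => c * F x).
Proof.
move=> [mF [C hC]]; split; first exact: measurable_funM.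
by exists (`|c| * C) => x hx; rewrite normrM ler_wpM2l ?hC.
Qed.

Lemma sphere_good_sum (I : Type) (t : seq I) (F : I -> vec -> R) :
  (forall i, sphere_good (F i)) -> sphere_good (fun x => \sum_(i <- t) F i x).
Proof.
move=> gF; elim: t => [|i t IH].
  rewrite (_ : (fun x => _) = fun=> 0); first exact: sphere_good_cst.
  by apply/funext => x; rewrite big_nil.
rewrite (_ : (fun x => _) = fun x => F i x + \sum_(i <- t) F i x).
  exact: sphere_goodD.
by apply/funext => x; rewrite big_cons.
Qed.

Lemma sphere_mean1 : sphere_mean (fun=> 1) = 1.
Proof. by rewrite /sphere_mean divff// gt_eqF. Qed.

Lemma sphere_meanD F G : sphere_good F -> sphere_good G ->
  sphere_mean (fun x => F x + G x) = sphere_mean F + sphere_mean G.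
Proof.
by move=> [mF bF] [mG bG]; rewrite /sphere_mean sphere_integralD// mulrDl.
Qed.

Lemma sphere_meanZ c F : sphere_good F ->
  sphere_mean (fun x => c * F x) = c * sphere_mean F.
Proof. by move=> [mF bF]; rewrite /sphere_mean sphere_integralZ// mulrA. Qed.

Lemma sphere_mean_cst c : sphere_mean (fun=> c) = c.
Proof.
by have := sphere_meanZ c (sphere_good_cst 1); rewrite sphere_mean1 mulr1.
Qed.

Lemma sphere_mean_sum (I : Type) (t : seq I) (F : I -> vec -> R) :
  (forall i, sphere_good (F i)) ->
  sphere_mean (fun x => \sum_(i <- t) F i x) = \sum_(i <- t) sphere_mean (F i).
Proof.
move=> gF; elim: t => [|i t IH].
  rewrite big_nil -[RHS]sphere_mean_cst; congr sphere_mean.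
  by apply/funext => x; rewrite big_nil.
rewrite big_cons -IH -sphere_meanD//; last exact: sphere_good_sum.
by congr sphere_mean; apply/funext => x; rewrite big_cons.
Qed.

Lemma sphere_mean_ge0 F : (forall x, cube n.+1 r x -> 0 <= F x) -> 0 <= sphere_mean F.
Proof.
move=> F0; apply: divr_ge0; last exact: ltW.
apply: Rintegral_ge0 => x _; apply: mulr_ge0; last exact: vandermonde_weight_ge0.
by apply: F0; exact: radial_cube.
Qed.

Lemma le_sphere_mean F G : sphere_good F -> sphere_good G ->
  (forall x, cube n.+1 r x -> F x <= G x) -> sphere_mean F <= sphere_mean G.
Proof.
move=> gF gG FG; rewrite -subr_ge0 -mulN1r -sphere_meanZ// -sphere_meanD//.
  by apply: sphere_mean_ge0 => x /FG; rewrite mulN1r subr_ge0.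
exact: sphere_goodZ.
Qed.

(** The factor [1 - beta / 2] merges two sources of [psum e.-1]: the derivative of the power of
    [x_i], and the diagonal removed from the double sum in [pair_sum]. *)
Lemma sphere_mean_loop e s :
  (n.+1%:R + ((e + sumn s)%:R - 1 + @vdegree R n beta)) * r ^- 2
    * sphere_mean (pprod (e.+1 :: s)) =
  e%:R * (1 - beta / 2) * sphere_mean (pprod (e.-1 :: s))
  + \sum_(p <- grad_terms e s) p.1%:R * sphere_mean (pprod p.2)
  + \sum_(a < e) beta / 2 * sphere_mean (pprod [:: (e.-1 - a)%N, val a & s]).
Proof.
rewrite {1}/sphere_mean mulrA -sphere_loop// -/(sphere_mean _).
have -> : loop_fun beta e s = fun x : vec => e%:R * (1 - beta / 2) * pprod (e.-1 :: s) x
    + (\sum_(p <- grad_terms e s) p.1%:R * pprod p.2 x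
    + \sum_(a < e) beta / 2 * pprod [:: (e.-1 - a)%N, val a & s] x).
  apply/funext => x; rewrite /loop_fun pgradE /pair_sum.
  have -> : \sum_(a < e) beta / 2 * pprod [:: (e.-1 - a)%N, val a & s] x =
     beta / 2 * (\sum_(a < e) psum (e.-1 - a) x * psum a x) * pprod s x.
    by rewrite mulr_sumr mulr_suml; apply: eq_bigr => a _; rewrite !pprod_cons; ring.
  rewrite pprod_cons.
  by field.
rewrite sphere_meanD; first last.
- apply: sphere_goodD; apply: sphere_good_sum => ?; apply: sphere_goodZ;
    exact: sphere_good_pprod.
- by apply: sphere_goodZ; exact: sphere_good_pprod.
rewrite sphere_meanD; first last.
- by apply: sphere_good_sum => ?; apply: sphere_goodZ; exact: sphere_good_pprod.
- by apply: sphere_good_sum => ?; apply: sphere_goodZ; exact: sphere_good_pprod.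
rewrite addrA !sphere_mean_sum; last 2 first.
- by move=> ?; apply: sphere_goodZ; exact: sphere_good_pprod.
- by move=> ?; apply: sphere_goodZ; exact: sphere_good_pprod.
rewrite sphere_meanZ; last exact: sphere_good_pprod.
congr (_ + _ + _).
- by apply: eq_bigr => p _; rewrite sphere_meanZ//; exact: sphere_good_pprod.
- by apply: eq_bigr => p _; rewrite sphere_meanZ//; exact: sphere_good_pprod.
Qed.

End sphere_mean.

(** * Limits of the joint moments *)

Section joint_moments.
Context {R : realType}.
Variable (beta : R).
Hypothesis beta0 : 0 < beta.
Local Notation radius n := ((@fte_radius R n.+1)%:num : R).
Local Notation sigma n := (Num.sqrt (2 * n.+1%:R) : R).
Hypothesis mass0 : forall n, (0 < n)%N ->
  0 < @sphere_integral R n beta (radius n) (fun=> 1).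

(** The mean of a product of moments of the empirical measure of the rescaled points
    [x_i / sigma]. *)
Definition joint_moment n s : R :=
  @sphere_mean R n beta (radius n) (pprod s)
  / (n.+1%:R ^+ size s * sigma n ^+ sumn s).

Lemma joint_moment_nil n : (0 < n)%N -> joint_moment n [::] = 1.
Proof.
move=> n0; rewrite /joint_moment /= !expr0 mulr1 divr1 -[RHS](sphere_mean1 (mass0 n0)).
by congr sphere_mean; apply/funext => x; rewrite /pprod big_nil.
Qed.

Lemma joint_moment_cons0 n s : (0 < n)%N ->
  joint_moment n (0%N :: s) = joint_moment n s.
Proof.
move=> n0; rewrite /joint_moment /= add0n.
have -> : pprod (0%N :: s) = fun x : n.+1.-tuple R => n.+1%:R * pprod s x.
  apply/funext => x; rewrite pprod_cons /psum; congr (_ * _).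
  by under eq_bigr do rewrite expr0; rewrite sumr_const card_ord.
rewrite sphere_meanZ//; [|exact: fte_radius_gt0|exact: sphere_good_pprod].
have s0 : sigma n != 0 by rewrite gt_eqF// sqrtr_gt0 mulr_gt0.
by rewrite exprS; field; rewrite !expf_neq0//=; rewrite addrC natr1 pnatr_eq0.
Qed.

(** With N = [n.+1] and r^2 = N(N-1)/2, the bracket on the left is (N + q) / r^2. Losing two degrees
    costs 1 / sigma^2 = 1 / (2N) and each additional factor gains N, so only the pair terms, with
    one factor more, keep a coefficient of order one, namely beta / 4. *)
Lemma joint_moment_loop n e s : (0 < n)%N ->
  (2 * (n.+1%:R^-1 + (e + sumn s)%:R * n.+1%:R^-1 * n%:R^-1) + beta)
    * joint_moment n (e.+1 :: s) =
  e%:R * (1 - beta / 2) * joint_moment n (e.-1 :: s) * (2^-1 * n.+1%:R^-1)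
  + \sum_(p <- grad_terms e s)
      p.1%:R * joint_moment n p.2 * (2^-1 * n.+1%:R^-1 * n.+1%:R^-1)
  + \sum_(a < e) beta / 4 * joint_moment n [:: (e.-1 - a)%N, val a & s].
Proof.
move=> n0.
have N0 : n.+1%:R != 0 :> R by rewrite pnatr_eq0.
have nn0 : n%:R != 0 :> R by rewrite pnatr_eq0 -lt0n.
have s0 : sigma n != 0 by rewrite gt_eqF// sqrtr_gt0 mulr_gt0.
have s2 : sigma n ^+ 2 = 2 * n.+1%:R by rewrite sqr_sqrtr.
have r2 : radius n ^+ 2 = n.+1%:R * n%:R / 2.
  rewrite /= sqr_sqrtr; last by rewrite divr_ge0// mulr_ge0// subr_ge0 ler1n.
  by rewrite -[in X in X - 1]natr1 addrK.
set D := n.+1%:R ^+ (size s).+1 * sigma n ^+ (e + sumn s).+1.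
have D0 : D != 0 by rewrite mulf_neq0// expf_neq0.
have <- : (n.+1%:R + ((e + sumn s)%:R - 1 + @vdegree R n beta)) * radius n ^- 2 =
   2 * (n.+1%:R^-1 + (e + sumn s)%:R / n.+1%:R / n%:R) + beta.
  rewrite r2 /vdegree -[X in X + (_ - 1 + _)]natr1.
  by move: (n.+1%:R) N0 => N N0; field; rewrite N0 nn0.
rewrite {1}/joint_moment [LHS]mulrA.
rewrite (sphere_mean_loop beta0 (@fte_radius_gt0 R n n0) (mass0 n0)).
rewrite -[_ * _ ^+ sumn (e.+1 :: s)]/D.
(* [k] is one more than the number of factors of [t], whose degree is two less than that of the
   moment on the left. *)
have scale k t : k != 0%N -> size t = k.-1 -> (sumn t).+2 = (e + sumn s).+1 ->
  @sphere_mean R n beta (radius n) (pprod t) / D =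
  joint_moment n t * (2^-1 * n.+1%:R ^+ k.-1 / n.+1%:R ^+ (size s).+1 * n.+1%:R^-1).
  move=> k0 st dt; rewrite /joint_moment st /D -dt.
  have -> : sigma n ^+ (sumn t).+2 = sigma n ^+ sumn t * (2 * n.+1%:R).
    by rewrite 2!exprSr -mulrA -expr2 s2.
  move: (n.+1%:R : R) (sigma n) (sphere_mean _ _ _) s0 N0 => N sg F sg0 N0.
  by field; rewrite N0 !expf_neq0.
rewrite !mulrDl; congr (_ + _ + _).
- case: (e) scale => [|e'] scale; first by rewrite !mul0r.
  rewrite -[LHS]mulrA (scale (size s).+2)// -[RHS]mulrA; congr (_ * (_ * _)).
  by rewrite /= !exprS; move: (n.+1%:R : R) N0 => N N0; field; rewrite N0 expf_neq0.
- rewrite mulr_suml big_seq [RHS]big_seq; apply: eq_bigr => p ps.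
  have [->|p0] := eqVneq p.1 0%N; first by rewrite !mul0r.
  have [sp dp] := grad_terms_degree ps p0.
  rewrite -[LHS]mulrA (scale (size s).+1)// ?dp// -[RHS]mulrA; congr (_ * (_ * _)).
  by rewrite /= !exprS; move: (n.+1%:R : R) N0 => N N0; field; rewrite N0 expf_neq0.
- rewrite mulr_suml; apply: eq_bigr => a _.
  rewrite -[LHS]mulrA (scale (size s).+3)//; last first.
    case: (e) a => [[]//|e'] a; rewrite /= addnA subnK; last by rewrite -ltnS.
    by rewrite addSn.
  rewrite mulrCA [RHS]mulrC; congr (_ * _).
  by rewrite /= !exprS; move: (n.+1%:R : R) N0 => N N0; field; rewrite N0 expf_neq0.
Qed.

Variable mo : nat -> R.
Hypotheses (mo0 : mo 0 = 1)
  (moS : forall e, mo e.+1 = 4^-1 * \sum_(a < e) mo (e.-1 - a)%N * mo a).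

Lemma cvg_joint_moment s :
  joint_moment n s @[n --> \oo] --> \prod_(a <- s) mo a.
Proof.
have invN : (n.+1%:R^-1 : R) @[n --> \oo] --> (0 : R) by exact: cvg_harmonic.
have invn : (n%:R^-1 : R) @[n --> \oo] --> (0 : R).
  by rewrite -(cvg_shiftS (fun n => n%:R^-1 : R)); exact: invN.
have [d] := ubnP (sumn s); elim: d s => // d IHd.
(* The outer induction is on the total degree. A zero exponent leaves it unchanged, so leading zeros
   are removed by an inner induction on the list. *)
elim=> [_|[|e] s IHs sd].
- rewrite big_nil; apply: cvg_near_cst; near=> n; apply: joint_moment_nil.
  by near: n; exact: nbhs_infty_gt.
- rewrite big_cons mo0 mul1r; apply: cvg_trans (IHs sd).
  apply: near_eq_cvg; near=> n; rewrite joint_moment_cons0//.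
  by near: n; exact: nbhs_infty_gt.
have {}IHd t : ((sumn t).+1 <= e + sumn s)%N ->
    joint_moment n t @[n --> \oo] --> \prod_(a <- t) mo a.
  by move=> td; apply: IHd; apply: (leq_trans td); rewrite -ltnS; exact: ltnW.
pose B n : R := 2 * (n.+1%:R^-1 + (e + sumn s)%:R * n.+1%:R^-1 * n%:R^-1) + beta.
have cB : B n @[n --> \oo] --> beta.
  have -> : beta = 2 * (0 + (e + sumn s)%:R * 0 * 0) + beta by ring.
  apply: cvgD; last exact: cvg_cst.
  apply: cvgM; first exact: cvg_cst.
  apply: cvgD => //; apply: cvgM => //; apply: cvgM => //; exact: cvg_cst.
(* The limit is put in the shape of the loop equation, with 1/N replaced by 0 and after division by
   [beta], so that convergence is checked term by term. Filtering by membership keeps the degree of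
   each gradient term available. *)
have -> : \prod_(a <- e.+1 :: s) mo a = (e%:R * (1 - beta / 2)
    * \prod_(a <- e.-1 :: s) mo a * (2^-1 * 0)
  + \sum_(p <- grad_terms e s | p \in grad_terms e s)
      p.1%:R * \prod_(a <- p.2) mo a * (2^-1 * 0 * 0)
  + \sum_(a < e) beta / 4 * \prod_(b <- [:: (e.-1 - a)%N, val a & s]) mo b) * beta^-1.
  have -> : \sum_(p <- grad_terms e s | p \in grad_terms e s)
      p.1%:R * \prod_(a <- p.2) mo a * (2^-1 * 0 * 0) = 0 :> R.
    by rewrite big1// => p _; rewrite mulr0 mulr0.
  rewrite mulr0 mulr0 addr0 add0r.
  rewrite big_cons moS.
  under [\sum_(a < e) beta / 4 * _]eq_bigr do rewrite !big_cons mulrA mulrA -[_ * mo (val _)]mulrA.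
  rewrite -mulr_suml -mulr_sumr.
  by field; rewrite gt_eqF.
pose W n : R := e%:R * (1 - beta / 2) * joint_moment n (e.-1 :: s) * (2^-1 * n.+1%:R^-1)
  + \sum_(p <- grad_terms e s | p \in grad_terms e s)
      p.1%:R * joint_moment n p.2 * (2^-1 * n.+1%:R^-1 * n.+1%:R^-1)
  + \sum_(a < e) beta / 4 * joint_moment n [:: (e.-1 - a)%N, val a & s].
apply: (@cvg_trans _ ((W n / B n) @[n --> \oo])).
  apply: near_eq_cvg; near=> n.
  have n0 : (0 < n)%N by near: n; exact: nbhs_infty_gt.
  rewrite /W -big_seq -joint_moment_loop// mulrC mulKf//.
  rewrite gt_eqF// ltr_wpDl// mulr_ge0// addr_ge0 ?invr_ge0//.
apply: cvgM; last by apply: cvgV => //; rewrite gt_eqF.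
have cN : (2^-1 * n.+1%:R^-1 : R) @[n --> \oo] --> (2^-1 * 0 : R).
  by apply: cvgM => //; exact: cvg_cst.
apply: cvgD; first apply: cvgD.
- case: (e) IHd => [|e'] IHd.
    by under eq_fun do rewrite !mul0r; rewrite !mul0r; exact: cvg_cst.
  apply: cvgM => //; apply: cvgM; first exact: cvg_cst.
  exact: IHd.
- apply: cvg_bigsum => p ps; have [p0|p0] := eqVneq p.1 0%N.
    by under eq_fun do rewrite p0 !mul0r; rewrite p0 !mul0r; exact: cvg_cst.
  apply: cvgM; last exact: cvgM.
  apply: cvgM; first exact: cvg_cst.
  by apply: IHd; have [_ ->] := grad_terms_degree ps p0.
- apply: cvg_bigsum => a _; apply: cvgM; first exact: cvg_cst.
  apply: IHd; case: (e) a => [[]//|e'] a; rewrite /= addnA subnK; last by rewrite -ltnS.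
  by rewrite addSn.
Unshelve. all: by end_near. Qed.

End joint_moments.

(** * Moments of the semicircle *)

Section semicircle.
Context {R : realType}.
Local Notation mu := (@lebesgue_measure R).
Implicit Types (f F h : R -> R) (x a b : R).

(** The derivative is required on the open interval only, because the square root is not
    differentiable at the ends of the semicircle. *)
Lemma integral_derivative F f a b : a < b -> continuous F -> continuous f ->
  (forall x, a < x < b -> is_derive x 1 F (f x)) ->
  (\int[mu]_(x in [set` `[a, b]%R]) (f x)%:E = (F b - F a)%:E)%E.
Proof.
move=> ab cF cf dF; rewrite (@continuous_FTC2 _ f F)// ?EFinB//.
- exact/continuous_subspaceT.
- split.
  + by move=> x; rewrite in_itv/= => /dF [].
  + exact/cvg_at_right_filter/cF.
  + exact/cvg_at_left_filter/cF.
- by move=> x; rewrite in_itv/= => /dF dFx; rewrite derive1E; have [] := dFx.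
Qed.

(** [Num.sqrt] is 0 on negative reals, so this is continuous on the whole line and vanishes outside
    [-1, 1]. *)
Definition halfcircle x : R := Num.sqrt (1 - x ^+ 2).

Lemma continuous_halfcircle : continuous halfcircle.
Proof.
move=> x; apply: continuous_comp; last exact: sqrt_continuous.
apply: cvgB; first exact: cvg_cst.
exact: exprn_continuous.
Qed.

Lemma halfcircle_out x : 1 <= `|x| -> halfcircle x = 0.
Proof.
move=> x1; apply: ler0_sqrtr; rewrite subr_le0 -(real_normK (num_real x)).
by rewrite exprn_ege1.
Qed.

Lemma semicircleE x : semicircle x = 2 / pi * halfcircle x.
Proof.
rewrite /semicircle -ltr_norml; case: ltP => // x1.
by rewrite halfcircle_out// mulr0.
Qed.

Lemma continuous_semicircle : continuous (@semicircle R).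
Proof.
rewrite (_ : semicircle = fun x : R => 2 / pi * halfcircle x); last first.
  by apply/funext => x; rewrite semicircleE.
by move=> x; apply: cvgM; [exact: cvg_cst|exact: continuous_halfcircle].
Qed.

Lemma semicircle_ge0 x : 0 <= semicircle x.
Proof. by rewrite semicircleE mulr_ge0 ?sqrtr_ge0 ?divr_ge0 ?pi_ge0. Qed.

Lemma semicircle_out x : 1 <= `|x| -> semicircle x = 0.
Proof. by move=> x1; rewrite semicircleE halfcircle_out ?mulr0. Qed.

Lemma integrable_semicircle h : continuous h ->
  mu.-integrable [set` `[-1, 1]%R] (fun x => (h x * semicircle x)%:E).
Proof.
move=> ch; apply: continuous_compact_integrable; first exact: segment_compact.
apply: continuous_subspaceT => x; apply: cvgM; first exact: ch.
exact: continuous_semicircle.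
Qed.

Lemma integral_semicircleE h : (\int[mu]_x (h x * semicircle x)%:E =
  \int[mu]_(x in [set` `[-1, 1]%R]) (h x * semicircle x)%:E)%E.
Proof.
rewrite [RHS]integral_mkcond; apply: eq_integral => x _; rewrite patchE.
case: ifPn => //; rewrite notin_setE/= in_itv/= -ler_norml => /negP.
by rewrite -ltNge => /ltW x1; rewrite semicircle_out// mulr0.
Qed.

Definition semicircle_mean h : R := \int[mu]_x (h x * semicircle x).

Lemma semicircle_meanE h : semicircle_mean h =
  \int[mu]_(x in [set` `[-1, 1]%R]) (h x * semicircle x).
Proof. by rewrite /semicircle_mean /Rintegral integral_semicircleE. Qed.

Lemma semicircle_meanD h k : continuous h -> continuous k ->
  semicircle_mean (fun x => h x + k x) = semicircle_mean h + semicircle_mean k.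
Proof.
move=> ch ck; rewrite !semicircle_meanE -RintegralD//.
- by apply: eq_Rintegral => x _; rewrite mulrDl.
- exact: integrable_semicircle.
- exact: integrable_semicircle.
Qed.

Lemma semicircle_meanZ c h : continuous h ->
  semicircle_mean (fun x => c * h x) = c * semicircle_mean h.
Proof.
move=> ch; rewrite !semicircle_meanE -RintegralZl//.
- by apply: eq_Rintegral => x _; rewrite mulrA.
- exact: integrable_semicircle.
Qed.

Lemma le_semicircle_mean h k : continuous h -> continuous k ->
  (forall x, `|x| <= 1 -> h x <= k x) -> semicircle_mean h <= semicircle_mean k.
Proof.
move=> ch ck hk; rewrite !semicircle_meanE; apply: le_Rintegral => //.
- exact: integrable_semicircle.
- exact: integrable_semicircle.
- move=> x; rewrite /= in_itv/= -ler_norml => x1.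
  by rewrite ler_wpM2r ?semicircle_ge0 ?hk.
Qed.

(** Substitution of sin, after which cos^2 has the antiderivative (x + sin x cos x) / 2. *)
Lemma semicircle_mass : semicircle_mean (fun=> 1) = 1.
Proof.
have pi2 : - (pi / 2) < pi / 2 :> R.
  by rewrite gtrN// divr_gt0// pi_gt0.
have halfE : (\int[mu]_(x in [set` `[-1, 1]%R]) (halfcircle x)%:E = (pi / 2 : R)%:E)%E.
  have E := @integration_by_substitution_increasing R sin halfcircle _ _ (ltW pi2).
  rewrite sinN sin_pihalf in E.
  rewrite (_ : derive1 _ = cos) in E; last first.
    by apply/funext => x; rewrite derive1E; have [] := is_derive_sin x.
  rewrite E.
  - transitivity (\int[mu]_(x in [set` `[- (pi / 2), pi / 2]%R]) (cos x ^+ 2)%:E)%E.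
      apply: eq_integral => x; rewrite inE/= in_itv/= => xpi.
      rewrite -[LHS]/((Num.sqrt (1 - sin x ^+ 2) * cos x)%:E) -cos2sin2 sqrtr_sqr ger0_norm ?expr2//.
      exact: cos_ge0_pihalf.
    have c1 : continuous (fun x : R => 2^-1 * (x + sin x * cos x)).
      move=> x; apply: cvgM; first exact: cvg_cst.
      apply: cvgD; first exact: cvg_id.
      by apply: cvgM; [exact: continuous_sin|exact: continuous_cos].
    have c2 : continuous (fun x : R => cos x ^+ 2).
      by move=> x; apply: (cvg_comp cos (fun y => y ^+ 2) (@continuous_cos R x));
        exact: exprn_continuous.
    have d x : is_derive x 1 (fun x : R => 2^-1 * (x + sin x * cos x)) (cos x ^+ 2).
      have C1sin : C1 (@sin R) cos.
        by split; [exact: is_derive_sin|exact: continuous_cos].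
      have C1cos : C1 (@cos R) (fun x => - sin x).
        split; [exact: is_derive_cos|move=> t; apply: cvgN; exact: continuous_sin].
      suff Cd : C1 (fun x : R => 2^-1 * (x + sin x * cos x)) (fun x => cos x ^+ 2).
        exact: Cd.1.
      apply: C1_ext (C1Z 2^-1 (C1D (@C1_id R) (C1M C1sin C1cos))) _ => y.
      by have := cos2Dsin2 y; rewrite /cst /= !expr2; lra.
    rewrite (integral_derivative pi2 c1 c2 (fun x _ => d x)); congr EFin.
    by rewrite sin_pihalf cos_pihalf cosN cos_pihalf !mulr0; field.
  - by move=> x y hx hy xy; rewrite ltr_sin.
  - by move=> x _; exact: continuous_cos.
  - apply/cvg_ex; exists (cos (- (pi / 2))).
    by apply: cvg_at_right_filter; exact: continuous_cos.
  - apply/cvg_ex; exists (cos (pi / 2)).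
    by apply: cvg_at_left_filter; exact: continuous_cos.
  - split.
    + by move=> x _; exact: derivable_sin.
    + by apply: cvg_at_right_filter; exact: continuous_sin.
    + by apply: cvg_at_left_filter; exact: continuous_sin.
  - by apply: continuous_subspaceT; exact: continuous_halfcircle.
rewrite semicircle_meanE.
transitivity (\int[mu]_(x in [set` `[-1, 1]%R]) (2 / pi * halfcircle x)).
  by apply: eq_Rintegral => x _; rewrite mul1r semicircleE.
rewrite RintegralZl//; last first.
  apply: continuous_compact_integrable; first exact: segment_compact.
  by apply: continuous_subspaceT; exact: continuous_halfcircle.
transitivity (2 / pi * (pi / 2) : R); first by rewrite /Rintegral halfE.
have := lt0r_neq0 (pi_gt0 R); move: (pi : R) => p p0.
by field; rewrite p0.
Qed.

Definition semicircle_moment k : R := semicircle_mean (fun x => x ^+ k).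

(** The function x^j (1 - x^2)^(3/2) vanishes at both end points and has derivative (j x^(j-1) -
    (j+3) x^(j+1)) sqrt(1 - x^2). *)
Lemma semicircle_moment_rec j :
  (j + 3)%:R * semicircle_moment j.+1 = j%:R * semicircle_moment j.-1.
Proof.
pose F x : R := x ^+ j * ((1 - x ^+ 2) * halfcircle x).
pose f x : R := j%:R * (x ^+ j.-1 * semicircle x) - (j + 3)%:R * (x ^+ j.+1 * semicircle x).
have cX k : continuous (fun x : R => x ^+ k) by move=> x; exact: exprn_continuous.
have cF : continuous F.
  move=> x; apply: cvgM; first exact: cX.
  apply: cvgM; last exact: continuous_halfcircle.
  by apply: cvgB; [exact: cvg_cst|exact: cX].
have cXs k : continuous (fun x : R => x ^+ k * semicircle x).
  by move=> x; apply: cvgM; [exact: cX|exact: continuous_semicircle].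
have cf : continuous f.
  by move=> x; apply: cvgB; apply: cvgM; try exact: cvg_cst; exact: cXs.
have dF x : -1 < x < 1 -> is_derive x 1 (fun x => 2 / pi * F x) (f x).
  move=> x1; have x2 : 0 < 1 - x ^+ 2.
    by move: x1 => /andP[? ?]; nra.
  have C1p : C1 (fun x : R => 1 - x ^+ 2) (fun x => - (2 * x)).
    have := C1D (C1_cst 1) (C1Z (-1) (C1X 2 (@C1_id R))).
    rewrite (_ : _ \+ _ = fun x => 1 - x ^+ 2); last by apply/funext => t /=; rewrite mulN1r.
    by move=> /C1_ext; apply => t; rewrite /= expr1; ring.
  have ds := @is_derive1_comp R Num.sqrt _ x _ _ (is_derive1_sqrt x2) (C1p.1 x).
  have dX := (C1X j (@C1_id R)).1 x.
  have d1 := is_deriveM (C1p.1 x) ds.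
  have d2 := is_deriveM dX d1.
  have d3 := is_deriveZ (2 / pi) d2.
  have d4 : is_derive x 1 (fun x => 2 / pi * F x) (2 / pi *
      (x ^+ j * ((1 - x ^+ 2) * ((2 * Num.sqrt (1 - x ^+ 2))^-1 * - (2 * x))
        + Num.sqrt (1 - x ^+ 2) * - (2 * x))
      + ((1 - x ^+ 2) * Num.sqrt (1 - x ^+ 2)) * (j%:R * x ^+ j.-1 * 1))) by exact: d3.
  apply: is_derive_eq d4 _.
  rewrite /f !semicircleE /halfcircle; move: (2 / pi : R) => c.
  have s0 : Num.sqrt (1 - x ^+ 2) != 0 by rewrite gt_eqF// sqrtr_gt0.
  have s2 := sqr_sqrtr (ltW x2).
  move: (Num.sqrt _) s0 s2 => s s0 s2.
  have -> : 1 - x ^+ 2 = s ^+ 2 by [].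
  have xs : x ^+ 2 = 1 - s ^+ 2 by rewrite s2; ring.
  case: (j) => [|j'] /=.
    rewrite expr0 expr1 natrD; field.
    by rewrite s0.
  have -> : x ^+ j'.+2 = x ^+ j' * (1 - s ^+ 2) by rewrite -xs -exprD addn2.
  have -> : x ^+ j'.+1 = x * x ^+ j' by rewrite exprS.
  rewrite natrD -(natr1 j').
  transitivity (c * (x ^+ j' * s * (- 3 * x ^+ 2 + (j'%:R + 1) * s ^+ 2))).
    by field; rewrite s0.
  by rewrite xs; field.
have c2F : continuous (fun x => 2 / pi * F x).
  by move=> x; apply: cvgM; [exact: cvg_cst|exact: cF].
have N11 : -1 < 1 :> R by lra.
have iXs k := integrable_semicircle (cX k).
have := integral_derivative N11 c2F cf dF.
have -> : F 1 = 0 by rewrite /F halfcircle_out ?normr1// !mulr0.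
have -> : F (-1) = 0 by rewrite /F halfcircle_out ?normrN1// !mulr0.
rewrite mulr0 subrr => E.
have : \int[mu]_(x in [set` `[-1, 1]%R]) f x = 0 by rewrite /Rintegral E.
rewrite RintegralB//; last 2 first.
- exact: (integrableZl _ _ (iXs j.-1)).
- exact: (integrableZl _ _ (iXs j.+1)).
have Z k (c : R) : \int[mu]_(x in [set` `[-1, 1]%R]) (c * (x ^+ k * semicircle x)) =
    c * semicircle_moment k.
  rewrite /semicircle_moment semicircle_meanE RintegralZl//.
  exact: iXs.
by rewrite !Z => /eqP; rewrite subr_eq0 => /eqP ->.
Qed.

End semicircle.

(** * From the two-step recursion to the Catalan convolution *)

Section catalan_convolution.
Context {R : realFieldType}.
Variable mo : nat -> R.
Hypothesis mo0 : mo 0 = 1.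
Hypothesis mo_rec : forall j, (j + 3)%:R * mo j.+1 = j%:R * mo j.-1.

Let conv k : R := \sum_(a < k.+1) mo (k - a) * mo a.

Let mo1 : mo 1 = 0.
Proof.
have := mo_rec 0; rewrite mul0r => /eqP; rewrite mulf_eq0 pnatr_eq0/=.
by move=> /eqP.
Qed.

(** Reflecting [a] into [k - a] averages the weight to [k / 2]. *)
Let conv_weighted k :
  \sum_(a < k.+1) (val a)%:R * (mo (k - a) * mo a) = k%:R / 2 * conv k.
Proof.
set T := LHS.
have TE : T = \sum_(a < k.+1) (k - a)%:R * (mo (k - a) * mo a).
  rewrite /T (reindex_inj rev_ord_inj)/=; apply: eq_bigr => a _.
  have ak : (a <= k)%N by rewrite -ltnS.
  rewrite !subSS (subKn ak); congr (_ * _); exact: mulrC.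
have : T + T = k%:R * conv k.
  rewrite {1}TE /T -big_split/= mulr_sumr; apply: eq_bigr => a _.
  by rewrite -mulrDl -natrD subnK// -ltnS.
by lra.
Qed.

(** The two-step recursion turns the weighted sums into a recursion for [conv] itself. Given
    [conv k = 4 * mo k.+2] it reads (k + 6) conv (k + 2) = 4 (k + 3) mo (k + 2), and [mo_rec]
    evaluates the right-hand side. No closed form of the moments enters. *)
Let convE k : conv k = 4 * mo k.+2.
Proof.
(* The step goes from [k] to [k.+2], so two consecutive values are carried. *)
suff: conv k = 4 * mo k.+2 /\ conv k.+1 = 4 * mo k.+3 by case.
elim: k => [|k [IH IH1]].
  have m2 := mo_rec 1; have m3 := mo_rec 2.
  rewrite /conv !big_ord_recl !big_ord0 /= /bump /= mo0 mo1 in m2 m3 *.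
  by rewrite -!natr1 in m2 m3; split; lra.
split => //.
have h : \sum_(a < k.+1) (a + 4)%:R * (mo (k - a) * mo a.+2) =
    (k%:R / 2 + 1) * conv k.
  transitivity (\sum_(a < k.+1) (a + 1)%:R * (mo (k - a) * mo a)).
    apply: eq_bigr => a _; have := mo_rec a.+1; rewrite /= addSnnS addn1 => e.
    by rewrite mulrCA e mulrCA.
  under eq_bigr do rewrite natrD mulrDl mul1r.
  by rewrite big_split/= conv_weighted mulrDl mul1r.
have split2 (F : nat -> R) :
    \sum_(b < k.+3) F b = F 0%N + F 1%N + \sum_(a < k.+1) F a.+2.
  by rewrite big_ord_recl big_ord_recl addrA.
pose c := \sum_(a < k.+1) mo (k - a) * mo a.+2.
have cE : conv k.+2 = mo k.+2 + c.
  rewrite /conv (split2 (fun b => mo (k.+2 - b) * mo b)) subn0 mo0 mo1.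
  by rewrite mulr1 mulr0 addr0.
have := conv_weighted k.+2.
rewrite (split2 (fun b => b%:R * (mo (k.+2 - b) * mo b))) mo1 mul0r !mulr0 !add0r.
have -> : \sum_(a < k.+1) a.+2%:R * (mo (k.+2 - a.+2) * mo a.+2) =
    (k%:R / 2 + 1) * conv k - 2 * c.
  rewrite -h /c mulr_sumr -sumrB; apply: eq_bigr => a _.
  by rewrite !subSS -mulrBl -(natr1 a.+1) -(natr1 a) natrD; congr (_ * _); ring.
have -> : c = conv k.+2 - mo k.+2 by rewrite cE addrC addKr.
rewrite IH; have := mo_rec k.+3; rewrite /= natrD -!(natr1 k.+2, natr1 k.+1, natr1 k).
move: (conv k.+2) (mo k.+4) (mo k.+2) => S m4 m2 E1 E2.
have k0 : k%:R + 6 != 0 :> R by rewrite -natrD pnatr_eq0 addnS.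
by apply: (mulfI k0); lra.
Qed.

Lemma moment_convolution e : mo e.+1 = 4^-1 * \sum_(a < e) mo (e.-1 - a) * mo a.
Proof.
case: e => [|e]; first by rewrite big_ord0 mulr0 mo1.
by rewrite -/(conv e) convE mulrA mulVf ?mul1r// pnatr_eq0.
Qed.

End catalan_convolution.

(** * Bernstein polynomials *)

Section bernstein.
Context {R : realType}.
Implicit Types (phi psi : nat -> R) (x c : R).

(* Pascal's rule for sum_k C(n,k) phi(k) X^k (1-X)^(n-k). *)
Fixpoint bernstein n phi : {poly R} :=
  if n is m.+1 then
    (1 - 'X) * bernstein m phi + 'X * bernstein m (fun k => phi k.+1)
  else (phi 0%N)%:P.

Lemma bernsteinS n phi x : (bernstein n.+1 phi).[x] =
  (1 - x) * (bernstein n phi).[x] + x * (bernstein n (fun k => phi k.+1)).[x].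
Proof. by rewrite /= !hornerE. Qed.

Lemma bernstein_affine n phi a c x :
  (bernstein n (fun k => a + c * phi k)).[x] = a + c * (bernstein n phi).[x].
Proof.
elim: n phi => [|n IH] phi; first by rewrite /= !hornerC.
by rewrite !bernsteinS !IH; ring.
Qed.

Lemma le_bernstein n phi psi x : 0 <= x <= 1 -> (forall k, phi k <= psi k) ->
  (bernstein n phi).[x] <= (bernstein n psi).[x].
Proof.
move=> /andP[x0 x1]; elim: n phi psi => [|n IH] phi psi h.
  by rewrite /= !hornerC.
by rewrite !bernsteinS lerD// ler_wpM2l ?subr_ge0// IH// => k; exact: h.
Qed.

(** The second moment of a binomial variable about [c]; generality in [c] absorbs the shift of [phi]
    in Pascal's rule. *)
Lemma bernstein_square n c x :
  (bernstein n (fun k => (k%:R - c) ^+ 2)).[x]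
  = (n%:R * x - c) ^+ 2 + n%:R * (x * (1 - x)).
Proof.
elim: n c => [|n IH] c; first by rewrite /= hornerC !mul0r addr0.
rewrite bernsteinS IH.
have -> : (fun k => (k.+1%:R - c) ^+ 2) = fun k => (k%:R - (c - 1)) ^+ 2.
  by apply/funext => k; rewrite -natr1; congr (_ ^+ 2); ring.
by rewrite IH -natr1; ring.
Qed.

(** Positivity of the operator applied to a quadratic majorant, together with [x * (1 - x) <= 1]. As
    [le_bernstein] compares all natural [k], the bound is asked at every [y >= 0] and not only on
    [0, 1]. *)
Lemma bernstein_approx (g : R -> R) x (delta C : R) n : (0 < n)%N -> 0 <= x <= 1 ->
  0 <= C ->
  (forall y, 0 <= y -> `|g y - g x| <= delta + C * (y - x) ^+ 2) ->
  `|(bernstein n (fun k => g (k%:R / n%:R))).[x] - g x| <= delta + C / n%:R.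
Proof.
move=> n0 x01 C0 hg.
have nn0 : n%:R != 0 :> R by rewrite pnatr_eq0 -lt0n.
have E : (bernstein n (fun k => delta + C * (k%:R / n%:R - x) ^+ 2)).[x] <= delta + C / n%:R.
  have -> : (fun k : nat => delta + C * (k%:R / n%:R - x) ^+ 2) =
      fun k => delta + C / n%:R ^+ 2 * (k%:R - n%:R * x) ^+ 2.
    by apply/funext => k; field.
  rewrite bernstein_affine bernstein_square subrr expr0n add0r lerD2l.
  have -> : C / n%:R ^+ 2 * (n%:R * (x * (1 - x))) = C / n%:R * (x * (1 - x)) by field.
  rewrite ler_piMr//; first by rewrite divr_ge0.
  by move: x01 => /andP[? ?]; nra.
rewrite ler_norml; apply/andP; split.
  rewrite lerBrDr.
  apply: (@le_trans _ _ (g x + -1 * (bernstein n (fun k => delta + C * (k%:R / n%:R - x) ^+ 2)).[x])).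
    by rewrite mulN1r addrC lerD2l lerN2.
  rewrite -bernstein_affine; apply: le_bernstein => // k.
  have := hg (k%:R / n%:R) (divr_ge0 (ler0n _ _) (ler0n _ _)).
  by rewrite ler_norml => /andP[+ _]; rewrite mulN1r; lra.
rewrite lerBlDr; apply: (@le_trans _ _ (g x + 1 * (bernstein n (fun k => delta + C * (k%:R / n%:R - x) ^+ 2)).[x])).
  rewrite -bernstein_affine; apply: le_bernstein => // k.
  have := hg (k%:R / n%:R) (divr_ge0 (ler0n _ _) (ler0n _ _)).
  by rewrite ler_norml => /andP[_ +]; rewrite mul1r; lra.
by rewrite mul1r addrC lerD2r.
Qed.

End bernstein.

(** * Polynomial approximation *)

Section modulus.
Context {R : realType}.
Implicit Types (f : R -> R) (A : set R).

(** Only [x] is confined to the compact set; [y] ranges over all its neighbours, inside or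
    outside. *)
Lemma compact_modulus f A (delta : R) : continuous f -> compact A -> 0 < delta ->
  exists2 eta, 0 < eta &
    forall x y, A x -> `|y - x| < eta -> `|f y - f x| <= delta.
Proof.
move=> cf /compact_near_coveringP cA d0.
have : \forall eta \near 0^'+, forall x, A x ->
    (fun (eta x : R) => forall y, `|y - x| < eta -> `|f y - f x| <= delta) eta x.
  apply: cA => x _.
  have d2 : 0 < delta / 2 by rewrite divr_gt0.
  have := cf x; move=> /cvgrPdist_lt /(_ _ d2) /nbhs_ballP[r /= r0 xr].
  have r2 : 0 < r / 2 by rewrite divr_gt0.
  exists (ball x (r / 2), [set eta | eta < r / 2]) => /=.
    split; first exact: nbhsx_ballx.
    exact: nbhs_right_lt.
  move=> [x' eta] /= [xx' er] y yx'.
  have bx' : ball x r x'.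
    by apply: lt_le_trans xx' _; rewrite ler_pdivrMr// ler_pMr// ler1n.
  have bxy : ball x r y.
    rewrite /ball /=; rewrite /ball /= in xx'.
    have -> : x - y = (x - x') - (y - x') by ring.
    apply: (le_lt_trans (ler_normB _ _)).
    by rewrite [r]splitr ltrD// (lt_trans yx').
  have := xr _ bx'; have := xr _ bxy; rewrite /= => h1 h2.
  have -> : f y - f x' = (f x - f x') - (f x - f y) by ring.
  by rewrite (le_trans (ler_normB _ _))// [delta]splitr lerD// ltW.
move=> [eta /= eta0 h]; exists (eta / 2); first by rewrite divr_gt0.
move=> x y Ax; apply: h => //=; last by rewrite divr_gt0.
by rewrite sub0r normrN gtr0_norm ?divr_gt0// ltr_pdivrMr// ltr_pMr// ltr1n.
Qed.

(** Farther than [eta] the quadratic term is at least [2 * M], which bounds any difference of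
    values; nearer, the uniform modulus suffices. *)
Lemma quadratic_modulus f A (M delta : R) : continuous f -> compact A ->
  (forall x, `|f x| <= M) -> 0 < delta ->
  exists2 C, 0 <= C & forall x y, A x -> `|f y - f x| <= delta + C * (y - x) ^+ 2.
Proof.
move=> cf cA fM d0; have [eta e0 h] := compact_modulus cf cA d0.
have M0 : 0 <= M by apply: le_trans (fM 0).
have C0 : 0 <= 2 * M / eta ^+ 2 by rewrite divr_ge0 ?sqr_ge0// mulr_ge0.
exists (2 * M / eta ^+ 2) => //.
move=> x y Ax; case: (ltP `|y - x| eta) => yx.
  rewrite (le_trans (h x y Ax yx))// lerDl mulr_ge0 ?sqr_ge0//.
have : 2 * M <= 2 * M / eta ^+ 2 * (y - x) ^+ 2.
  rewrite mulrAC -mulrA ler_peMr ?mulr_ge0// ler_pdivlMr ?exprn_gt0// mul1r.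
  by rewrite -[leRHS](real_normK (num_real _)) lerXn2r// nnegrE ltW.
have := ler_normB (f y) (f x); have := fM x; have := fM y; lra.
Qed.

End modulus.

(** * Convergence *)

Section polynomial_approximation.
Context {R : realType}.
Implicit Types (f : R -> R) (p : {poly R}).

Lemma continuous_horner p : continuous (fun t : R => p.[t]).
Proof.
move=> t; apply/differentiable_continuous/derivable1_diffP.
by have [] := is_derive_poly p t.
Qed.

Lemma weierstrass_approx f (M delta : R) : continuous f -> (forall t, `|f t| <= M) ->
  0 < delta -> exists p, forall t, `|t| <= 2 -> `|f t - p.[t]| <= delta.
Proof.
move=> cf fM d0; have d2 : 0 < delta / 2 by rewrite divr_gt0.
have [C C0 hC] := quadratic_modulus cf (@segment_compact R (-2) 2) fM d2.
(* The substitution t = 4x - 2 carries [0, 1] to [-2, 2] and multiplies the quadratic coefficient by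
   16. *)
have [n n0 nC] : exists2 n, (0 < n)%N & 16 * C / (delta / 2) <= n%:R.
  by exists (Num.truncn (16 * C / (delta / 2))).+1 => //; rewrite ltW// truncnS_gt.
have nn0 : 0 < n%:R :> R by rewrite ltr0n.
exists (bernstein n (fun k => f (4 * (k%:R / n%:R) - 2)) \Po ((4^-1)%:P * ('X + 2%:P))).
move=> t t2; rewrite horner_comp hornerM hornerD hornerX !hornerC.
set x := 4^-1 * (t + 2).
have tE : t = 4 * x - 2 by rewrite /x; field.
have x01 : 0 <= x <= 1.
  by move: t2; rewrite ler_norml => /andP[? ?]; rewrite /x; apply/andP; split; lra.
have hx y : 0 <= y -> `|f (4 * y - 2) - f (4 * x - 2)| <= delta / 2 + 16 * C * (y - x) ^+ 2.
  move=> _; rewrite -tE; have := hC t (4 * y - 2).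
  rewrite /= in_itv/= -ler_norml => /(_ t2).
  by have -> : C * (4 * y - 2 - t) ^+ 2 = 16 * C * (y - x) ^+ 2 by rewrite tE; ring.
have C16 : 0 <= 16 * C by rewrite mulr_ge0.
have := bernstein_approx (g := fun y => f (4 * y - 2)) n0 x01 C16 hx.
rewrite -tE distrC => /le_trans; apply.
rewrite [leRHS]splitr lerD2l ler_pdivrMr// [leRHS]mulrC -ler_pdivrMr//.
Qed.

(** For [2 <= |t|] one has [1 <= t ^+ 2 / 4], so the exponent can be raised from the size of [p] to
    any larger [K] at no cost: [D] does not depend on [K], and the coefficient decays like
    4^(-K). *)
Lemma horner_tail p (M : R) : exists2 D, 0 <= D &
  forall K t, (size p <= K)%N -> 2 <= `|t| ->
    M + `|p.[t]| <= D / 4 ^+ K * t ^+ (2 * K).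
Proof.
pose A := \sum_(i < size p) `|p`_i|.
have A0 : 0 <= A by apply: sumr_ge0.
exists ((`|M| + A) * 4 ^+ size p); first by rewrite mulr_ge0 ?addr_ge0 ?exprn_ge0.
move=> K t dK t2; set d := size p in dK *.
have t1 : 1 <= `|t| by rewrite (le_trans _ t2)// ler1n.
have pA : `|p.[t]| <= A * `|t| ^+ (2 * d).
  rewrite horner_coef (le_trans (ler_norm_sum _ _ _))// mulr_suml ler_sum// => i _.
  rewrite normrM normrX ler_wpM2l// ler_weXn2l// mul2n -addnn.
  by rewrite (leq_trans (ltnW (ltn_ord i)))// leq_addr.
have MA : M <= `|M| * `|t| ^+ (2 * d).
  by rewrite (le_trans (ler_norm M))// ler_peMr// exprn_ege1.
apply: (le_trans (lerD MA pA)); rewrite -mulrDl -[leRHS]mulrA.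
rewrite -[leRHS]mulrA ler_wpM2l ?addr_ge0//.
have y1 : 1 <= t ^+ 2 / 4.
  rewrite ler_pdivlMr// mul1r -(real_normK (num_real t)).
  have -> : 4 = 2 ^+ 2 :> R by ring.
  by rewrite lerXn2r// nnegrE.
have -> : `|t| ^+ (2 * d) = 4 ^+ d * (t ^+ 2 / 4) ^+ d.
  by rewrite -exprMn mulrC divfK// exprM real_normK// num_real.
rewrite ler_wpM2l ?exprn_ge0// (le_trans (ler_weXn2l y1 dK))//.
by rewrite exprMn exprVn -exprM mulrC.
Qed.

Lemma polynomial_majorant f (M delta : R) : continuous f -> (forall t, `|f t| <= M) ->
  0 < delta -> exists p K D, [/\ 0 <= D <= delta,
    (forall t, `|t| <= 2 -> `|f t - p.[t]| <= delta) &
    forall t, `|f t - p.[t]| <= delta + D * t ^+ (2 * K)].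
Proof.
move=> cf fM d0; have [p hp] := weierstrass_approx cf fM d0.
have [D D0 hD] := horner_tail p M.
(* 4^K exceeds [K], which already exceeds [D / delta]. *)
pose K := maxn (size p) (Num.truncn (D / delta)).+1.
exists p, K, (D / 4 ^+ K).
have K4 : 0 < 4 ^+ K :> R by rewrite exprn_gt0.
have DK : 0 <= D / 4 ^+ K by rewrite divr_ge0// ltW.
split => //.
  rewrite DK ler_pdivrMr// mulrC -ler_pdivrMr// (le_trans (ltW (truncnS_gt _)))//.
  have -> : (4 : R) ^+ K = (4 ^ K)%N%:R by rewrite natrX.
  by rewrite ler_nat (leq_trans (leq_maxr (size p) _))// ltnW// ltn_expl.
move=> t; have t2K : 0 <= t ^+ (2 * K) by rewrite exprM exprn_ge0// sqr_ge0.
case: (leP `|t| 2) => t2.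
  by rewrite (le_trans (hp t t2))// lerDl mulr_ge0.
apply: (@le_trans _ _ (D / 4 ^+ K * t ^+ (2 * K))).
  rewrite (le_trans (ler_normB _ _))// (le_trans _ (hD K t (leq_maxl _ _) (ltW t2)))//.
  by rewrite lerD2r.
by rewrite lerDr ltW.
Qed.

Lemma semicircle_mean_horner p : semicircle_mean (fun t => p.[t]) =
  \sum_(i < size p) p`_i * semicircle_moment i.
Proof.
have cX k : continuous (fun t : R => t ^+ k) by move=> t; exact: exprn_continuous.
have h m : continuous (fun t : R => \sum_(i < m) p`_i * t ^+ i) /\
    semicircle_mean (fun t => \sum_(i < m) p`_i * t ^+ i) =
    \sum_(i < m) p`_i * semicircle_moment i.
  elim: m => [|m [cm IH]].
    have -> : (fun t : R => \sum_(i < 0) p`_i * t ^+ i) = fun t => 0 * 1.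
      by apply/funext => t; rewrite big_ord0 mul0r.
    split; first by move=> t; exact: cvg_cst.
    by rewrite (@semicircle_meanZ R 0 (fun=> 1)) ?mul0r ?big_ord0// => t; exact: cvg_cst.
  have -> : (fun t : R => \sum_(i < m.+1) p`_i * t ^+ i) =
      fun t => \sum_(i < m) p`_i * t ^+ i + p`_m * t ^+ m.
    by apply/funext => t; rewrite big_ord_recr.
  have cp : continuous (fun t : R => p`_m * t ^+ m).
    by move=> t; apply: cvgM; [exact: cvg_cst|exact: cX].
  split; first by move=> t; apply: cvgD; [exact: cm|exact: cp].
  by rewrite semicircle_meanD// IH semicircle_meanZ// big_ord_recr.
rewrite -(h (size p)).2; congr semicircle_mean.
by apply/funext => t; rewrite horner_coef.
Qed.

End polynomial_approximation.

(** * From moments to bounded continuous functions *)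

Section semicircle_law.
Context {R : realType}.
Variables (beta : R) (rho : nat -> R -> R).
Hypothesis beta0 : 0 < beta.
Hypothesis hrho : forall N, (2 <= N)%N -> is_level_density beta N (rho N).
Local Notation radius n := ((@fte_radius R n.+1)%:num : R).
Local Notation sigma n := (Num.sqrt (2 * n.+1%:R) : R).
Local Notation mean n := (@sphere_mean R n beta (radius n)).

(** A product [c * mass] equal to 1 with [0 <= c] forces a positive mass, without a lower estimate
    of the weight. *)
Lemma sphere_mass_gt0 n : (0 < n)%N ->
  0 < @sphere_integral R n beta (radius n) (fun=> 1).
Proof.
move=> n0; have [|c [c0 c1 _]] := level_density_sphere_integral beta0 n0 (hrho _) ltr01.
  exact: n0.
have : 0 < c * @sphere_integral R n beta (radius n) (fun=> 1) by rewrite c1.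
by rewrite pmulr_rgt0// lt_def c0 andbT; apply: contra_eq_neq c1 => ->; rewrite mul0r eq_sym oner_eq0.
Qed.

Lemma sigma_gt0 n : 0 < sigma n.
Proof. by rewrite sqrtr_gt0 mulr_gt0. Qed.

Lemma level_density_mean n (h : R -> R) : (0 < n)%N -> measurable_fun setT h ->
  (exists C, forall t, `|h t| <= C) ->
  \int[lebesgue_measure]_t (h t * (sigma n * rho n.+1 (sigma n * t))) =
  mean n (fun x => h (tnth x ord0 / sigma n)).
Proof.
move=> n0 mh bh.
have [|c [c0 c1 hc]] := level_density_sphere_integral beta0 n0 (hrho _) (sigma_gt0 n).
  exact: n0.
have S0 := lt0r_neq0 (sphere_mass_gt0 n0).
rewrite hc// /sphere_mean mulrC; congr (_ * _).
by apply: (mulIf S0); rewrite c1 mulVf.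
Qed.

Lemma sphere_good_coord n (h : R -> R) : (0 < n)%N -> continuous h ->
  sphere_good (radius n) (fun x : n.+1.-tuple R => h (tnth x ord0 / sigma n)).
Proof.
move=> n0 ch; have r0 := @fte_radius_gt0 R n n0.
have cg : continuous (fun t : R => h (t / sigma n)).
  move=> t; apply: (cvg_comp (fun t : R => t / sigma n) h); last exact: ch.
  by apply: cvgM; [exact: cvg_id|exact: cvg_cst].
split.
  exact: (measurableT_comp (continuous_measurable_fun cg) (measurable_tnth ord0)).
have rr : - radius n <= radius n by rewrite lerNl (le_trans _ (ltW r0))// oppr_le0 ltW.
have [|c _ hcm] := @EVT_max R (fun t => `|h (t / sigma n)|) _ _ rr.
  by apply: continuous_subspaceT => t; apply: cvg_norm; exact: cg.
exists `|h (c / sigma n)| => x hx; apply: (hcm (tnth x ord0)).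
by rewrite in_itv/= -ler_norml; exact: hx.
Qed.

(** By exchangeability all coordinates have the same mean power, so the k-th power of the first one
    may be replaced by [psum k] divided by the dimension. *)
Lemma mean_power n k : (0 < n)%N ->
  mean n (fun x => (tnth x ord0 / sigma n) ^+ k) = joint_moment beta n [:: k].
Proof.
move=> n0; have r0 := @fte_radius_gt0 R n n0; have m0 := sphere_mass_gt0 n0.
have s0 := lt0r_neq0 (sigma_gt0 n).
have gX i : sphere_good (radius n) (fun x : n.+1.-tuple R => tnth x i ^+ k).
  split; first by apply: measurable_funX; exact: measurable_tnth.
  exists (radius n ^+ k) => x hx; rewrite normrX lerXn2r// ?nnegrE ?(ltW r0)//.
have -> : (fun x : n.+1.-tuple R => (tnth x ord0 / sigma n) ^+ k) =
    fun x => sigma n ^- k * tnth x ord0 ^+ k.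
  by apply/funext => x; rewrite exprMn exprVn mulrC.
rewrite sphere_meanZ// /joint_moment /=.
have -> : pprod [:: k] = fun x : n.+1.-tuple R => \sum_(i < n.+1) tnth x i ^+ k.
  by apply/funext => x; rewrite /pprod big_seq1.
rewrite sphere_mean_sum//.
have E i : mean n (fun x => tnth x i ^+ k) = mean n (fun x => tnth x ord0 ^+ k).
  rewrite /sphere_mean (sphere_integral_coord (h := fun t => t ^+ k))//.
  exists (radius n ^+ k) => t tr; rewrite normrX lerXn2r// ?nnegrE ?(ltW r0)//.
under eq_bigr do rewrite E.
set m := mean n _; rewrite sumr_const card_ord -[m *+ _]mulr_natl expr1 addn0 invfM mulrACA mulfV ?pnatr_eq0//.
by rewrite mul1r mulrC.
Qed.

Lemma cvg_mean_power k : mean n (fun x => (tnth x ord0 / sigma n) ^+ k) @[n --> \oo]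
  --> (semicircle_moment k : R).
Proof.
have mo0 : semicircle_moment 0 = 1 :> R.
  transitivity (@semicircle_mean R (fun=> 1)); last exact: semicircle_mass.
  by rewrite /semicircle_moment; congr semicircle_mean; apply/funext => t; rewrite expr0.
have moS := moment_convolution mo0 (@semicircle_moment_rec R).
have := @cvg_joint_moment R beta beta0 sphere_mass_gt0 _ mo0 moS [:: k].
rewrite big_seq1; apply: cvg_trans; apply: near_eq_cvg; near=> n.
by rewrite mean_power//; near: n; exact: nbhs_infty_gt.
Unshelve. all: by end_near. Qed.

Lemma cvg_mean_horner (p : {poly R}) :
  mean n (fun x => p.[tnth x ord0 / sigma n]) @[n --> \oo]
  --> (semicircle_mean (fun t => p.[t]) : R).
Proof.
rewrite semicircle_mean_horner.
apply: (@cvg_trans _ ((\sum_(i < size p) p`_i *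
  mean n (fun x => (tnth x ord0 / sigma n) ^+ i)) @[n --> \oo])); last first.
  apply: cvg_bigsum => i _; apply: cvgM; first exact: cvg_cst.
  exact: cvg_mean_power.
apply: near_eq_cvg; near=> n.
have n0 : (0 < n)%N by near: n; exact: nbhs_infty_gt.
have r0 := @fte_radius_gt0 R n n0; have m0 := sphere_mass_gt0 n0.
have gX (i : nat) := sphere_good_coord n0 (@exprn_continuous R i).
under eq_bigr do rewrite -sphere_meanZ//.
rewrite -(sphere_mean_sum beta0 r0 m0) => [|i]; last exact: sphere_goodZ.
by congr (sphere_mean _ _); apply/funext => x; rewrite horner_coef.
Unshelve. all: by end_near. Qed.

Lemma sphere_mean_dist n (F G H : R -> R) : (0 < n)%N ->
  continuous F -> continuous G -> continuous H ->
  (forall t, `|F t - G t| <= H t) ->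
  `|mean n (fun x => F (tnth x ord0 / sigma n)) - mean n (fun x => G (tnth x ord0 / sigma n))|
  <= mean n (fun x => H (tnth x ord0 / sigma n)).
Proof.
move=> n0 cF cG cH FGH.
have r0 := @fte_radius_gt0 R n n0; have m0 := sphere_mass_gt0 n0.
have gF := sphere_good_coord n0 cF; have gG := sphere_good_coord n0 cG.
have gH := sphere_good_coord n0 cH.
rewrite ler_norml lerBrDr addrC lerBlDr lerBlDr; apply/andP; split.
  rewrite -sphere_meanD//; apply: le_sphere_mean => //; first exact: sphere_goodD.
  by move=> x _; have := FGH (tnth x ord0 / sigma n); rewrite ler_norml => /andP[? ?]; lra.
rewrite -sphere_meanD//; apply: le_sphere_mean => //; first exact: sphere_goodD.
by move=> x _; have := FGH (tnth x ord0 / sigma n); rewrite ler_norml => /andP[? ?]; lra.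
Qed.

Lemma cvg_mean_bounded (f : R -> R) (M : R) : continuous f -> (forall t, `|f t| <= M) ->
  mean n (fun x => f (tnth x ord0 / sigma n)) @[n --> \oo] --> semicircle_mean f.
Proof.
move=> cf fM; apply/cvgrPdist_le => eps eps0.
(* Five parts: one for the polynomial under the semicircle, one for the convergence of polynomial
   means, and [delta + 2 * delta] for the majorant on the sphere. *)
pose delta := eps / 5.
have d0 : 0 < delta by rewrite divr_gt0.
have [p [K [D [/andP[D0 Dd] hp hpK]]]] := polynomial_majorant cf fM d0.
have cp := @continuous_horner R p.
have cX k : continuous (fun t : R => t ^+ k) by move=> t; exact: exprn_continuous.
have c1 : continuous (fun _ : R => 1 : R) by move=> t; exact: cvg_cst.
have cc : continuous (fun _ : R => delta) by move=> t; exact: cvg_cst.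
have cDX : continuous (fun t : R => D * t ^+ (2 * K)).
  by move=> t; apply: cvgM; [exact: cvg_cst|exact: cX].
have cH : continuous (fun t : R => delta + D * t ^+ (2 * K)).
  by move=> t; apply: cvgD; [exact: cvg_cst|exact: cDX].
(* The semicircle lives on [-1, 1], so this moment is at most 1 for every [K]; the moments on the
   sphere are then eventually at most 2. *)
have mo1 : semicircle_moment (2 * K) < 2 :> R.
  apply: (@le_lt_trans _ _ 1); last by rewrite ltr1n.
  rewrite -semicircle_mass; apply: le_semicircle_mean => // t t1.
  by rewrite (le_trans (ler_norm _))// normrX exprn_ile1.
have sc : `|semicircle_mean f - semicircle_mean (fun t => p.[t])| <= delta.
  have dE : semicircle_mean (fun=> delta) = delta :> R.
    rewrite -[RHS]mulr1 -semicircle_mass -semicircle_meanZ//.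
    by congr semicircle_mean; apply/funext => t; rewrite mulr1.
  rewrite -[leRHS]dE ler_norml lerBrDr addrC lerBlDr lerBlDr -!semicircle_meanD//.
  have fp t : `|t| <= 1 -> `|f t - p.[t]| <= delta.
    by move=> t1; apply: hp; rewrite (le_trans t1)// ler1n.
  apply/andP; split; apply: le_semicircle_mean => //.
  - by move=> t; apply: cvgD; [exact: cf|exact: cc].
  - by move=> t /fp; rewrite ler_norml => /andP[? ?]; lra.
  - by move=> t; apply: cvgD; [exact: cc|exact: cp].
  - by move=> t /fp; rewrite ler_norml => /andP[? ?]; lra.
have e1 : \forall n \near \oo,
    mean n (fun x => (tnth x ord0 / sigma n) ^+ (2 * K)) <= 2.
  by move/cvgr_le : (@cvg_mean_power (2 * K)%N) => /(_ _ mo1).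
have e2 : \forall n \near \oo, `|semicircle_mean (fun t => p.[t])
    - mean n (fun x => p.[tnth x ord0 / sigma n])| <= delta.
  by move/cvgrPdist_le : (@cvg_mean_horner p) => /(_ _ d0).
near=> n.
have n0 : (0 < n)%N by near: n; exact: nbhs_infty_gt.
have r0 := @fte_radius_gt0 R n n0; have m0 := sphere_mass_gt0 n0.
have h1 : mean n (fun x => (tnth x ord0 / sigma n) ^+ (2 * K)) <= 2.
  by near: n; exact: e1.
have h2 : `|semicircle_mean (fun t => p.[t]) - mean n (fun x => p.[tnth x ord0 / sigma n])|
    <= delta.
  by near: n; exact: e2.
have h3 := sphere_mean_dist n0 cf cp cH hpK.
have h4 : mean n (fun x => delta + D * (tnth x ord0 / sigma n) ^+ (2 * K)) <= 3 * delta.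
  have gX := sphere_good_coord n0 (cX (2 * K)%N).
  rewrite sphere_meanD//; [|exact: sphere_good_cst|exact: sphere_goodZ].
  rewrite sphere_mean_cst// sphere_meanZ//.
  have : D * mean n (fun x => (tnth x ord0 / sigma n) ^+ (2 * K)) <= delta * 2.
    apply: (@le_trans _ _ (D * 2)); first by rewrite ler_wpM2l.
    by rewrite ler_wpM2r.
  by lra.
have e5 : eps = 5 * delta by rewrite /delta; field.
move: (mean n _) (mean n _) (mean n _) h2 h3 h4 sc => a b c.
move: (semicircle_mean _) (semicircle_mean _) => u v.
rewrite !ler_norml e5 => /andP[? ?] /andP[? ?] ? /andP[? ?].
by apply/andP; split; lra.
Unshelve. all: by end_near. Qed.

End semicircle_law.

Theorem theorem1 (R : realType) (beta : R) (hbeta : 0 < beta)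
  (rho : nat -> R -> R)
  (hrho : forall N : nat, (2 <= N)%N -> is_level_density beta N (rho N))
  (f : R -> R) (hf : continuous_compact_support f) :
  (fun N : nat => \int[lebesgue_measure]_x
     (f x * (Num.sqrt (2 * N%:R) * rho N (Num.sqrt (2 * N%:R) * x))))
    @ \oo --> \int[lebesgue_measure]_x (f x * semicircle x).
Proof.
case: hf => cf /compact_bounded[B [_ hB]].
(* Compact support confines the nonzero values of [f] to a bounded interval, so [f] is bounded. *)
have [M fM] : exists M, forall t, `|f t| <= M.
  apply: (@bounded_compact_support R f (- (`|B| + 1)) (`|B| + 1) cf) => t ht.
  apply/eqP; apply: contraT => ft.
  have /(hB (`|B| + 1 / 2)) : B < `|B| + 1 / 2.
    by rewrite (le_lt_trans (ler_norm B))// ltrDl.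
  move=> /(_ t); rewrite /=; have tc : closure [set x | f x != 0] t.
    exact: subset_closure.
  move=> /(_ tc); rewrite ler_norml => /andP[? ?].
  by case: ht => ?; lra.
(* With [N = n.+1] the condition [2 <= N] becomes [0 < n], which holds eventually. *)
rewrite -cvg_shiftS.
apply: cvg_trans (cvg_mean_bounded hbeta hrho cf fM).
apply: near_eq_cvg; near=> n.
symmetry; apply: level_density_mean => //.
- by near: n; exact: nbhs_infty_gt.
- exact: continuous_measurable_fun.
- by exists M.
Unshelve. all: by end_near. Qed.
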